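(* Suppose Hypothesis (R) or Hypothesis (R1) (stated in the context) holds. For each $N\ge1$ let $x=(x_1,\dots,x_N)\in\mathbb R^N$ be given, put $\mu^N:=\frac1N\sum_{i=1}^N\delta_{x_i}$, and suppose $\mu^N\to\mu$ in $(\mathcal P_2(\mathbb R),\mathcal W_2)$ as $N\to+\infty$. Then for $t\in[0,T]$ $$\lim_{N\to+\infty}V_N(t,x_1,\dots,x_N)=\mathcal V(t,\mu),$$ at the rate $$|V_N(t,x_1,\dots,x_N)-\mathcal V(t,\mu)|\le\tilde C_{71}\mathcal W_2(\mu^N,\mu)+\tilde C_{72}\Big[\mathcal W_2^2(\mu^N,\mu)+\Big(\int_{\mathbb R}y^2\mu^N(dy)+\int_{\mathbb R}y^2\mu(dy)\Big)\mathcal W_2(\mu^N,\mu)\Big],$$ where $\tilde C_{71}=\tilde C_2(C^L_{11}+C^U_{11}+C^L_{10}+C^U_{10})$ and $\tilde C_{72}=\frac12\tilde C_2(C^L_{11}+C^U_{11})$.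
   Context: **Setting.** $T,\lambda>0$, $\sigma\in\mathbb R$, $\Theta=\mathbb R$. $\mathcal P_2(\mathbb R)$ is the set of Borel probability measures on $\mathbb R$ with finite second moment, $\mathcal W_2$ the 2-Wasserstein distance. $\partial_\mu$ denotes the intrinsic (Wasserstein/Lions) derivative; the extra variable it creates is written after the measure variable. Data: $f:[0,T]\times\Theta\times\mathbb R\times\mathcal P_2(\mathbb R)\to\mathbb R$ and $L,U:\mathbb R\to\mathbb R$. **Standing assumption.** (1) $(t,\theta)\mapsto f(t,\theta,0,\delta_0)$ is continuous; (2) $\partial_tf$ is bounded and $f$ has bounded derivatives with respect to $(\theta,x,\mu)$ up to second order; (3) for $\varphi\in\{L,U\}$: $\varphi\ge0$, $|\varphi'(x)|\le C^\varphi_{11}|x|+C^\varphi_{10}$, $|\varphi''(x)|\le C^\varphi_{20}$ for constants $C^\varphi_{11},C^\varphi_{10},C^\varphi_{20}$; (4) there are $\alpha\in(0,2)$, $C_g>0$ with $|L(x)|+|U(x)|\le C_g(|x|^{2-\alpha}+1)$. **Control problem.** For $s\in[0,T]$, $\mathcal U^{ad}_s$ is the set of (weak) admissible controls: a complete probability space with independent real Brownian motions $W^0,W^1,W^2,\dots$ started at time $s$, and a $\Theta$-valued process $\theta$ on $[s,T]$ adapted to the augmented filtration they generate, such that for every $N$ the system below has a (pathwise unique) solution. For $x\in\mathbb R^N$, $$dX^{\theta,i}_N(t)=f\Big(t,\theta(t),X^{\theta,i}_N(t),\tfrac1N\sum_{j=1}^N\delta_{X^{\theta,j}_N(t)}\Big)dt+\sigma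 dW^0(t),\quad X^{\theta,i}_N(s)=x_i,$$ $$J_N(s,\theta,x)=\mathbb E\Big[\tfrac1N\sum_i\int_s^TL(X^{\theta,i}_N(t))dt+\tfrac1N\sum_iU(X^{\theta,i}_N(T))+\tfrac\lambda2\int_s^T|\theta(t)|^2dt\Big],$$ $$V_N(s,x)=\inf_{\theta\in\mathcal U^{ad}_s}J_N(s,\theta,x).$$ For $\varepsilon>0$, $V^\varepsilon_N$ is defined in the same way with the dynamics of the $i$-th particle perturbed by the additional term $\varepsilon\,dW^i(t)$. **Lift.** For $\mu^N=\frac1N\sum_{i=1}^N\delta_{x_i}$ set $\mathcal V(t,\mu^N):=V_N(t,x_1,\dots,x_N)$ (well defined: depends only on the measure); $\mathcal V(t,\cdot)$ also denotes its unique continuous (locally Lipschitz) extension to $(\mathcal P_2(\mathbb R),\mathcal W_2)$. **The constant $\tilde C_2$.** $\tilde C_2=\tilde C_2(f,\lambda^{-1/2},T)$ denotes a constant, independent of $N$ and $\varepsilon$, such that for all $N\ge1$, $\varepsilon>0$, $1\le i\le N$, $(t,x)\in[0,T]\times\mathbb R^N$: $|\partial_{x_i}V^\varepsilon_N(t,x)|\le\frac{\tilde C_2(C^L_{11}+C^U_{11})}N\big(1+|x_i|^2+\frac1N\sum_{j=1}^N|x_j|^2\big)^{1/2}+\frac{\tilde C_2(C^L_{10}+C^U_{10})}N$. **Hypothesis (R)** (with parameters $\Gamma_1,\Gamma_2\in\mathbb R$). For $\Gamma\in\mathbb R$ put $G_{N,i}(x,\Gamma)=\frac{\Gamma(C^L_{11}+C^U_{11})}N\big(1+|x_i|^2+\frac1N\sum_j|x_j|^2\big)^{1/2}+\frac{\Gamma(C^L_{10}+C^U_{10})}N$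 and $\mathcal A_{N,\Gamma_1,\Gamma_2}=\{(x,p)\in\mathbb R^N\times\mathbb R^N:\ -G_{N,i}(x,\Gamma_1)\le p_i\le G_{N,i}(x,\Gamma_2),\ 1\le i\le N\}$. Hypothesis (R) requires: (i) there is $\lambda_0>0$ such that for all $N\ge1$, $t\in[0,T]$, $\theta\in\Theta$, $(x,p)\in\mathcal A_{N,\Gamma_1,\Gamma_2}$: $\lambda_0+\sum_{i=1}^N\partial^2_{\theta\theta}f(t,\theta,x_i,\frac1N\sum_j\delta_{x_j})p_i\ge0$; (ii) there is $C^Q>0$ such that for the same $(N,t,\theta,x,p)$, all $i$, and all $\varphi\in\{|\partial^2_{x\theta}f|,|\partial^2_{xx}f|\}$, $\phi\in\{|\partial^2_{x\mu}f|,|\partial^2_{\theta\mu}f|\}$: $C^Q>\varphi(t,\theta,x_i,\frac1N\sum_j\delta_{x_j})Np_i+\phi(t,\theta,x_i,\frac1N\sum_j\delta_{x_j},x_i)Np_i$; (iii) $\lambda>\lambda_0$. **Hypothesis (R1)** (with parameters $\Gamma_1,\Gamma_2$). Hypothesis (R) holds with $\Gamma_1,\Gamma_2$, $U$ is convex, and $\tilde H_N(t,x,p):=\inf_{\theta\in\mathbb R}\{\frac\lambda2|\theta|^2+\sum_{i=1}^Nf(t,\theta,x_i,\frac1N\sum_j\delta_{x_j})p_i+\frac1N\sum_{i=1}^NL(x_i)\}$ is convex in $x$, in particular $\nabla^2_{xx}\tilde H_N(t,x,p)\ge0$ for all $(t,x,p)\in[0,T]\times\mathbb R^N\times\mathbb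 R^N$ (positive semidefinite order), $N\ge1$. In this statement (R) or (R1) is assumed for some parameters $\Gamma_1,\Gamma_2$. *)

(* Defs.v *)
From HB Require Import structures.
From mathcomp Require Import all_boot all_order all_algebra.
From mathcomp Require Import finmap.
From mathcomp Require Import all_classical all_reals all_analysis.
From mathcomp Require Import measurable_realfun.

Set Implicit Arguments.
Unset Strict Implicit.
Unset Printing Implicit Defensive.
Import Order.TTheory GRing.Theory Num.Theory.
Import numFieldNormedType.Exports.

Local Open Scope classical_set_scope.
Local Open Scope ring_scope.

Record P2 (R : realType) := MkP2 {
  P2_prob :> probability R R ;
  P2_fin : (\int[P2_prob]_y (y ^+ 2)%:E < +oo)%E }.

Definition second_moment (R : realType) (mu : P2 R) : R :=
  \int[mu]_y (y ^+ 2).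

Section transport.
Context (R : realType).

Definition coupling (mu nu : P2 R) (g : probability (R * R)%type R) :=
  forall A : set R, measurable A ->
    g (A `*` setT) = mu A /\ g (setT `*` A) = nu A.

Definition transport_cost (g : probability (R * R)%type R) : \bar R :=
  (\int[g]_z ((z.2 - z.1) ^+ 2)%:E)%E.

Definition W2 (mu nu : P2 R) : R :=
  Num.sqrt (fine (ereal_inf [set transport_cost g | g in coupling mu nu])).

End transport.

Section dirac_P2.
Context (R : realType) (a : R).

Let dirac_fin : (\int[\d_a]_y (y ^+ 2)%:E < +oo :> \bar R)%E.
Proof.
rewrite integral_dirac//; first by rewrite diracT mul1e ltry.
by apply/measurable_EFinP; exact: exprn_measurable.
Qed.

Definition dirac_P2 : P2 R := @MkP2 R \d_a dirac_fin.

End dirac_P2.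

(* A configuration of N >= 1 particles is a row vector of length N = n.+1. *)
Section empirical.
Context (R : realType) (n : nat) (x : 'rV[R]_n.+1).

Definition emp_measure : set R -> \bar R :=
  mscale (n.+1%:R^-1)%:nng (msum (fun k => \d_(x 0 (inord k))) n.+1).

HB.instance Definition _ := Measure.on emp_measure.

Let emp_measure_setT : emp_measure setT = 1%E.
Proof.
rewrite /emp_measure /mscale /= /msum.
under eq_bigr => i _ do rewrite /= diracT.
by rewrite sumEFin sumr_const card_ord -EFinM mulVf.
Qed.

HB.instance Definition _ :=
  Measure_isProbability.Build _ _ _ emp_measure emp_measure_setT.

Let emp_fin : (\int[emp_measure]_y (y ^+ 2)%:E < +oo)%E.
Proof.
have mf : measurable_fun setT (fun y : R => (y ^+ 2)%:E).
  by apply/measurable_EFinP; exact: exprn_measurable.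
have f0 (y : R) : setT y -> (0 <= (y ^+ 2)%:E)%E by rewrite lee_fin sqr_ge0.
rewrite ge0_integral_mscale// ge0_integral_measure_sum//.
under eq_bigr do rewrite integral_dirac// diracT mul1e.
by rewrite sumEFin -EFinM ltry.
Qed.

Definition emp : P2 R := @MkP2 R emp_measure emp_fin.

End empirical.

Section derivatives.
Context (R : realType).

(* Lions derivative of F at mu: g(xi) is the L^2-gradient at xi of the lift
   xi |-> F(law of xi), where law(xi) = mu.  The pair (xi, xi + eta) is
   represented by its joint law gam, a coupling of mu and nu, so that
   E[g(xi) eta] = \int g(z.1) (z.2 - z.1) dgam and ||eta||_2^2 is the transport
   cost of gam; all couplings, not only the optimal ones, are tested. *)
Definition is_intrinsic_derivative (F : P2 R -> R) (mu : P2 R) (g : R -> R) :=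
  [/\ measurable_fun setT g,
      (\int[mu]_y (g y ^+ 2)%:E < +oo)%E &
      forall e : R, 0 < e -> exists2 d : R, 0 < d &
        forall (nu : P2 R) (gam : probability (R * R)%type R),
          coupling mu nu gam -> (transport_cost gam <= (d ^+ 2)%:E)%E ->
          `|F nu - F mu - \int[gam]_z (g z.1 * (z.2 - z.1))|
            <= e * Num.sqrt (fine (transport_cost gam))].

(* Derivative relative to D, one-sided at the end points of an interval. *)
Definition is_derivative_within (D : set R) (h : R -> R) (a l : R) :=
  (fun b => (h b - h a) / (b - a)) @ within (D `\ a) (nbhs a) --> l.

Definition derivable_bounded (K : R) (h : R -> R) (a : R) :=
  derivable h a 1 /\ `|derive1 h a| <= K.

Definition intrinsic_derivable_bounded (K : R) (F : P2 R -> R) (mu : P2 R) :=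
  exists2 g : R -> R, is_intrinsic_derivative F mu g & forall y, `|g y| <= K.

Definition partial_theta (F : R -> R -> R -> P2 R -> R) :=
  fun t theta x mu => derive1 (fun a => F t a x mu) theta.

Definition partial_x (F : R -> R -> R -> P2 R -> R) :=
  fun t theta x mu => derive1 (fun a => F t theta a mu) x.

Definition partial_thetamu (Fmu : R -> R -> R -> P2 R -> R -> R) :=
  fun t theta x mu y => derive1 (fun a => Fmu t a x mu y) theta.

Definition partial_xmu (Fmu : R -> R -> R -> P2 R -> R -> R) :=
  fun t theta x mu y => derive1 (fun a => Fmu t theta a mu y) x.

End derivatives.

Section standing.
Context (R : realType).

(* fmu t theta x mu y is the intrinsic derivative of f in mu, evaluated at y.  It
   is an explicit function because it is determined only mu-a.e. in y. *)
Definition bounded_derivatives (T : R) (f : R -> R -> R -> P2 R -> R)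
    (fmu : R -> R -> R -> P2 R -> R -> R) :=
  exists K : R, forall t theta x mu, 0 <= t <= T ->
    let D := @derivable_bounded R K in
    let Dmu := @intrinsic_derivable_bounded R K in
    [/\
      exists2 l : R,
        is_derivative_within `[0, T] (fun s => f s theta x mu) t l & `|l| <= K,
      [/\ D (fun a => f t a x mu) theta,
          D (fun a => f t theta a mu) x,
          is_intrinsic_derivative (f t theta x) mu (fmu t theta x mu) &
          forall y, `|fmu t theta x mu y| <= K],
      [/\ D (fun a => partial_theta f t a x mu) theta,
          D (fun a => partial_theta f t theta a mu) x &
          Dmu (partial_theta f t theta x) mu],
      [/\ D (fun a => partial_x f t a x mu) theta,
          D (fun a => partial_x f t theta a mu) x &
          Dmu (partial_x f t theta x) mu] &
      forall y,
      [/\ D (fun a => fmu t a x mu y) theta,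
          D (fun a => fmu t theta a mu y) x,
          D (fun a => fmu t theta x mu a) y &
          Dmu (fun nu => fmu t theta x nu y) mu]].

Definition cost_assumption (phi : R -> R) (C11 C10 C20 : R) :=
  forall x, [/\ 0 <= phi x,
    derivable phi x 1, derivable (derive1 phi) x 1,
    `|derive1 phi x| <= C11 * `|x| + C10 & `|derive1n 2 phi x| <= C20].

Definition growth_assumption (L U : R -> R) :=
  exists alpha Cg : R, [/\ 0 < alpha < 2, 0 < Cg &
    forall x, `|L x| + `|U x| <= Cg * (`|x| `^ (2 - alpha) + 1)].

Definition standing_assumption (T : R) (f : R -> R -> R -> P2 R -> R)
    (fmu : R -> R -> R -> P2 R -> R -> R) (L U : R -> R)
    (CL11 CL10 CL20 CU11 CU10 CU20 : R) :=
  [/\ {within `[0, T] `*` setT,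
        continuous (fun z : R * R => f z.1 z.2 0 (dirac_P2 0))},
      bounded_derivatives T f fmu,
      cost_assumption L CL11 CL10 CL20,
      cost_assumption U CU11 CU10 CU20 &
      growth_assumption L U].

End standing.

Section probability.
Context (R : realType) d (Om : measurableType d) (P : probability Om R).

Definition preimage_sets (X : Om -> R) : set (set Om) :=
  [set X @^-1` B | B in measurable].

Definition mutually_independent (I : choiceType) (G : I -> set (set Om)) :=
  forall (J : {fset I}) (A : I -> set Om),
    (forall i, i \in J -> G i (A i)) ->
    P (\bigcap_(i in [set` J]) A i) = (\prod_(i <- J) P (A i))%E.

Definition brownian (s T : R) (W : R -> Om -> R) :=
  [/\ forall t, s <= t <= T -> measurable_fun setT (W t),
      {ae P, forall w, W s w = 0},
      {ae P, forall w, {within `[s, T], continuous (fun t => W t w)}},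
      forall r t, s <= r -> r < t -> t <= T ->
        forall B : set R, measurable B ->
          P ((fun w => W t w - W r w) @^-1` B)
            = normal_prob 0 (Num.sqrt (t - r)) B &
      forall u : nat -> R, (forall k, s <= u k <= T) ->
        (forall k, u k <= u k.+1) ->
        mutually_independent
          (fun k => preimage_sets (fun w => W (u k.+1) w - W (u k) w))].

Definition generated_by (s t : R) (W : R -> Om -> R) : set (set Om) :=
  <<s [set A | exists2 r, s <= r <= t & preimage_sets (W r) A] >>.

Definition augmented_filtration (s : R) (W : nat -> R -> Om -> R) (t : R) :
    set (set Om) :=
  <<s [set A | (exists i, exists2 r, s <= r <= t & preimage_sets (W i r) A)
               \/ P.-negligible A] >>.

Definition adapted (s T : R) (F : R -> set (set Om)) (X : R -> Om -> R) :=
  forall t, s <= t <= T -> preimage_sets (X t) `<=` F t.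

End probability.

Record weak_control (R : realType) := WeakControl {
  wc_disp : measure_display ;
  wc_Om : measurableType wc_disp ;
  wc_P : probability wc_Om R ;
  wc_W : nat -> R -> wc_Om -> R ;
  wc_theta : R -> wc_Om -> R }.
Arguments wc_W {R} w.
Arguments wc_theta {R} w.

(* The conditions on a control that do not involve the particle system.  Joint
   measurability is what makes the time integrals of theta meaningful. *)
Definition is_control_basis (R : realType) (s T : R) (c : weak_control R) :=
  [/\ measure_is_complete (wc_P c),
      forall i, brownian (wc_P c) s T (wc_W c i),
      mutually_independent (wc_P c) (fun i => generated_by s T (wc_W c i)),
      measurable_fun (`[s, T] `*` setT)
        (fun z : R * wc_Om c => wc_theta c z.1 z.2) &
      adapted s T (augmented_filtration (wc_P c) s (wc_W c)) (wc_theta c)].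

Section control_problem.
Context (R : realType) (T lambda sigma : R) (f : R -> R -> R -> P2 R -> R)
  (L U : R -> R).

(* eps is the intensity of the idiosyncratic noise W^1, W^2, ...; the original
   system is eps = 0.  The noise is additive, so the equation is pathwise. *)
Definition is_solution (eps s : R) (c : weak_control R) (n : nat)
    (x : 'rV[R]_n.+1) (X : R -> wc_Om c -> 'rV[R]_n.+1) :=
  [/\ forall i, adapted s T (augmented_filtration (wc_P c) s (wc_W c))
                  (fun t w => X t w 0 i),
      {ae wc_P c, forall w i,
        {within `[s, T], continuous (fun t => X t w 0 i)}} &
      {ae wc_P c, forall w i t, s <= t <= T ->
        let b := fun r => f r (wc_theta c r w) (X r w 0 i) (emp (X r w)) in
        lebesgue_measure.-integrable `[s, t] (EFin \o b) /\
        X t w 0 i = x 0 i + \int[lebesgue_measure]_(r in `[s, t]) b r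
          + sigma * (wc_W c 0%N t w - wc_W c 0%N s w)
          + eps * (wc_W c i.+1 t w - wc_W c i.+1 s w)}].
Arguments is_solution eps s c {n} x X.

Definition well_posed (eps s : R) (c : weak_control R) :=
  forall (n : nat) (x : 'rV[R]_n.+1),
    (exists X, is_solution eps s c x X) /\
    forall X Y, is_solution eps s c x X ->
      is_solution eps s c x Y ->
      {ae wc_P c, forall w t, s <= t <= T -> X t w = Y t w}.

Definition admissible (eps s : R) (c : weak_control R) : Prop :=
  is_control_basis s T c /\ well_posed eps s c.

Definition state (eps s : R) (c : weak_control R) (n : nat) (x : 'rV[R]_n.+1) :
    R -> wc_Om c -> 'rV[R]_n.+1 :=
  xget (fun _ _ => 0) [set X | is_solution eps s c x X].
Arguments state eps s c {n} x.

Definition J (eps s : R) (n : nat) (c : weak_control R) (x : 'rV[R]_n.+1) :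
    \bar R :=
  let X := state eps s c x in
  (\int[wc_P c]_w
    ((n.+1%:R^-1)%:E * (\sum_(i < n.+1)
        \int[lebesgue_measure]_(t in `[s, T]) (L (X t w 0 i))%:E)
     + (n.+1%:R^-1)%:E * (\sum_(i < n.+1) (U (X T w 0 i))%:E)
     + (lambda / 2)%:E *
        \int[lebesgue_measure]_(t in `[s, T]) (`|wc_theta c t w| ^+ 2)%:E))%E.

(* V^eps_N for N = n.+1, hence V_N when eps = 0.  The infimum is over a
   comprehension because weak_control lives in too large a universe for set. *)
Definition V (eps : R) (n : nat) (s : R) (x : 'rV[R]_n.+1) : R :=
  fine (ereal_inf
    [set j | exists c : weak_control R, admissible eps s c /\ j = J eps s c x]).

Definition is_lift (Vc : R -> P2 R -> R) :=
  forall t, 0 <= t <= T ->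
    (forall n (x : 'rV[R]_n.+1), Vc t (emp x) = V 0 t x) /\
    (forall mu e, 0 < e -> exists2 d, 0 < d &
      forall nu, W2 nu mu < d -> `|Vc t nu - Vc t mu| < e).

End control_problem.

Section hypotheses.
Context (R : realType) (T lambda sigma : R) (f : R -> R -> R -> P2 R -> R)
  (fmu : R -> R -> R -> P2 R -> R -> R) (L U : R -> R)
  (CL11 CL10 CU11 CU10 : R).

Definition G (n : nat) (i : 'I_n.+1) (x : 'rV[R]_n.+1) (Gam : R) : R :=
  Gam * (CL11 + CU11) / n.+1%:R *
    Num.sqrt (1 + `|x 0 i| ^+ 2
              + n.+1%:R^-1 * \sum_(j < n.+1) `|x 0 j| ^+ 2)
  + Gam * (CL10 + CU10) / n.+1%:R.

Definition gradient_bound (C2 : R) :=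
  forall (n : nat) (eps t : R) (i : 'I_n.+1) (x : 'rV[R]_n.+1),
    0 < eps -> 0 <= t <= T ->
    let Veps : 'rV[R]_n.+1 -> R := V T lambda sigma f L U eps t in
    derivable Veps x (delta_mx 0 i) /\
    `|'D_(delta_mx 0 i) Veps x| <= G i x C2.

Definition AN (n : nat) (Gam1 Gam2 : R) : set ('rV[R]_n.+1 * 'rV[R]_n.+1) :=
  [set xp : 'rV[R]_n.+1 * 'rV[R]_n.+1 | forall i, - G i xp.1 Gam1 <= xp.2 0 i <= G i xp.1 Gam2].

Definition hypothesis_R (Gam1 Gam2 : R) :=
  exists lambda0 : R, [/\ 0 < lambda0,
    forall n t theta (x p : 'rV[R]_n.+1), 0 <= t <= T ->
      @AN n Gam1 Gam2 (x, p) ->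
      0 <= lambda0 + \sum_(i < n.+1)
        partial_theta (partial_theta f) t theta (x 0 i) (emp x) * p 0 i,
    exists2 CQ : R, 0 < CQ &
      forall n t theta (x p : 'rV[R]_n.+1), 0 <= t <= T ->
      @AN n Gam1 Gam2 (x, p) ->
      forall i (phi : R -> R -> R -> P2 R -> R)
        (psi : R -> R -> R -> P2 R -> R -> R),
        phi = partial_x (partial_theta f) \/ phi = partial_x (partial_x f) ->
        psi = partial_xmu fmu \/ psi = partial_thetamu fmu ->
        `|phi t theta (x 0 i) (emp x)| * n.+1%:R * p 0 i
        + `|psi t theta (x 0 i) (emp x) (x 0 i)| * n.+1%:R * p 0 i < CQ &
    lambda0 < lambda].

Definition Htilde (n : nat) (t : R) (x p : 'rV[R]_n.+1) : R :=
  inf [set lambda / 2 * `|theta| ^+ 2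
           + \sum_(i < n.+1) f t theta (x 0 i) (emp x) * p 0 i
           + n.+1%:R^-1 * \sum_(i < n.+1) L (x 0 i) | theta in [set: R]].

Definition hypothesis_R1 (Gam1 Gam2 : R) :=
  [/\ hypothesis_R Gam1 Gam2,
      convex_function (E := R^o) setT U &
      forall n t (p : 'rV[R]_n.+1), 0 <= t <= T ->
        convex_function (E := 'rV[R]_n.+1) setT (fun x => Htilde t x p)].

End hypotheses.

(* Main.v *)
(* The noisy value function V^eps_N has partial derivatives of order 1/N, so integrating along a segment and applying the Cauchy-Schwarz inequality bounds |V^eps_N(x) - V^eps_N(y)| by (a (1 + (m(x) + m(y)) / 2) + b) times the root mean square of x_i - y_i, where m is the empirical second moment. The bound passes to eps = 0: the noise is additive, hence the same controls are admissible for every eps, Gronwall's inequality compares the two particle systems path by path, and J^e <= (1 + c |e - e'|) J^e' + c |e - e'| with a constant that does not depend on the control. Finally, every coupling of two measures is approximated, together with its marginals and its cost, by matchings of N-point configurations with N large; continuity of the lift therefore turns the bound for matchings into the same bound with the Wasserstein distance, a bound slightly stronger than the stated rate. *)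
From HB Require Import structures.
Require Import Defs.
From mathcomp Require Import all_boot all_order all_algebra.
From mathcomp Require Import all_classical all_reals all_analysis.
From mathcomp Require Import measurable_realfun ring lra.
Set Implicit Arguments.
Unset Strict Implicit.
Unset Printing Implicit Defensive.
Import Order.TTheory GRing.Theory Num.Theory.
Import numFieldNormedType.Exports.
Local Open Scope classical_set_scope.
Local Open Scope ring_scope.

(** Several obstacles shape the proof. The partial derivatives of the noisy value function exist and
    have a continuous majorant but are not known to be continuous, so they cannot simply be
    integrated along a segment: local increments are estimated coordinate by coordinate and then
    added up by a real induction. Controls are jointly measurable and adapted, with no integrability
    in time; the drift inherits its integrability from a solution at another noise level, and
    adaptedness of time integrals comes from sample means over finitely many times. The cost is an
    integral whose integrand need not be measurable in the outcome, hence it is treated as a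
    supremum over simple functions. The comparison of costs has a multiplicative factor because the
    error contains the energy of the control, which no constant bounds uniformly; as [lambda > 0],
    this energy is at most [2 / lambda] times the cost. The Gronwall constants grow with N, which is
    harmless since the noise vanishes for fixed N; the bound that survives is uniform in N because
    it comes from the gradient alone. *)

(** * From local to global bounds for functions of one real variable *)

(** Real induction: let [c] be the supremum of the points up to which the bound holds. The local
    bound to the left of [c] shows that [c] is such a point, and the local bound to its right
    excludes [c < b]. This takes the place of the mean value theorem for paths that may fail to be
    differentiable. *)
Lemma variation_le (R : realType) (phi Q : R -> R) (a b : R) : a <= b ->
  {in `[a, b] &, {homo Q : x y / x <= y}} ->
  (forall s, s \in `[a, b] -> exists2 d : R, 0 < d &
    forall r, r \in `[a, b] -> `|r - s| < d -> `|phi r - phi s| <= `|Q r - Q s|) ->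
  `|phi b - phi a| <= Q b - Q a.
Proof.
move=> ab Qm loc.
pose E := [set s | s \in `[a, b] /\ `|phi s - phi a| <= Q s - Q a].
have aab : a \in `[a, b] by rewrite in_itv /= lexx ab.
have Ea : E a by split=> //; rewrite !subrr normr0.
have Eub : has_sup E.
  split; first by exists a.
  by exists b => s [] /itvP ->.
set c := sup E.
have cab : c \in `[a, b].
  rewrite in_itv /= (ub_le_sup _ Ea) ?Eub.2 //=; last by case: Eub.
  by apply: ge_sup; [exists a|move=> s [] /itvP ->].
have [d d0 dP] := loc _ cab.
have [s0 Es0 cs0] := sup_adherent d0 Eub.
have s0c : s0 <= c by apply: ub_le_sup => //; case: Eub.
case: Es0 => s0ab Es0.
have step r1 r2 : r1 \in `[a, b] -> r2 \in `[a, b] -> r1 <= r2 ->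
    `|phi r2 - phi r1| <= `|Q r2 - Q r1| -> E r1 -> E r2.
  move=> r1ab r2ab r12 H [_ Er1]; split => //.
  have -> : phi r2 - phi a = (phi r2 - phi r1) + (phi r1 - phi a) by ring.
  have Q12 : Q r1 <= Q r2 by apply: Qm.
  apply: le_trans (ler_normD _ _) _.
  rewrite (ger0_norm (_ : 0 <= Q r2 - Q r1)) ?subr_ge0 // in H.
  by move: H Er1; lra.
have Ec : E c.
  apply: (step s0) => //; rewrite distrC (distrC (Q c)); apply: dP => //.
  by rewrite distrC ger0_norm ?subr_ge0 //; move: cs0; rewrite -/c; lra.
have [cb|cb] := eqVneq c b; first by rewrite -cb; case: Ec.
have cltb : c < b by rewrite lt_neqAle cb; case/andP: (cab).
pose r := Num.min b (c + d / 2).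
have cr : c < r by rewrite lt_min cltb ltrDl divr_gt0.
have rb : r <= b by rewrite ge_min lexx.
have rab : r \in `[a, b].
  by rewrite in_itv /= rb andbT (le_trans _ (ltW cr)) // (itvP cab).
have Er : E r.
  apply: (step c) => //; first exact: ltW.
  apply: dP => //; rewrite ger0_norm ?subr_ge0 ?(ltW cr) //.
  have : r <= c + d / 2 by rewrite ge_min lexx orbT.
  by move: d0; lra.
have := ub_le_sup Eub.2 Er; rewrite -/c leNgt.
by rewrite cr.
Qed.

(* The slack [eta] turns a bound on the derivative into a local Lipschitz bound. *)
Lemma local_lipschitz (R : realType) (phi : R -> R) (a b C : R) : a <= b ->
  (forall eta, 0 < eta -> forall s, s \in `[a, b] -> exists2 d : R, 0 < d &
    forall r, r \in `[a, b] -> `|r - s| < d ->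
      `|phi r - phi s| <= (C + eta) * `|r - s|) ->
  `|phi b - phi a| <= C * (b - a).
Proof.
move=> ab loc; apply/ler_addgt0Pr => e e0.
(* The slope must be nonnegative for the majorant to be monotone; the local bound at [a], tested at
   a nearby point, forces this. *)
have C0 eta : 0 < eta -> a < b -> 0 <= C + eta.
  move=> eta0 altb.
  have aab : a \in `[a, b] by rewrite in_itv /= lexx ab.
  have [d d0 dP] := loc eta eta0 a aab.
  pose r := Num.min b (a + d / 2).
  have ar : a < r by rewrite lt_min altb ltrDl divr_gt0.
  have rab : r \in `[a, b] by rewrite in_itv /= ltW //= ge_min lexx.
  have rd : `|r - a| < d.
    rewrite ger0_norm ?subr_ge0 ?(ltW ar) //.
    have : r <= a + d / 2 by rewrite ge_min lexx orbT.
    by move: d0; lra.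
  have := le_trans (normr_ge0 _) (dP _ rab rd).
  by rewrite pmulr_lge0 // normr_gt0 subr_eq0 gt_eqF.
move: ab; rewrite le_eqVlt => /predU1P[->|altb].
  by rewrite !subrr normr0 mulr0 add0r ltW.
pose eta := e / (b - a).
have eta0 : 0 < eta by rewrite divr_gt0 // subr_gt0.
have -> : C * (b - a) + e = (C + eta) * b - (C + eta) * a.
  by rewrite /eta; field; rewrite subr_eq0 gt_eqF.
apply: (@variation_le _ phi (fun s => (C + eta) * s) a b (ltW altb)).
  by move=> x y _ _ xy /=; apply: ler_wpM2l => //; apply: C0.
move=> s sab; have [d d0 dP] := loc eta eta0 s sab; exists d => // r rab rsd.
by rewrite -mulrBr normrM (ger0_norm (C0 _ eta0 altb)); exact: dP.
Qed.

Lemma derivable_lipschitz (R : realType) (phi : R -> R) (a b C : R) : a <= b ->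
  (forall s, s \in `[a, b] -> derivable phi s 1 /\ `|derive1 phi s| <= C) ->
  `|phi b - phi a| <= C * (b - a).
Proof.
move=> ab H.
have [||c cab ->] := @MVT_segment R phi (derive1 phi) a b ab.
- move=> x xab; rewrite derive1E; apply/derivableP.
  by apply: (H _ _).1; apply: subset_itv_oo_cc xab.
- by apply: derivable_within_continuous => x /H [].
by rewrite normrM (ger0_norm (_ : 0 <= b - a)) ?subr_ge0 // ler_wpM2r ?subr_ge0 // (H _ cab).2.
Qed.

(** * Empirical measures *)

Section empirical.
Context (R : realType).

Definition mean (n : nat) (u : 'I_n.+1 -> R) : R := n.+1%:R^-1 * \sum_(i < n.+1) u i.

Lemma ler_mean n (u v : 'I_n.+1 -> R) : (forall i, u i <= v i) -> mean u <= mean v.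
Proof. by move=> uv; rewrite ler_wpM2l ?invr_ge0 ?ler0n // ler_sum. Qed.

Lemma mean_ge0 n (u : 'I_n.+1 -> R) : (forall i, 0 <= u i) -> 0 <= mean u.
Proof. by move=> u0; rewrite mulr_ge0 ?invr_ge0 ?ler0n // sumr_ge0. Qed.

Lemma meanZ n (u : 'I_n.+1 -> R) k : mean (fun i => k * u i) = k * mean u.
Proof. by rewrite /mean -mulr_sumr mulrCA. Qed.

Lemma meanD n (u v : 'I_n.+1 -> R) : mean (fun i => u i + v i) = mean u + mean v.
Proof. by rewrite /mean big_split mulrDr. Qed.

Lemma mean_cst n (k : R) : mean (fun _ : 'I_n.+1 => k) = k.
Proof.
by rewrite /mean sumr_const card_ord -[in LHS](mulr_natl k) mulrA mulVf ?mul1r // pnatr_eq0.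
Qed.

Lemma eq_mean n (u v : 'I_n.+1 -> R) : u =1 v -> mean u = mean v.
Proof. by move=> uv; rewrite /mean; congr (_ * _); apply: eq_bigr. Qed.

Lemma mean_le_sum n (u : 'I_n.+1 -> R) : (forall i, 0 <= u i) -> mean u <= \sum_i u i.
Proof.
move=> u0; rewrite ler_piMl ?sumr_ge0 // invf_le1 ?ltr0n //.
by rewrite ler1n.
Qed.

Lemma emp_set n (x : 'rV[R]_n.+1) (A : set R) :
  emp x A = (mean (fun i => \1_A (x 0 i)))%:E.
Proof.
rewrite /= /emp_measure /mscale /= /msum.
under eq_bigr => i _ do rewrite /= diracE inord_val.
by rewrite sumEFin -EFinM.
Qed.

Section joint.
Context (n : nat) (x y : 'rV[R]_n.+1).

(** The uniform law on the pairs [(x_i, y_i)]: the coupling of the two empirical measures that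
    matches particles by index. *)
Definition emp2_measure : set (R * R) -> \bar R :=
  mscale (n.+1%:R^-1)%:nng (msum (fun k => \d_(x 0 (inord k), y 0 (inord k))) n.+1).

HB.instance Definition _ := Measure.on emp2_measure.

Let emp2_measure_setT : emp2_measure setT = 1%E.
Proof.
rewrite /emp2_measure /mscale /= /msum.
under eq_bigr => i _ do rewrite /= diracT.
by rewrite sumEFin sumr_const card_ord -EFinM mulVf.
Qed.

HB.instance Definition _ :=
  Measure_isProbability.Build _ _ _ emp2_measure emp2_measure_setT.

Definition emp2 : probability (R * R)%type R := emp2_measure.

Lemma ge0_integral_emp2 (g : R * R -> R) : measurable_fun setT g ->
  (forall z, 0 <= g z) ->
  (\int[emp2]_z (g z)%:E = (mean (fun i => g (x 0 i, y 0 i)))%:E)%E.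
Proof.
move=> mg g0.
have mf : measurable_fun setT (fun z : R * R => (g z)%:E) by apply/measurable_EFinP.
have f0 (z : R * R) : setT z -> (0 <= (g z)%:E)%E by rewrite lee_fin.
rewrite ge0_integral_mscale// ge0_integral_measure_sum//.
under eq_bigr => i _ do rewrite integral_dirac// diracT mul1e inord_val.
by rewrite sumEFin -EFinM.
Qed.

Lemma coupling_emp2 : coupling (emp x) (emp y) emp2.
Proof.
move=> A mA; split; rewrite emp_set /= /emp2_measure /mscale /= /msum.
all: under eq_bigr => i _ do rewrite /= diracE inord_val.
all: rewrite sumEFin -EFinM; congr (_%:E); congr (_ * _); apply: eq_bigr => i _.
all: by rewrite indicE in_setX in_setT /= ?andbT.
Qed.

Lemma cost_emp2 : transport_cost emp2 = (mean (fun i => (y 0 i - x 0 i) ^+ 2))%:E.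
Proof.
rewrite /transport_cost (@ge0_integral_emp2 (fun z => (z.2 - z.1) ^+ 2)) //.
  apply: measurable_funX; apply: measurable_funB; [exact: measurable_snd|exact: measurable_fst].
by move=> z; exact: sqr_ge0.
Qed.

End joint.

(** On the segment from [x] to [y] the index matching of two nearby configurations has cost
    [(|r - s| m2)^2]. The Lions derivative therefore gives the increment up to a small multiple of
    [|r - s| m2], and its linear part is at most [K |r - s| m1] because the derivative is bounded by
    [K]. This yields the mean distance of the particles rather than the root mean square. *)
Lemma intrinsic_lipschitz (F : P2 R -> R) (K : R) :
  (forall mu, intrinsic_derivable_bounded K F mu) ->
  forall n (x y : 'rV[R]_n.+1),
    `|F (emp y) - F (emp x)| <= K * mean (fun i => `|y 0 i - x 0 i|).
Proof.
move=> FK n x y; pose h := y - x.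
pose m1 := mean (fun i => `|h 0 i|); pose m2 := Num.sqrt (mean (fun i => (h 0 i) ^+ 2)).
have m10 : 0 <= m1 by apply: mean_ge0.
have m20 : 0 <= m2 by exact: sqrtr_ge0.
have K0 : 0 <= K by have [g _ /(_ 0)] := FK (emp x); apply: le_trans.
pose phi (s : R) := F (emp (x + s *: h)).
have -> : F (emp y) - F (emp x) = phi 1 - phi 0.
  by rewrite /phi scale0r addr0 scale1r /h [x + _]addrC subrK.
rewrite (_ : mean _ = m1); last by apply: eq_mean => i; rewrite !mxE.
rewrite -[X in _ <= X]mulr1 -[X in _ * X]subr0.
apply: local_lipschitz => // eta eta0 s _.
have [g [mg _ gd] gK] := FK (emp (x + s *: h)).
have m2p : 0 < 1 + m2 by rewrite ltr_pwDl.
(* Dividing the tolerance by [1 + m2] turns the error [m2 |r - s|] into at most [eta |r - s|]; the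
   added 1 covers [m2 = 0]. *)
have [d d0 dP] := gd (eta / (1 + m2)) (divr_gt0 eta0 m2p).
exists (d / (1 + m2)); first exact: divr_gt0.
move=> r _ rs.
have hE i : (x + r *: h) 0 i - (x + s *: h) 0 i = (r - s) * h 0 i by rewrite !mxE; ring.
have cE : transport_cost (emp2 (x + s *: h) (x + r *: h)) = (((r - s) * m2) ^+ 2)%:E.
  rewrite cost_emp2 exprMn sqr_sqrtr; last by apply: mean_ge0 => i; exact: sqr_ge0.
  by rewrite -meanZ; congr (_%:E); apply: eq_mean => i; rewrite hE exprMn.
have := dP _ _ (coupling_emp2 _ (x + r *: h)).
rewrite cE lee_fin.
have rsm : `|r - s| * m2 <= d.
  move: rs; rewrite ltr_pdivlMr // => rs; apply: le_trans (ltW rs).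
  by rewrite ler_wpM2l // lerDr.
rewrite -[X in X <= _ -> _]real_normK ?num_real // normrM (ger0_norm m20).
rewrite ler_pXn2r ?nnegrE ?mulr_ge0 // ?(ltW d0) // => /(_ rsm) /=.
rewrite sqrtr_sqr normrM (ger0_norm m20) => H.
set I := \int[_]_z _ in H.
have IK : `|I| <= K * (`|r - s| * m1).
  have mh : measurable_fun setT (fun z : R * R => g z.1 * (z.2 - z.1)).
    apply: measurable_funM; first exact: measurableT_comp mg measurable_fst.
    by apply: measurable_funB; [exact: measurable_snd|exact: measurable_fst].
  have mah : measurable_fun setT (fun z : R * R => `|g z.1 * (z.2 - z.1)|).
    exact: measurableT_comp.
  have ih : (emp2 (x + s *: h) (x + r *: h)).-integrable setT
      (EFin \o (fun z : R * R => g z.1 * (z.2 - z.1))).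
    apply/integrableP; split; first exact/measurable_EFinP.
    have E := ge0_integral_emp2 (x + s *: h) (x + r *: h) mah (fun=> normr_ge0 _).
    by rewrite [X in (X < _)%E]E ltry.
  apply: (le_trans (le_normr_Rintegral measurableT ih)).
  rewrite /Rintegral (ge0_integral_emp2 _ _ mah) //= mulrA -meanZ.
  apply: ler_mean => i; rewrite hE !normrM -!mulrA.
  by apply: ler_wpM2r; rewrite ?mulr_ge0.
have e1 : eta / (1 + m2) * (`|r - s| * m2) <= eta * `|r - s|.
  rewrite mulrAC -mulrA ler_wpM2l ?(ltW eta0) // ler_pdivrMr //.
  by rewrite ler_wpM2l // lerDr.
rewrite -/(phi r) -/(phi s) in H.
have -> : phi r - phi s = (phi r - phi s - I) + I by ring.
apply: le_trans (ler_normD _ _) _; move: (le_trans H e1) IK; lra.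
Qed.

End empirical.

(** * Lipschitz continuity of the drift *)

Lemma derivable_bounded_lipschitz (R : realType) (K : R) (h : R -> R) (x y : R) :
  (forall a, derivable_bounded K h a) -> `|h x - h y| <= K * `|x - y|.
Proof.
move=> H; wlog xy : x y / y <= x.
  move=> W; have [/W//|/ltW/W] := leP y x.
  by rewrite distrC (distrC x).
rewrite (ger0_norm (_ : 0 <= x - y)) ?subr_ge0 //.
by apply: derivable_lipschitz => // s _; exact: H.
Qed.

Lemma derivative_within_lipschitz (R : realType) (T K : R) (h : R -> R) :
  (forall a, 0 <= a <= T ->
    exists2 l, is_derivative_within `[0, T] h a l & `|l| <= K) ->
  forall x y, 0 <= x <= T -> 0 <= y <= T -> `|h x - h y| <= K * `|x - y|.
Proof.
move=> H x y; wlog xy : x y / y <= x.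
  move=> W; have [/W//|/ltW/W {}W xT yT] := leP y x.
  by rewrite distrC (distrC x); apply: W.
move=> /andP[x0 xT] /andP[y0 yT].
rewrite (ger0_norm (_ : 0 <= x - y)) ?subr_ge0 //; apply: local_lipschitz => // eta eta0 s.
rewrite in_itv /= => /andP[ys sx].
have [|l dl lK] := H s; first by rewrite (le_trans y0 ys) (le_trans sx xT).
move/cvgrPdist_lt : dl => /(_ _ eta0); rewrite near_withinE => /nbhs_ballP[d /= d0 dP].
exists d => // r; rewrite in_itv /= => /andP[yr rx] rs.
have [->|rns] := eqVneq r s; first by rewrite !subrr normr0 mulr0.
have /= := dP r; rewrite /ball /= distrC => /(_ rs).
have rD : r \in `[0, T] /\ r <> s.
  split; first by rewrite in_itv /= (le_trans y0 yr) (le_trans rx xT).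
  by move=> E; rewrite E eqxx in rns.
move=> /(_ rD); set q := (_ / _) => lq.
have -> : h r - h s = q * (r - s) by rewrite /q divfK // subr_eq0.
rewrite normrM ler_wpM2r //.
have -> : q = l - (l - q) by ring.
by apply: le_trans (ler_normB _ _) _; apply: lerD => //; exact: ltW.
Qed.

(** The particle system evaluates the drift at empirical measures only, so the distance of measures
    is replaced by the mean distance of the particles matched by index. *)
Definition drift_lipschitz (R : realType) (T K : R) (f : R -> R -> R -> P2 R -> R) :=
  forall n t t' th th' x x' (z z' : 'rV[R]_n.+1), 0 <= t <= T -> 0 <= t' <= T ->
    `|f t th x (emp z) - f t' th' x' (emp z')| <=
      K * (`|t - t'| + `|th - th'| + `|x - x'| + mean (fun i => `|z 0 i - z' 0 i|)).

Lemma bounded_derivatives_lipschitz (R : realType) (T : R) f fmu : 0 < T ->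
  @bounded_derivatives R T f fmu -> exists2 K : R, 0 <= K & drift_lipschitz T K f.
Proof.
move=> T0 [K H].
have T00 : 0 <= (0 : R) <= T by rewrite lexx ltW.
have K0 : 0 <= K.
  by have [[l _ lK]] := H 0 0 0 (dirac_P2 0) T00; rewrite (le_trans _ lK).
exists K => // n t t' th th' x x' z z' tT tT'.
have -> : f t th x (emp z) - f t' th' x' (emp z') =
  (f t th x (emp z) - f t' th x (emp z)) + (f t' th x (emp z) - f t' th' x (emp z)) +
  (f t' th' x (emp z) - f t' th' x' (emp z)) + (f t' th' x' (emp z) - f t' th' x' (emp z')).
  by ring.
rewrite !mulrDr.
apply: le_trans (ler_normD _ _) _; apply: lerD.
  apply: le_trans (ler_normD _ _) _; apply: lerD.
    apply: le_trans (ler_normD _ _) _; apply: lerD.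
      apply: (@derivative_within_lipschitz _ T K (fun s => f s th x (emp z))) => // a aT.
      by have [] := H a th x (emp z) aT.
    apply: (@derivable_bounded_lipschitz _ K (fun a => f t' a x (emp z))) => a.
    by have [_ []] := H t' a x (emp z) tT'.
  apply: (@derivable_bounded_lipschitz _ K (fun a => f t' th' a (emp z))) => a.
  by have [_ []] := H t' th' a (emp z) tT'.
apply: intrinsic_lipschitz => mu.
have [_ [_ _ dmu bmu] _ _ _] := H t' th' x' mu tT'.
by exists (fmu t' th' x' mu).
Qed.

(** * Integration of the gradient bound along segments *)

(** Young's inequality [|h| g <= k h^2 / 2 + g^2 / (2 k)] with the optimal [k = B / W], perturbed by
    [e / B] in the denominator so that [W = 0] is allowed. *)
Lemma mean_cauchy_schwarz (R : realType) n (h g : 'I_n.+1 -> R) (B : R) : 0 < B ->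
  mean (fun i => g i ^+ 2) <= B ^+ 2 ->
  mean (fun i => `|h i| * g i) <= Num.sqrt (mean (fun i => h i ^+ 2)) * B.
Proof.
move=> B0 gB; set W := Num.sqrt _.
have W0 : 0 <= W by exact: sqrtr_ge0.
apply/ler_addgt0Pr => e e0.
pose k := B / (W + e / B).
have We : 0 < W + e / B by rewrite ltr_wpDl // divr_gt0.
have k0 : 0 < k by rewrite divr_gt0.
have young i : `|h i| * g i <= k / 2 * h i ^+ 2 + (k *+ 2)^-1 * g i ^+ 2.
  rewrite -subr_ge0 -[h i ^+ 2]real_normK ?num_real //.
  have -> : k / 2 * `|h i| ^+ 2 + (k *+ 2)^-1 * g i ^+ 2 - `|h i| * g i =
    (k *+ 2)^-1 * (k * `|h i| - g i) ^+ 2 by field; rewrite gt_eqF.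
  by rewrite mulr_ge0 ?sqr_ge0 // invr_ge0 mulrn_wge0 // ltW.
apply: (le_trans (ler_mean young)); rewrite meanD !meanZ.
have -> : mean (fun i => h i ^+ 2) = W ^+ 2.
  by rewrite sqr_sqrtr //; apply: mean_ge0 => i; exact: sqr_ge0.
have -> : W * B + e = k / 2 * (W + e / B) ^+ 2 + (k *+ 2)^-1 * B ^+ 2.
  by rewrite /k; field; rewrite !gt_eqF //; nra.
apply: lerD; last by rewrite ler_wpM2l // invr_ge0 mulrn_wge0 // ltW.
apply: ler_wpM2l; first by rewrite divr_ge0 // ltW.
rewrite ler_pXn2r ?nnegrE ?(ltW We) //.
by rewrite lerDl divr_ge0 // ltW.
Qed.

Section gradient_path.
Context (R : realType) (n : nat) (F : 'rV[R]_n.+1 -> R).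

Let e_ (i : 'I_n.+1) : 'rV[R]_n.+1 := delta_mx 0 i.

Lemma partial_line (i : 'I_n.+1) (p : 'rV[R]_n.+1) (u : R) :
  derivable F (p + u *: e_ i) (e_ i) ->
  derivable (fun v : R => F (p + v *: e_ i)) u 1 /\
  derive1 (fun v : R => F (p + v *: e_ i)) u = 'D_(e_ i) F (p + u *: e_ i).
Proof.
rewrite derive1E /derivable /derive.
suff -> : (fun h : R => h^-1 *: ((F \o shift (p + u *: e_ i)) (h *: e_ i) - F (p + u *: e_ i))) =
  (fun h : R => h^-1 *: (((fun v : R => F (p + v *: e_ i)) \o shift u) (h *: 1) - F (p + u *: e_ i))) by [].
apply/funext => h /=; congr (_ *: (F _ - _)).
by rewrite [h *: 1]mulr1 scalerDl addrCA.
Qed.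

Lemma partial_step (i : 'I_n.+1) (p : 'rV[R]_n.+1) (w C : R) :
  (forall u : R, `|u| <= `|w| -> derivable F (p + u *: e_ i) (e_ i) /\
     `|'D_(e_ i) F (p + u *: e_ i)| <= C) ->
  `|F (p + w *: e_ i) - F p| <= C * `|w|.
Proof.
move=> H; pose psi (v : R) := F (p + v *: e_ i).
have Hd u : `|u| <= `|w| -> derivable psi u 1 /\ `|derive1 psi u| <= C.
  by move=> /H[/partial_line[d1 E] dC]; rewrite E.
have -> : F p = psi 0 by rewrite /psi scale0r addr0.
rewrite -/(psi w); have [w0|/ltW w0] := leP 0 w.
  rewrite (ger0_norm w0) -[X in C * X]subr0; apply: derivable_lipschitz => // s.
  rewrite in_itv /= => /andP[s0 sw]; apply: Hd.
  by rewrite !ger0_norm.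
rewrite distrC (ler0_norm w0) -[X in C * X]sub0r; apply: derivable_lipschitz => // s.
rewrite in_itv /= => /andP[ws s0]; apply: Hd.
by rewrite !ler0_norm // lerN2.
Qed.

Context (g : 'I_n.+1 -> 'rV[R]_n.+1 -> R).
Hypothesis g_cont : forall i, continuous (g i).
Hypothesis Fd : forall i x, derivable F x (e_ i) /\ `|'D_(e_ i) F x| <= g i x.

(** Move from [z] to [z + t h] one coordinate at a time. All intermediate points lie in a ball
    around [z] on which each majorant [g i] exceeds its value at [z] by less than [eta / s], so
    continuity is required of the majorants and not of the partial derivatives. *)
Lemma partial_local (z h : 'rV[R]_n.+1) (eta : R) : 0 < eta ->
  exists2 d : R, 0 < d & forall t : R, `|t| < d ->
    `|F (z + t *: h) - F z| <= (\sum_i `|h 0 i| * g i z + eta) * `|t|.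
Proof.
move=> eta0; pose s := 1 + \sum_i `|h 0 i|.
have s0 : 0 < s by rewrite ltr_pwDl // sumr_ge0.
have eta's : 0 < eta / s by rewrite divr_gt0.
have : \forall x \near z, forall i, g i x < g i z + eta / s.
  apply: (@filter_forall _ _ _ (nbhs z) _) => i; have := @g_cont i z.
  move=> /cvgrPdist_lt /(_ _ eta's); apply: filterS => x /=.
  by rewrite distrC => /ltr_distlDr; rewrite addrC.
move=> /nbhs_ballP[rho /= rho0 near_z].
exists (rho / s); first exact: divr_gt0.
move=> t td.
(* In [q k u] the coordinates below [k] have made their full move and coordinate [k] is displaced by
   [u]. *)
pose q (k : nat) (u : R) : 'rV[R]_n.+1 :=
  \row_j (z 0 j + (if (j < k)%N then t * h 0 j else if j == k :> nat then u else 0)).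
have qball (k : nat) (u : R) (kn : (k < n.+1)%N) :
    `|u| <= `|t * h 0 (Ordinal kn)| -> ball z rho (q k u).
  have hs j : `|t * h 0 j| < rho.
    rewrite normrM; move: td; rewrite ltr_pdivlMr // => td; apply: le_lt_trans td.
    rewrite ler_wpM2l // /s (bigD1 j) //= addrCA lerDl addr_ge0 // sumr_ge0 //.
  move=> uh; split=> // i j; rewrite /ball /= ord1 !mxE opprD addrA subrr sub0r normrN.
  case: ifP => _; first exact: hs.
  case: eqP => [jk|_]; last by rewrite normr0.
  by apply: le_lt_trans (hs j); rewrite (_ : j = Ordinal kn) //; apply: val_inj.
have -> : F (z + t *: h) - F z = F (q n.+1 0) - F (q 0%N 0).
  congr (F _ - F _); apply/rowP => j; rewrite !mxE.
    by rewrite ltn_ord.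
  by rewrite ltn0; case: ifP; rewrite addr0.
rewrite -(telescope_sumr (fun k => F (q k 0))) // big_mkord.
apply: le_trans (ler_norm_sum _ _ _) _.
have step (i : 'I_n.+1) : `|F (q i.+1 0) - F (q i 0)| <= (g i z + eta / s) * (`|t| * `|h 0 i|).
  have -> : q i.+1 0 = q i 0 + (t * h 0 i) *: e_ i.
    apply/rowP => j; rewrite !mxE eqxx /= ltnS.
    case: (ltngtP j i) => [ji|ji|/val_inj ->].
    - by rewrite (_ : j == i = false) ?mulr0 ?addr0 //; apply/eqP => E; rewrite E ltnn in ji.
    - rewrite (_ : j == i = false) ?mulr0 ?addr0 //; last by apply/eqP => E; rewrite E ltnn in ji.
      by case: ifP; rewrite addr0.
    - by rewrite !eqxx mulr1 addr0.
  rewrite -normrM; apply: partial_step => u uh.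
  have -> : q i 0 + u *: e_ i = q i u.
    apply/rowP => j; rewrite !mxE eqxx /=.
    case: (ltngtP j i) => [ji|ji|/val_inj ->].
    - by rewrite (_ : j == i = false) ?mulr0 ?addr0 //; apply/eqP => E; rewrite E ltnn in ji.
    - by rewrite (_ : j == i = false) ?mulr0 ?addr0 //; apply/eqP => E; rewrite E ltnn in ji.
    - by rewrite !eqxx mulr1 addr0.
  have [Fdi Fgi] := @Fd i (q i u); split=> //; apply: (le_trans Fgi); apply/ltW.
  apply: near_z; apply: (qball i u (ltn_ord i)).
  by rewrite (_ : Ordinal _ = i) //; apply: val_inj.
apply: (le_trans (ler_sum _ (fun i _ => step i))).
have -> : \sum_i (g i z + eta / s) * (`|t| * `|h 0 i|) =
    (\sum_i `|h 0 i| * g i z + (\sum_i `|h 0 i|) * (eta / s)) * `|t|.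
  rewrite mulr_suml -big_split mulr_suml; apply: eq_bigr => i _ /=; ring.
rewrite ler_wpM2r // lerD2l mulrA ler_pdivrMr // mulrC ler_wpM2l ?(ltW eta0) //.
by rewrite /s lerDr.
Qed.

End gradient_path.

Lemma cvg_gradient_radius (R : realType) (n : nat) (i : 'I_n.+1) (c c' : R) (S : Type)
    (D : set_system S) {FD : Filter D} (u : 'I_n.+1 -> S -> R) (l : 'I_n.+1 -> R) :
  (forall j, u j @ D --> l j) ->
  (fun z => c * Num.sqrt (1 + `|u i z| ^+ 2 + n.+1%:R^-1 * \sum_j `|u j z| ^+ 2) + c') @ D -->
  c * Num.sqrt (1 + `|l i| ^+ 2 + n.+1%:R^-1 * \sum_j `|l j| ^+ 2) + c'.
Proof.
move=> ul.
have cj j : (fun z => `|u j z| ^+ 2) @ D --> `|l j| ^+ 2.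
  by rewrite expr2; under eq_fun do rewrite expr2; apply: cvgM; apply: cvg_norm.
apply: cvgD; last exact: cvg_cst.
apply: cvgM; first exact: cvg_cst.
apply: (@continuous_cvg _ _ _ D _ _ Num.sqrt); first exact: sqrt_continuous.
apply: cvgD; first by apply: cvgD; [exact: cvg_cst|exact: cj].
apply: cvgM; first exact: cvg_cst.
by apply: cvg_big => //; exact: add_continuous.
Qed.

(** Since the mean of the squared radii is [1 + 2 m <= (1 + m)^2], the Cauchy-Schwarz inequality
    bounds the slope at [z] by [(a (1 + m z) + b) W]. The second moment [m] is convex along the
    segment, so the slope at [s] is at most the affine function [c0 + c1 s], whose integral over
    [[0, 1]] is the mean of its end values. *)
Lemma gradient_path_bound (R : realType) (n : nat) (F : 'rV[R]_n.+1 -> R) (a b : R) :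
  0 <= a -> 0 <= b ->
  (forall i x, derivable F x (delta_mx 0 i) /\
    `|'D_(delta_mx 0 i) F x| <= a / n.+1%:R *
      Num.sqrt (1 + `|x 0 i| ^+ 2 + n.+1%:R^-1 * \sum_j `|x 0 j| ^+ 2) + b / n.+1%:R) ->
  forall x y, `|F y - F x| <=
    (a * (1 + (mean (fun i => x 0 i ^+ 2) + mean (fun i => y 0 i ^+ 2)) / 2) + b) *
    Num.sqrt (mean (fun i => (y 0 i - x 0 i) ^+ 2)).
Proof.
move=> a0 b0 FG x y; pose h := y - x.
pose m (z : 'rV[R]_n.+1) := mean (fun i => z 0 i ^+ 2).
have m0 z : 0 <= m z by apply: mean_ge0 => i; exact: sqr_ge0.
set W := Num.sqrt _.
have W0 : 0 <= W by exact: sqrtr_ge0.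
have WE : W = Num.sqrt (mean (fun i => h 0 i ^+ 2)).
  by congr Num.sqrt; apply: eq_mean => i; rewrite !mxE.
pose r i (z : 'rV[R]_n.+1) := Num.sqrt (1 + `|z 0 i| ^+ 2 + n.+1%:R^-1 * \sum_j `|z 0 j| ^+ 2).
pose g i z := a / n.+1%:R * r i z + b / n.+1%:R.
have rE i z : r i z ^+ 2 = 1 + z 0 i ^+ 2 + m z.
  rewrite sqr_sqrtr.
    rewrite real_normK ?num_real //; congr (_ + _); apply: eq_mean => j.
    by rewrite real_normK ?num_real.
  by rewrite !addr_ge0 ?mulr_ge0 ?sumr_ge0.
have g_cont i : continuous (g i).
  move=> z; apply: (@cvg_gradient_radius _ _ _ _ _ _ (nbhs z) _ (fun j z => z 0 j)) => j.
  exact: coord_continuous.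
have Mz z : \sum_i `|h 0 i| * g i z <= (a * (1 + m z) + b) * W.
  have -> : \sum_i `|h 0 i| * g i z = a * mean (fun i => `|h 0 i| * r i z) + b * mean (fun i => `|h 0 i| * 1).
    rewrite -!meanZ -meanD /mean mulr_sumr; apply: eq_bigr => i _; rewrite /g; ring.
  rewrite mulrDl -mulrA (mulrC _ W) WE lerD // ler_wpM2l //.
    apply: mean_cauchy_schwarz; first by rewrite ltr_pwDl.
    rewrite (eq_mean (fun i => rE i z)) meanD meanD !mean_cst -/(m z).
    by have := m0 z; nra.
  rewrite -[X in _ <= X]mulr1; apply: mean_cauchy_schwarz => //.
  by rewrite expr1n mean_cst.
have mconv s : 0 <= s -> s <= 1 -> m (x + s *: h) <= m x + s * (m y - m x).
  move=> s0 s1.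
  have -> : m x + s * (m y - m x) = (1 - s) * m x + s * m y by ring.
  rewrite /m -!meanZ -meanD; apply: ler_mean => i; rewrite !mxE -subr_ge0.
  have -> : (1 - s) * x 0 i ^+ 2 + s * y 0 i ^+ 2 - (x 0 i + s * (y 0 i - x 0 i)) ^+ 2 =
    s * (1 - s) * (y 0 i - x 0 i) ^+ 2 by ring.
  by apply: mulr_ge0; [apply: mulr_ge0; rewrite // subr_ge0|exact: sqr_ge0].
rewrite -/(m x) -/(m y).
pose phi (s : R) := F (x + s *: h).
have -> : F y - F x = phi 1 - phi 0.
  by rewrite /phi scale0r addr0 scale1r /h [x + _]addrC subrK.
pose c0 := (a * (1 + m x) + b) * W; pose c1 := a * W * (m y - m x).
have c00 : 0 <= c0 by rewrite mulr_ge0 // addr_ge0 // mulr_ge0 // addr_ge0.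
have c01 : 0 <= c0 + c1.
  have -> : c0 + c1 = (a * (1 + m y) + b) * W by rewrite /c0 /c1; ring.
  by rewrite mulr_ge0 // addr_ge0 // mulr_ge0 // addr_ge0.
have csg s : 0 <= s -> s <= 1 -> 0 <= c0 + c1 * s.
  move=> s0 s1; have -> : c0 + c1 * s = (1 - s) * c0 + s * (c0 + c1) by ring.
  by rewrite addr_ge0 // mulr_ge0 // subr_ge0.
apply/ler_addgt0Pr => e e0.
pose eta := e / 2; have eta0 : 0 < eta by rewrite divr_gt0.
(* A primitive of [c0 + c1 s + 2 eta]. One [eta] absorbs the error of [partial_local], the other the
   change of [c1 s] between [s] and the midpoint [(s + u) / 2]. *)
pose Q s := (c0 + 2 * eta) * s + c1 * s ^+ 2 / 2.
have -> : (a * (1 + (m x + m y) / 2) + b) * W + e = Q 1 - Q 0.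
  by rewrite /Q /c0 /c1 /eta; field.
have QE r1 r2 : Q r2 - Q r1 = (r2 - r1) * (c0 + c1 * ((r1 + r2) / 2) + 2 * eta).
  by rewrite /Q; field.
have Qp r1 r2 : r1 \in `[0, 1] -> r2 \in `[0, 1] -> 0 <= c0 + c1 * ((r1 + r2) / 2) + 2 * eta.
  rewrite !in_itv /= => /andP[? ?] /andP[? ?].
  have : 0 <= c0 + c1 * ((r1 + r2) / 2) by apply: csg; lra.
  by move: eta0; lra.
apply: variation_le => //.
  by move=> r1 r2 r1i r2i r12; rewrite -subr_ge0 QE mulr_ge0 ?subr_ge0 ?Qp.
move=> s si; have [d d0 dP] := partial_local g_cont FG (x + s *: h) h eta0.
have c1p : 0 < 1 + `|c1| by rewrite ltr_pwDl.
exists (Num.min d (eta / (1 + `|c1|))); first by rewrite lt_min d0 divr_gt0.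
move=> u ui; rewrite lt_min => /andP[usd use].
rewrite QE normrM (ger0_norm (Qp _ _ _ _)) // mulrC.
have := dP _ usd; rewrite -addrA -scalerDl [s + _]addrC subrK => /le_trans; apply.
rewrite ler_wpM2r //.
move: (si); rewrite in_itv /= => /andP[s0 s1].
have := le_trans (Mz (x + s *: h)) (_ : _ <= c0 + c1 * s) => H.
have {}H : \sum_i `|h 0 i| * g i (x + s *: h) <= c0 + c1 * s.
  apply: H; rewrite -subr_ge0.
  have -> : c0 + c1 * s - (a * (1 + m (x + s *: h)) + b) * W =
    a * W * (m x + s * (m y - m x) - m (x + s *: h)) by rewrite /c0 /c1; ring.
  by rewrite !mulr_ge0 // subr_ge0 mconv.
have E : c1 * (s - u) <= eta.
  apply: le_trans (ler_norm _) _; rewrite normrM distrC.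
  move: use; rewrite ltr_pdivlMr // mulrC => use; apply: le_trans (ltW use).
  by rewrite ler_wpM2r // lerDr.
by move: E H eta0; lra.
Qed.

(** * Measurability and adaptedness of time integrals *)

Lemma measurable_countable_select d (S : measurableType d) d' (S' : measurableType d')
    (C : countType) (D : set S) (c : S -> C) (F : C -> S -> S') :
  (forall q, measurable (D `&` [set s | c s = q])) ->
  (forall q, measurable_fun D (F q)) ->
  measurable_fun D (fun s => F (c s) s).
Proof.
move=> mc mF mD Y mY.
have -> : D `&` (fun s => F (c s) s) @^-1` Y =
    \bigcup_n (if @unpickle C n is Some q then
      (D `&` [set s | c s = q]) `&` (D `&` F q @^-1` Y) else set0).
  apply/seteqP; split => [s [Ds Ys]|s [n _]].
    by exists (pickle (c s)) => //; rewrite pickleK.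
  by case: (unpickle n) => // q [[Ds /= <-] [_ Ys]].
apply: bigcup_measurable => n _; case: (unpickle n) => [q|]; last exact: measurable0.
by apply: measurableI; [exact: mc|exact: mF].
Qed.

Section grid.
Context (R : realType).

Definition grid_index (m : nat) (t : R) : int := Num.floor (t * m.+1%:R).
Definition grid_point (m : nat) (k : int) : R := k%:~R / m.+1%:R.

Lemma grid_dist m t : `|grid_point m (grid_index m t) - t| <= m.+1%:R^-1.
Proof.
have m0 : 0 < m.+1%:R :> R by rewrite ltr0n.
rewrite /grid_point /grid_index.
have -> : (Num.floor (t * m.+1%:R))%:~R / m.+1%:R - t =
    - ((t * m.+1%:R - (Num.floor (t * m.+1%:R))%:~R) / m.+1%:R).
  by field; rewrite gt_eqF.
have i0 : 0 <= m.+1%:R^-1 :> R by rewrite invr_ge0 ltW.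
rewrite normrN normrM (ger0_norm i0) ler_piMl //.
have := floor_itv (t * m.+1%:R); rewrite intrD => /andP[h1 h2].
by rewrite ger0_norm ?subr_ge0 // lerBlDr addrC ltW.
Qed.

Lemma cvg_grid t : (fun m => grid_point m (grid_index m t)) @ \oo --> t.
Proof.
apply/cvgrPdist_le => e e0.
have := @cvg_harmonic R; move=> /cvgrPdist_le /(_ _ e0); apply: filterS => m /=.
rewrite sub0r normrN ger0_norm ?invr_ge0 // distrC => h; exact: le_trans (grid_dist _ _) h.
Qed.

Lemma measurable_grid_index d (S : measurableType d) (D : set S) (u : S -> R) m k :
  measurable D -> measurable_fun D u ->
  measurable (D `&` [set s | grid_index m (u s) = k]).
Proof.
move=> mD mu.
have -> : [set s | grid_index m (u s) = k] =
    (fun s => u s * m.+1%:R) @^-1` `[k%:~R, (k + 1)%:~R[.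
  apply/seteqP; split => s; rewrite /grid_index /= in_itv /=.
    by move=> <-; exact: floor_itv.
  by move/floor_def.
have mum : measurable_fun D (fun s => u s * m.+1%:R) by apply: measurable_funM.
by apply: mum.
Qed.

(** Rounding the arguments to the grid of mesh [1 / (m + 1)] leaves countably many values, so the
    composition is measurable; the Lipschitz bound makes the roundings converge. Applied to the
    drift, this avoids any sigma-algebra on the space of measures. *)
Lemma measurable_lipschitz_comp d (S : measurableType d) (I : finType) (D : set S)
    (u : I -> S -> R) (Phi : (I -> R) -> R) (K : R) :
  (forall x y, `|Phi x - Phi y| <= K * \sum_i `|x i - y i|) ->
  (forall i, measurable_fun D (u i)) ->
  measurable_fun D (fun s => Phi (u^~ s)).
Proof.
move=> PhiK mu mD; move: (mD).
apply: (@measurable_fun_cvg _ _ _ D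
  (fun m s => Phi (fun i => grid_point m (grid_index m (u i s))))).
  move=> m.
  pose c s : {ffun I -> int} := [ffun i => grid_index m (u i s)].
  have -> : (fun s => Phi (fun i => grid_point m (grid_index m (u i s)))) =
      (fun s => (fun (q : {ffun I -> int}) (_ : S) => Phi (fun i => grid_point m (q i))) (c s) s).
    by apply/funext => s; congr Phi; apply/funext => i; rewrite /c ffunE.
  apply: (@measurable_countable_select _ _ _ _ {ffun I -> int} D c
    (fun q _ => Phi (fun i => grid_point m (q i)))); last by move=> q; exact: measurable_cst.
  move=> q.
  have -> : D `&` [set s | c s = q] =
      \bigcap_(i in [set: I]) (D `&` [set s | grid_index m (u i s) = q i]) `&` D.
    apply/seteqP; split => s.
      by move=> [Ds /= <-]; split=> // i _; split => //=; rewrite /c ffunE.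
    move=> [H Ds]; split => //=; apply/ffunP => i; rewrite /c ffunE.
    by have [] := H i Logic.I.
  apply: measurableI => //; apply: fin_bigcap_measurable; first exact: finite_finset.
  by move=> i _; apply: measurable_grid_index.
move=> s Ds; apply/cvgrPdist_le => e e0.
have := @cvgM R nat \oo _ (fun=> `|K| * \sum_(i : I) 1) _ _ _ (cvg_cst _) (@cvg_harmonic R).
rewrite mulr0 => /(_ _ _) /cvgrPdist_le /(_ _ e0); apply: filterS => m /=.
rewrite sub0r normrN; apply: le_trans; rewrite distrC; apply: (le_trans (PhiK _ _)).
apply: le_trans (ler_norm _) _; rewrite -mulrA !normrM normr_id ler_wpM2l //.
rewrite -normrM mulr_suml; apply: le_trans (ler_norm _).
have S0 : 0 <= \sum_i `|grid_point m (grid_index m (u i s)) - u i s| by rewrite sumr_ge0.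
rewrite (ger0_norm S0).
by apply: ler_sum => i _; rewrite mul1r; exact: grid_dist.
Qed.

Lemma measurable_caratheodory d (S : measurableType d) (X : R -> S -> R) :
  (forall w, continuous (X^~ w)) -> (forall t, measurable_fun setT (X t)) ->
  measurable_fun setT (fun z : R * S => X z.1 z.2).
Proof.
move=> Xc mX; apply: (@measurable_fun_cvg _ _ _ setT
  (fun m z => X (grid_point m (grid_index m z.1)) z.2)).
  move=> m.
  apply: (@measurable_countable_select _ _ _ _ int setT (fun z : R * S => grid_index m z.1)
    (fun k z => X (grid_point m k) z.2)).
    by move=> k; apply: measurable_grid_index => //; exact: measurable_fst.
  by move=> k; apply: measurableT_comp; [exact: mX|exact: measurable_snd].
move=> z _; apply: (continuous_cvg _ (Xc z.2 z.1)); exact: cvg_grid.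
Qed.

End grid.

Section clip.
Context (R : realType).

(** For [s <= T], the projection onto [[s, T]]. Composing a path with it freezes the path outside
    the interval, so that continuity within [[s, T]] becomes continuity on the whole line. *)
Definition clip (s T t : R) : R := Num.max s (Num.min T t).

Lemma clip_bounds s T t : s <= T -> s <= clip s T t <= T.
Proof. by move=> sT; rewrite /clip le_max lexx /= ge_max sT ge_min lexx. Qed.

Lemma clip_id s T t : s <= t <= T -> clip s T t = t.
Proof. by move=> /andP[st tT]; rewrite /clip (min_r tT) max_r. Qed.

Lemma maxr_lipschitz (c x y : R) : `|Num.max c x - Num.max c y| <= `|x - y|.
Proof.
have := ler_norm (x - y); have := ler_norm (y - x); rewrite (distrC y x) ler_norml.
by case: (leP c x) => ?; case: (leP c y) => ?; lra.
Qed.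

Lemma minr_lipschitz (c x y : R) : `|Num.min c x - Num.min c y| <= `|x - y|.
Proof.
have := ler_norm (x - y); have := ler_norm (y - x); rewrite (distrC y x) ler_norml.
by case: (leP c x) => ?; case: (leP c y) => ?; lra.
Qed.

Lemma clip_lipschitz s T t t' : `|clip s T t - clip s T t'| <= `|t - t'|.
Proof.
by apply: le_trans (maxr_lipschitz _ _ _) _; exact: minr_lipschitz.
Qed.

Lemma clip_continuous s T : continuous (clip s T).
Proof.
move=> t; apply/cvgrPdist_le => e e0; near=> u.
apply: le_trans (clip_lipschitz _ _ _ _) _.
by near: u; exact: cvgr_dist_le.
Unshelve. all: by end_near. Qed.

Lemma continuous_clip_comp s T (g : R -> R) : s <= T ->
  {within `[s, T], continuous g} -> continuous (g \o clip s T).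
Proof.
move=> sT /subspace_continuousP gc t.
have cT u : `[s, T]%classic (clip s T u) by rewrite /= in_itv /= clip_bounds.
apply: (cvg_comp _ _ _ (gc _ (cT t))).
move=> A; rewrite /= nbhs_simpl => /= wA.
have := @clip_continuous s T t _ wA; rewrite nbhs_simpl /=.
by apply: filterS => u /(_ (cT u)).
Qed.

End clip.

(** The drift along a configuration is a Lipschitz function of finitely many reals, indexed by an
    option type: [None] is the time, [Some None] the control, and the rest are the particles. The
    time is clipped because the Lipschitz bound is available on [[0, T]] only. *)
Lemma measurable_drift (R : realType) (T K : R) (f : R -> R -> R -> P2 R -> R)
    (n : nat) (i : 'I_n.+1) d (S : measurableType d) (D : set S)
    (rho th : S -> R) (X : S -> 'rV[R]_n.+1) :
  0 <= T -> 0 <= K -> drift_lipschitz T K f ->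
  measurable_fun D rho -> (forall w, D w -> 0 <= rho w <= T) ->
  measurable_fun D th -> (forall j, measurable_fun D (fun w => X w 0 j)) ->
  measurable_fun D (fun w => f (rho w) (th w) (X w 0 i) (emp (X w))).
Proof.
move=> T0 K0 fK mrho rhoT mth mX.
pose u (o : option (option 'I_n.+1)) (w : S) :=
  if o is Some o' then (if o' is Some j then X w 0 j else th w) else rho w.
pose Phi (v : option (option 'I_n.+1) -> R) :=
  f (clip 0 T (v None)) (v (Some None)) (v (Some (Some i))) (emp (\row_j v (Some (Some j)))).
have Phi_lip x y : `|Phi x - Phi y| <= (4 * K) * \sum_o `|x o - y o|.
  have single o : `|x o - y o| <= \sum_o `|x o - y o|.
    by rewrite (bigD1 o) //= lerDl sumr_ge0.
  have c0T v : 0 <= clip 0 T v <= T by exact: clip_bounds.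
  apply: le_trans (fK _ _ _ _ _ _ _ _ _ (c0T _) (c0T _)) _.
  rewrite [4 * K]mulrC -mulrA ler_wpM2l //.
  have h1 := le_trans (clip_lipschitz 0 T (x None) (y None)) (single None).
  have h2 := single (Some None); have h3 := single (Some (Some i)).
  have h4 : mean (fun j => `|(\row_j x (Some (Some j))) 0 j - (\row_j y (Some (Some j))) 0 j|) <=
      \sum_o `|x o - y o|.
    rewrite -[leRHS](mean_cst n); apply: ler_mean => j; rewrite !mxE; exact: single.
  by move: h1 h2 h3 h4; lra.
apply: (@eq_measurable_fun _ _ _ _ D (fun w => Phi (u^~ w))).
  move=> w; rewrite inE => Dw; rewrite /Phi /u /= clip_id ?rhoT //.
  by congr (f _ _ _ (emp _)); apply/rowP => j; rewrite mxE.
apply: (measurable_lipschitz_comp Phi_lip); case=> [[j|]|].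
- exact: mX.
- exact: mth.
- exact: mrho.
Qed.

(** * Measurability with respect to a sub-sigma-algebra *)

Section subsigma.
Context (R : realType) d (Om : measurableType d) (P : probability Om R).
Variable G : set (set Om).
Hypothesis G_measurable : forall A, G A -> measurable A.
Hypothesis G_negligible : forall A, P.-negligible A -> G A.

Definition gmeas (X : Om -> R) :=
  @measurable_fun _ _ (g_sigma_algebraType G) R setT X.

Lemma gmeasP X : gmeas X <-> preimage_sets X `<=` <<s G >>.
Proof.
split => [mX _ [B mB <-]|H _ B mB].
  by rewrite -[X in _ X]setTI; exact: mX.
by rewrite setTI; apply: H; exists B.
Qed.

Lemma sub_g_measurable : <<s G >> `<=` measurable.
Proof. by apply: smallest_sub => //; exact: sigma_algebra_measurable. Qed.

Lemma gmeas_measurable X : gmeas X -> measurable_fun setT X.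
Proof. by move=> mX _ B mB; apply: sub_g_measurable; apply: mX. Qed.

Lemma gmeas_ae X Y (N : set Om) : gmeas X -> P.-negligible N ->
  (forall w, ~ N w -> X w = Y w) -> gmeas Y.
Proof.
move=> mX nN XY _ B mB; rewrite setTI.
have -> : Y @^-1` B = (X @^-1` B `\` N) `|` (Y @^-1` B `&` N).
  apply/seteqP; split => [w Yw|w [[Xw /XY E]|[//]]]; last by rewrite /= -E.
  by have [Nw|Nw] := pselect (N w); [right|left; split=> //=; rewrite XY].
have mG A : P.-negligible A -> @measurable _ (g_sigma_algebraType G) A.
  by move=> /G_negligible; exact: sub_gen_smallest.
apply: measurableU; last by apply: mG; apply: negligibleS nN => w [].
by apply: measurableD; [rewrite -[X in _ X]setTI; exact: mX|exact: mG].
Qed.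

End subsigma.

Lemma integral_prob_cst (R : realType) d (S : measurableType d) (P : probability S R) (c : R) :
  (\int[P]_x c%:E = c%:E)%E.
Proof. by rewrite integral_cst // [X in (_ * X)%E]probability_setT mule1. Qed.

Section sampling.
Context (R : realType) d (Om : measurableType d) (P : probability Om R).
Context d' (I : measurableType d') (U : probability I R) (A : set I).
Hypothesis mA : measurable A.
Hypothesis UA : U A = 1%E.
Variable b : I * Om -> R.
Hypothesis mb : measurable_fun setT b.
Hypothesis b01 : forall z, 0 <= b z <= 1.

Definition average (w : Om) : R := fine (\int[U]_r (b (r, w))%:E)%E.

Let b0 z : (0 <= (b z)%:E)%E.
Proof. by rewrite lee_fin; case/andP: (b01 z). Qed.

Let mbr r : measurable_fun setT (fun w => b (r, w)).
Proof. exact: measurable_fun_pair2. Qed.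

Let mbw w : measurable_fun setT (fun r => b (r, w)).
Proof. exact: measurable_fun_pair1. Qed.

Let average_fin w : (\int[U]_r (b (r, w))%:E = (average w)%:E)%E.
Proof.
rewrite /average fineK // ge0_fin_numE; last by apply: integral_ge0.
apply: (@le_lt_trans _ _ (\int[U]_r 1)%E).
  apply: ge0_le_integral => //; first exact/measurable_EFinP.
  by move=> r _; rewrite lee_fin; case/andP: (b01 (r, w)).
by rewrite integral_prob_cst ltry.
Qed.

Lemma average_bounds w : 0 <= average w <= 1.
Proof.
rewrite -!lee_fin -average_fin integral_ge0 //=.
rewrite -[leRHS](integral_prob_cst U).
apply: ge0_le_integral => //; first exact/measurable_EFinP.
by move=> r _; rewrite lee_fin; case/andP: (b01 (r, w)).
Qed.

Lemma measurable_average : measurable_fun setT average.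
Proof.
apply: measurableT_comp; first exact: fine_measurable.
apply: (@measurable_fun_fubini_tonelli_G _ _ _ _ _ U (fun z => (b z)%:E)) => //.
exact/measurable_EFinP.
Qed.

Let dev r w := b (r, w) - average w.

Let dev1 r w : `|dev r w| <= 1.
Proof.
rewrite /dev ler_norml; have /andP[? ?] := b01 (r, w).
by have /andP[? ?] := average_bounds w; apply/andP; split; lra.
Qed.

Let mdev r : measurable_fun setT (dev r).
Proof. by apply: measurable_funB => //; exact: measurable_average. Qed.

(** The cross term has integral zero, as the deviation from the average is centred under [U], and
    the deviation is at most 1 in absolute value. *)
Let integral_dev_sqr (x : R) w :
  (\int[U]_r ((x + dev r w) ^+ 2)%:E <= (x ^+ 2 + 1)%:E)%E.
Proof.
have mw : measurable_fun setT (fun r => dev r w) by apply: measurable_funB.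
have ib : U.-integrable setT (fun r => (b (r, w))%:E).
  apply/integrableP; split; first exact/measurable_EFinP.
  by under eq_integral do rewrite gee0_abs //; rewrite average_fin ltry.
have ic (c : R) : U.-integrable setT (fun=> c%:E).
  by apply: finite_measure_integrable_cst.
have id : U.-integrable setT (fun r => (dev r w)%:E).
  by under eq_fun do rewrite /dev EFinB; exact: integrableB.
have i2 : U.-integrable setT (fun r => ((2 * x) * dev r w)%:E).
  by under eq_fun do rewrite EFinM; exact: integrableZl.
apply: (@le_trans _ _ (\int[U]_r ((x ^+ 2 + 1)%:E + ((2 * x) * dev r w)%:E))%E).
  apply: ge0_le_integral => //.
  - by move=> r _; rewrite lee_fin sqr_ge0.
  - by apply/measurable_EFinP; apply: measurable_funX; apply: measurable_funD.
  - by apply: emeasurable_funD; [exact: measurable_cst|apply/measurable_EFinP; apply: measurable_funM].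
  - move=> r _; rewrite -EFinD lee_fin.
    have : dev r w ^+ 2 <= 1 by rewrite -[_ ^+ 2]real_normK ?num_real // expr_le1.
    by move: (dev r w) => y; rewrite (_ : (x + y) ^+ 2 = x ^+ 2 + y ^+ 2 + 2 * x * y); [lra|ring].
rewrite integralD // integral_prob_cst.
under [X in (_ + X)%E]eq_integral do rewrite EFinM.
rewrite integralZl // /dev; under [X in (_ + _ * X)%E]eq_integral do rewrite EFinB.
by rewrite integralB // average_fin integral_prob_cst subee // mule0 adde0.
Qed.

(* Averaging over r shows that some r increases the second moment by at most 1; iterating, the sample mean of n well chosen times is within 2 / n of the average in L^2. *)
Lemma sample_times (n : nat) : exists l : seq I,
  [/\ size l = n, (forall r, r \in l -> A r) &
   (\int[P]_w ((\sum_(r <- l) (b (r, w) - average w)) ^+ 2)%:E <= (n.*2)%:R%:E)%E].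
Proof.
elim: n => [|n [l [ln lA IH]]].
  exists [::]; split=> //; under eq_integral do rewrite big_nil expr0n /=.
  by rewrite integral0.
pose S w := \sum_(r <- l) dev r w.
have mS : measurable_fun setT S by apply: measurable_sum.
have S2 : (0 <= \int[P]_w (S w ^+ 2)%:E)%E.
  by apply: integral_ge0 => w _; rewrite lee_fin sqr_ge0.
suff [r [Ar Hr]] : exists r, A r /\
    (\int[P]_w ((S w + dev r w) ^+ 2)%:E <= \int[P]_w (S w ^+ 2)%:E + 2%:E)%E.
  exists (r :: l); split.
  - by rewrite /= ln.
  - by move=> r'; rewrite inE => /predU1P[->|/lA].
  - under eq_integral do rewrite big_cons addrC.
    apply: (le_trans Hr); rewrite doubleS.
    have -> : (n.*2.+2)%:R = n.*2%:R + 2 :> R by rewrite -addn2 natrD.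
    by rewrite (EFinD n.*2%:R) leeD2r.
(* If every time in [A] raised the second moment by at least 2, so would the average over [A], which
   has full measure; but the average raises it by at most 1. The gap between 1 and 2 gives the
   contradiction. *)
apply: contrapT => /forallNP H.
have {}H r : A r -> (\int[P]_w (S w ^+ 2)%:E + 2%:E <= \int[P]_w ((S w + dev r w) ^+ 2)%:E)%E.
  by move=> Ar; rewrite leNgt; apply/negP => /ltW ?; apply: (H r).
pose g (z : I * Om) := (S z.2 + dev z.1 z.2) ^+ 2.
have mg : measurable_fun setT (fun z => (g z)%:E).
  apply/measurable_EFinP; apply: measurable_funX; apply: measurable_funD.
    exact: measurableT_comp mS measurable_snd.
  rewrite /dev; apply: measurable_funB; last exact: measurableT_comp measurable_average measurable_snd.
  by under eq_fun do rewrite -surjective_pairing.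
have g0 z : (0 <= (g z)%:E)%E by rewrite lee_fin sqr_ge0.
have T := @fubini_tonelli _ _ _ _ _ U P _ mg g0.
have c1 : (\int[P]_w \int[U]_r (g (r, w))%:E <= \int[P]_w (S w ^+ 2)%:E + 1%:E)%E.
  have -> : (\int[P]_w (S w ^+ 2)%:E + 1%:E = \int[P]_w ((S w ^+ 2)%:E + 1))%E.
    rewrite ge0_integralD //; first by rewrite integral_prob_cst.
      by move=> w _; rewrite lee_fin sqr_ge0.
    by apply/measurable_EFinP; exact: measurable_funX.
  apply: ge0_le_integral => //.
  - by move=> w _; apply: integral_ge0.
  - exact: (@measurable_fun_fubini_tonelli_G _ _ _ _ _ U _ mg g0).
  - by apply: emeasurable_funD => //; apply/measurable_EFinP; exact: measurable_funX.
  - by move=> w _; exact: le_trans (integral_dev_sqr (S w) w) (lexx _).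
have c2 : (\int[P]_w (S w ^+ 2)%:E + 2%:E <= \int[U]_r \int[P]_w (g (r, w))%:E)%E.
  rewrite -[leLHS]mule1 -UA -integral_cst //.
  apply: (@le_trans _ _ (\int[U]_(r in A) \int[P]_w (g (r, w))%:E)%E).
    apply: ge0_le_integral => //.
    - by move=> r _; rewrite adde_ge0.
    - apply: (measurable_funTS (f := fun r => (\int[P]_w (g (r, w))%:E)%E)).
      exact: (@measurable_fun_fubini_tonelli_F _ _ _ _ _ P _ mg g0).
  apply: ge0_subset_integral => //.
    exact: (@measurable_fun_fubini_tonelli_F _ _ _ _ _ P _ mg g0).
  by move=> r _; apply: integral_ge0.
have fin : (\int[P]_w (S w ^+ 2)%:E \is a fin_num)%E.
  by rewrite ge0_fin_numE // (le_lt_trans IH) // ltry.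
move: c2; rewrite T => /le_trans /(_ c1).
by rewrite leeD2lE // lee_fin; lra.
Qed.

End sampling.

Section progressive.
Context (R : realType) d (Om : measurableType d) (P : probability Om R).
Variable G : set (set Om).
Hypothesis G_measurable : forall A, G A -> measurable A.
Hypothesis G_negligible : forall A, P.-negligible A -> G A.

(** Sample means over [2^k] times of [A] are measurable for the sigma-algebra generated by [G],
    since each time of [A] contributes such a function. Their squared L^2 distances to the average
    are summable, hence they converge to it almost surely, and the exceptional null set belongs to
    [G]. *)
Lemma gmeas_average d' (I : measurableType d') (U : probability I R) (A : set I)
    (b : I * Om -> R) :
  measurable A -> U A = 1%E -> measurable_fun setT b -> (forall z, 0 <= b z <= 1) ->
  (forall r, A r -> gmeas G (fun w => b (r, w))) -> gmeas G (average U b).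
Proof.
move=> mA UA mb b01 Gb.
have /choice[l Hl] := fun k : nat => sample_times P mA UA mb b01 (2 ^ k)%N.
pose M k w := (2 ^ k)%:R^-1 * \sum_(r <- l k) b (r, w).
have GM k : gmeas G (M k).
  have [_ lA _] := Hl k.
  apply: measurable_funM; first exact: measurable_cst.
  under eq_fun do rewrite big_tnth.
  by apply: measurable_sum => i; apply: Gb; apply: lA; exact: mem_tnth.
pose u k w := (M k w - average U b w) ^+ 2.
have mu k : measurable_fun setT (u k).
  apply: measurable_funX; apply: measurable_funB; last exact: measurable_average.
  exact: gmeas_measurable (GM k).
have u0 k w : (0 <= (u k w)%:E)%E by rewrite lee_fin sqr_ge0.
have pk k : 0 < (2 ^ k)%:R :> R by rewrite ltr0n expn_gt0.
(* The bound is [2 * 2^k / (2^k)^2 = 2 / 2^k], written as [4 / 2^(k+1)], the terms of a series with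
   sum 4. *)
have Iu k : (\int[P]_w (u k w)%:E <= (4 / (2 ^ k.+1)%:R)%:E)%E.
  have [ln lA H] := Hl k.
  have uE w : (u k w)%:E = (((2 ^ k)%:R^-1 ^+ 2)%:E *
      ((\sum_(r <- l k) (b (r, w) - average U b w)) ^+ 2)%:E)%E.
    rewrite -EFinM -exprMn; congr ((_ ^+ 2)%:E).
    rewrite sumrB mulrBr; congr (_ - _).
    by rewrite big_const_seq count_predT ln iter_addr_0 -[average _ _ _ *+ _]mulr_natl mulKf // gt_eqF.
  under eq_integral do rewrite uE.
  rewrite ge0_integralZl_EFin ?sqr_ge0 //.
  - apply: (@le_trans _ _ (((2 ^ k)%:R^-1 ^+ 2)%:E * ((2 ^ k).*2%:R)%:E)%E).
      by apply: lee_wpmul2l => //; rewrite lee_fin sqr_ge0.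
    rewrite -EFinM lee_fin -muln2 natrM expnS natrM.
    by rewrite le_eqVlt; apply/orP; left; apply/eqP; field; rewrite gt_eqF.
  - by move=> w _; rewrite lee_fin sqr_ge0.
  - apply/measurable_EFinP; apply: measurable_funX; apply: measurable_sum => r.
    by apply: measurable_funB; [exact: measurable_fun_pair2|exact: measurable_average].
have mser : measurable_fun setT (fun w => \sum_(0 <= k <oo) (u k w)%:E)%E.
  apply: (ge0_emeasurable_sum (P := xpredT)) => // k _.
  exact/measurable_EFinP.
have ser0 w : (0 <= \sum_(0 <= k <oo) (u k w)%:E)%E by apply: nneseries_ge0.
have iser : P.-integrable setT (fun w => \sum_(0 <= k <oo) (u k w)%:E)%E.
  apply/integrableP; split => //.
  under eq_integral do rewrite gee0_abs //.
  rewrite integral_nneseries //; last by move=> k; apply/measurable_EFinP.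
  apply: le_lt_trans (ltry 4); apply: le_trans (epsilon_trick0 xpredT _) => //.
  by apply: lee_nneseries; [move=> *; exact: integral_ge0|move=> k _; exact: Iu].
have := integrable_ae measurableT iser.
set N := [set w | ~ (M k w @[k --> \oo] --> average U b w)].
have neglN : P.-negligible N.
  apply: negligibleS (integrable_ae measurableT iser) => w /= Nw fw; apply: Nw.
  have /cvg_series_cvg_0 uw : cvgn (series (u ^~ w)).
    apply: nnseries_is_cvg; first by move=> k; exact: sqr_ge0.
    by rewrite ltey_eq fw.
  apply/cvgrPdist_lt => e e0.
  have e20 : 0 < e ^+ 2 by rewrite exprn_gt0.
  move/cvgrPdist_lt : uw => /(_ _ e20); apply: filterS => k /=.
  rewrite sub0r normrN ger0_norm ?sqr_ge0 // /u => h.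
  by rewrite distrC -(ltr_pXn2r (_ : 0 < 2)%N) ?nnegrE ?(ltW e0) // real_normK ?num_real.
move=> _.
pose M' k w := if w \in N then 0 else M k w.
have GM' k : gmeas G (M' k).
  apply: (gmeas_ae G_negligible (GM k) neglN) => w Nw.
  by rewrite /M' memNset.
have GY : gmeas G (fun w => if w \in N then 0 else average U b w).
  apply: (@measurable_fun_cvg _ (g_sigma_algebraType G) _ _ M') => // w _.
  rewrite /M'; case: ifPn => [_|]; first exact: cvg_cst.
  by move/negP; rewrite in_setE => /contrapT.
by apply: (gmeas_ae G_negligible GY neglN) => w Nw; rewrite memNset.
Qed.

Let egmeas (X : Om -> \bar R) :=
  @measurable_fun _ _ (g_sigma_algebraType G) _ setT X.

(** For [s < t] the time integral is [t - s] times the average under the uniform law on [[s, t]], a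
    law that charges only the times at which adaptedness is known. *)
Lemma gmeas_integral01 (s t : R) (c : R * Om -> R) :
  measurable_fun setT c -> (forall z, 0 <= c z <= 1) ->
  (forall r, s <= r <= t -> gmeas G (fun w => c (r, w))) ->
  egmeas (fun w => \int[lebesgue_measure]_(r in `[s, t]) (c (r, w))%:E)%E.
Proof.
move=> mc c01 Gc; have [st|ts] := ltP s t; last first.
  rewrite (_ : (fun w => _) = cst 0%E); first exact: measurable_cst.
  apply/funext => w; move: ts; rewrite le_eqVlt => /predU1P[->|ts].
    by rewrite set_itv1 integral_set1.
  by rewrite set_itv_ge ?integral_set0 // bnd_simp -ltNge.
have c0 z : (0 <= (c z)%:E)%E by rewrite lee_fin; case/andP: (c01 z).
have mcw w : @measurable_fun _ _ (measurableTypeR R) _ setT (fun r => (c (r, w))%:E).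
  by apply/measurable_EFinP; exact: measurable_fun_pair1.
pose U : probability (measurableTypeR R) R := uniform_prob st.
have ts0 : 0 < t - s by rewrite subr_gt0.
have E w : (\int[lebesgue_measure]_(r in `[s, t]) (c (r, w))%:E)%E =
    ((t - s)%:E * (average U c w)%:E)%E.
  have := integral_uniform st (mcw w) (fun r => c0 (r, w)).
  rewrite /average => ->; rewrite fineK; last first.
    rewrite ge0_fin_numE; last by rewrite mule_ge0 ?integral_ge0 // lee_fin invr_ge0 ltW.
    rewrite -(integral_uniform st (mcw w) (fun r => c0 (r, w))).
    rewrite (@le_lt_trans _ _ (\int[U]_r 1%:E)%E) //.
      by apply: ge0_le_integral => // r _; rewrite lee_fin; case/andP: (c01 (r, w)).
    by rewrite integral_prob_cst ltry.
  by rewrite muleA -EFinM divff ?gt_eqF // mul1e.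
rewrite /egmeas; under eq_fun do rewrite E -EFinM.
apply/measurable_EFinP; apply: measurable_funM; first exact: measurable_cst.
apply: (@gmeas_average _ _ U `[s, t]) => //.
by rewrite /U /= /uniform_prob integral_uniform_pdf1.
Qed.

(** Truncation at [n + 1] and division by [n + 1] bring the integrand into [[0, 1]]; monotone
    convergence removes the truncation. *)
Lemma gmeas_ge0_integral (s t : R) (c : R * Om -> R) :
  measurable_fun setT c -> (forall z, 0 <= c z) ->
  (forall r, s <= r <= t -> gmeas G (fun w => c (r, w))) ->
  egmeas (fun w => \int[lebesgue_measure]_(r in `[s, t]) (c (r, w))%:E)%E.
Proof.
move=> mc c0 Gc.
pose cn (n : nat) z := Num.min (c z) n.+1%:R.
have n0 (n : nat) : 0 < n.+1%:R :> R by rewrite ltr0n.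
have cn0 n z : 0 <= cn n z by rewrite le_min c0 ltW.
have mcn n : measurable_fun setT (cn n).
  by apply: measurable_minr => //; exact: measurable_cst.
have mcw n w : @measurable_fun _ _ (measurableTypeR R) _ setT (fun r => (cn n (r, w))%:E).
  by apply/measurable_EFinP; exact: (measurable_fun_pair1 w (mcn n)).
have Gcn n : egmeas (fun w => \int[lebesgue_measure]_(r in `[s, t]) (cn n (r, w))%:E)%E.
  have -> : (fun w => \int[lebesgue_measure]_(r in `[s, t]) (cn n (r, w))%:E)%E =
      (fun w => n.+1%:R%:E * \int[lebesgue_measure]_(r in `[s, t]) (n.+1%:R^-1 * cn n (r, w))%:E)%E.
    apply/funext => w; under [in RHS]eq_integral do rewrite EFinM.
    rewrite ge0_integralZl_EFin ?invr_ge0 ?(ltW (n0 n)) //.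
    - by rewrite muleA -EFinM divff ?gt_eqF // mul1e.
    - by move=> r _; rewrite lee_fin.
    - exact: measurable_funTS (mcw n w).
  apply: emeasurable_funM; first exact: measurable_cst.
  apply: (@gmeas_integral01 s t (fun z => n.+1%:R^-1 * cn n z)).
  - by apply: measurable_funM.
  - move=> z; rewrite mulr_ge0 ?invr_ge0 ?(ltW (n0 n)) //= mulrC ler_pdivrMr // mul1r.
    by rewrite ge_min lexx orbT.
  - move=> r sr; apply: measurable_funM; first exact: measurable_cst.
    by apply: measurable_minr; [exact: Gc|exact: measurable_cst].
apply: (@emeasurable_fun_cvg _ (g_sigma_algebraType G) _ _
  (fun n w => \int[lebesgue_measure]_(r in `[s, t]) (cn n (r, w))%:E)%E) => // w _.
have lim_cn z : (cn n z)%:E @[n --> \oo] --> (c z)%:E.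
  apply: cvg_near_cst; near=> n; congr (_%:E); apply/min_idPl.
  apply: (@le_trans _ _ n%:R); last by rewrite ler_nat.
  by near: n; exact: nbhs_infty_ger.
have := @cvg_monotone_convergence _ _ _ lebesgue_measure `[s, t] _ (fun n r => (cn n (r, w))%:E).
under [X in _ --> X]eq_integral do rewrite (cvg_lim _ (lim_cn _)) //.
apply => //.
- by move=> n; exact: measurable_funTS (mcw n w).
- by move=> n r _; rewrite lee_fin.
- move=> r _ n m nm; rewrite lee_fin /cn le_min ge_min lexx /=.
  by rewrite ge_min ler_nat ltnS nm orbT.
Unshelve. all: by end_near. Qed.

(* Progressive measurability of time integrals without a progressively measurable integrand: adaptedness and joint measurability suffice since G contains the null sets. *)
Lemma gmeas_Rintegral (s t : R) (b : R -> Om -> R) :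
  measurable_fun (`[s, t] `*` setT) (fun z : R * Om => b z.1 z.2) ->
  (forall r, s <= r <= t -> gmeas G (b r)) ->
  gmeas G (fun w => \int[lebesgue_measure]_(r in `[s, t]) b r w).
Proof.
move=> mb Gb.
pose D : set (R * Om) := `[s, t] `*` setT.
have mD : measurable D by exact: measurableX.
pose c (h : R -> R) : R * Om -> R := (fun z => Num.max (h (b z.1 z.2)) 0) \_ D.
have Gc (h : R -> R) : measurable_fun setT h ->
    egmeas (fun w => \int[lebesgue_measure]_(r in `[s, t]) (Num.max (h (b r w)) 0)%:E)%E.
  move=> mh.
  have -> : (fun w => \int[lebesgue_measure]_(r in `[s, t]) (Num.max (h (b r w)) 0)%:E)%E =
      (fun w => \int[lebesgue_measure]_(r in `[s, t]) (c h (r, w))%:E)%E.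
    apply/funext => w; apply: eq_integral => r; rewrite inE => rst.
    by rewrite /c patchT // inE.
  apply: gmeas_ge0_integral.
  - apply/(measurable_restrictT _ mD); apply: measurable_maxr; last exact: measurable_cst.
    exact: measurableT_comp.
  - by move=> z; rewrite /c patchE; case: ifP => // _; rewrite le_max lexx orbT.
  - move=> r rst.
    have -> : (fun w => c h (r, w)) = (fun w => Num.max (h (b r w)) 0).
      by apply/funext => w; rewrite /c patchT // inE; split => //=; rewrite in_itv.
    apply: measurable_maxr; last exact: measurable_cst.
    by apply: measurableT_comp => //; exact: Gb.
rewrite /gmeas /Rintegral.
apply: (@measurableT_comp _ _ _ _ _ _ fine).
  exact: fine_measurable.
under eq_fun do rewrite integralE.
apply: emeasurable_funB.
- under eq_fun do under eq_integral do rewrite funeposE -EFin_max.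
  exact: (Gc id (@measurable_id _ _ _)).
- under eq_fun do under eq_integral do rewrite funenegE -EFinN -EFin_max.
  by apply: (Gc -%R); exact: oppr_measurable.
Qed.

End progressive.

(** * Pathwise solutions of the particle system *)

Section gronwall.
Context (R : realType).
Local Notation mu := (@lebesgue_measure R).

Lemma continuous_integrable (f : R -> R) (a b : R) :
  continuous f -> mu.-integrable `[a, b] (EFin \o f).
Proof.
move=> cf; apply: continuous_compact_integrable; first exact: segment_compact.
exact: continuous_subspaceT.
Qed.

Lemma continuous_bounded (f : R -> R) (a b : R) : a <= b -> continuous f ->
  exists2 M, 0 <= M & forall t, a <= t <= b -> f t <= M.
Proof.
move=> ab cf; have [|c _ Hc] := @EVT_max R f a b ab; first exact: continuous_subspaceT.
exists (Num.max 0 (f c)); first by rewrite le_max lexx.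
by move=> t tab; rewrite le_max (Hc t) ?orbT // in_itv.
Qed.

Lemma Rintegral_itv1 (f : R -> R) (a : R) : \int[mu]_(r in `[a, a]) f r = 0.
Proof. by rewrite set_itv1 /Rintegral integral_set1. Qed.

Lemma Rintegral_cst_itv (k a b : R) : a <= b -> \int[mu]_(r in `[a, b]) k = k * (b - a).
Proof.
move=> ab; rewrite /Rintegral integral_cst //= lebesgue_measure_itv /= lte_fin.
case: ltP => // ba; have -> : a = b by apply/eqP; rewrite eq_le ab.
by rewrite mule0 subrr mulr0.
Qed.

Lemma continuous_primitive (f : R -> R) (s T : R) : s <= T ->
  mu.-integrable `[s, T] (EFin \o f) ->
  continuous (fun t => \int[mu]_(r in `[s, clip s T t]) f r).
Proof.
move=> sT fi.
apply: (@continuous_clip_comp _ s T (fun t => \int[mu]_(r in `[s, t]) f r)) => //.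
exact: parameterized_integral_continuous.
Qed.

Lemma is_derive_primitive (f : R -> R) (s x : R) : continuous f -> s < x ->
  is_derive x 1 (fun t => \int[mu]_(r in `[s, t]) f r) (f x).
Proof.
move=> cf sx.
have [|||d e] := @continuous_FTC1 R f (BLeft s) x (x + 1) _ _ _ (cf x).
- by rewrite ltrDl.
- exact: continuous_integrable.
- exact: sx.
by apply: DeriveDef; [exact: d|rewrite -derive1E; exact: e].
Qed.

Let is_derive_exp (k s x : R) :
  is_derive x 1 (fun u => expR (k * (u - s))) (k * expR (k * (x - s))).
Proof.
have H : is_derive x 1 (fun u => k * (u - s)) k.
  apply: is_derive_eq; rewrite /GRing.scale /=; ring.
have := @is_derive1_comp _ expR (fun u => k * (u - s)) x _ _ (is_derive_expR _) H.
by rewrite mulrC.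
Qed.

Let continuous_exp (k s : R) : continuous ((fun u => expR (k * (u - s))) : R -> R).
Proof.
move=> x; apply: (@continuous_comp R R R (fun u => k * (u - s)) expR); last exact: continuous_expR.
by apply: cvgM; [exact: cvg_cst|apply: cvgB; [exact: cvg_id|exact: cvg_cst]].
Qed.

(** The function [expR (- k (u - s))] times the integral of [D], minus the integral of [beta], is
    nonincreasing: by the hypothesis its derivative is at most
    [(expR (- k (u - s)) - 1) beta <= 0]. *)
Lemma gronwall (s T k : R) (D beta : R -> R) : 0 <= k ->
  continuous D -> continuous beta ->
  (forall t, s <= t <= T -> 0 <= beta t) ->
  (forall t, s <= t <= T -> D t <= k * \int[mu]_(r in `[s, t]) D r + beta t) ->
  forall t, s <= t <= T ->
    D t <= beta t + k * expR (k * (t - s)) * \int[mu]_(r in `[s, t]) beta r.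
Proof.
move=> k0 cD cb b0 H t /andP[st tT]; have stT : s <= t <= T by rewrite st.
apply: le_trans (H _ stT) _; rewrite addrC lerD2l -mulrA ler_wpM2l //.
move: (st); rewrite le_eqVlt => /predU1P[<-|slt].
  by rewrite !Rintegral_itv1 mulr0.
pose I u := \int[mu]_(r in `[s, u]) D r.
pose B u := \int[mu]_(r in `[s, u]) beta r.
pose psi u := expR (- k * (u - s)) * I u - B u.
have dpsi x : s < x -> is_derive x 1 psi
    (expR (- k * (x - s)) * D x + I x * (- k * expR (- k * (x - s))) - beta x).
  move=> sx.
  have dI := is_derive_primitive cD sx; have dB := is_derive_primitive cb sx.
  have dE := is_derive_exp (- k) s x.
  exact: is_deriveB (is_deriveM dE dI) dB.
have psi_t : psi t <= psi s.
  have cI f : continuous f -> {within `[s, t], continuous (fun u => \int[mu]_(r in `[s, u]) f r)}.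
    by move=> cf; apply: parameterized_integral_continuous => //; exact: continuous_integrable.
  have cE : {within `[s, t], continuous (fun u => expR (- k * (u - s)))}.
    by apply: continuous_subspaceT; exact: continuous_exp.
  have c1 x : x \in `]s, t[ -> derivable psi x 1.
    by rewrite in_itv /= => /andP[sx _]; have [] := dpsi x sx.
  have c2 x : x \in `]s, t[ -> derive1 psi x <= 0.
    rewrite in_itv /= => /andP[sx xt].
    have [_ dv] := dpsi x sx; rewrite derive1E dv.
    have xT : s <= x <= T by rewrite ltW //= (le_trans (ltW xt)).
    have E1 : expR (- k * (x - s)) <= 1.
      by rewrite -expR0 ler_expR mulNr oppr_le0 mulr_ge0 // subr_ge0 ltW.
    have Hx := H _ xT; have bx := b0 _ xT.
    have E0 := expR_ge0 (- k * (x - s)).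
    move: Hx E1 E0 bx; rewrite -/(I x); move: (expR _) (I x) (D x) (beta x) => e i dd bb.
    nra.
  have c3 : {within `[s, t], continuous psi}.
    move=> x; apply: cvgB; last exact: (cI _ cb).
    by apply: cvgM; [exact: cE|exact: (cI _ cD)].
  have s_in : s \in `[s, t] by rewrite in_itv /= lexx.
  have t_in : t \in `[s, t] by rewrite in_itv /= lexx st.
  exact: (ler0_derive1_le_cc c1 c2 c3 t_in s_in st).
move: psi_t; rewrite /psi /I /B subrr mulr0 !Rintegral_itv1 mulr0 subr0.
rewrite subr_le0 mulNr expRN => h.
by rewrite -ler_pdivrMl ?expR_gt0.
Qed.

Lemma integral_exp (a s t : R) : 0 < a -> s <= t ->
  \int[mu]_(r in `[s, t]) expR (a * (r - s)) <= a^-1 * expR (a * (t - s)).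
Proof.
move=> a0; rewrite le_eqVlt => /predU1P[<-|st].
  by rewrite Rintegral_itv1 mulr_ge0 ?expR_ge0 // invr_ge0 ltW.
pose F u := a^-1 * expR (a * (u - s)).
have dF (x : R) : is_derive x 1 F (expR (a * (x - s))).
  have dE := is_derive_exp a s x.
  have -> : expR (a * (x - s)) = a^-1 * (a * expR (a * (x - s))) by rewrite mulKf ?gt_eqF.
  exact: (@is_deriveZ _ _ _ _ a^-1 _ _ _ dE).
have cF : continuous F by move=> x; apply: cvgM; [exact: cvg_cst|exact: continuous_exp].
rewrite /Rintegral (@continuous_FTC2 _ _ F) //=.
- by rewrite /F lerBlDr lerDl mulr_ge0 ?expR_ge0 // invr_ge0 ltW.
- by apply: continuous_subspaceT; exact: continuous_exp.
- split; first by move=> x _; have [] := dF x.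
  + exact: cvg_at_right_filter (cF s).
  + exact: cvg_at_left_filter (cF t).
- by move=> x _; have [_] := dF x; rewrite derive1E.
Qed.

(** With [e_k = 2 C / 2^k], the sequence [u - e] increases, [u + e] decreases, and both have the
    same limit. Being enclosed by them, the limit is within [e_k] of [u_k]. *)
Lemma geometric_cvg (u : nat -> R) (C : R) : (forall k, `|u k.+1 - u k| <= C / 2 ^+ k) ->
  exists l, u @ \oo --> l /\ forall k, `|l - u k| <= 2 * C / 2 ^+ k.
Proof.
move=> H.
have p2 k : 0 < 2 ^+ k :> R by rewrite exprn_gt0.
have E k : C / 2 ^+ k.+1 = C / 2 ^+ k / 2 by rewrite exprSr invfM mulrA.
have C0 : 0 <= C by have := le_trans (normr_ge0 _) (H 0%N); rewrite expr0 divr1.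
pose e k := 2 * C / 2 ^+ k.
have eS k : e k.+1 = e k / 2 by rewrite /e -mulrA E; field; rewrite gt_eqF.
have eE k : e k = 2 * (C / 2 ^+ k) by rewrite /e mulrA.
have e0 k : 0 <= e k by rewrite /e !mulr_ge0 // invr_ge0 ltW.
have ecvg : e @ \oo --> (0 : R).
  have : geometric (2 * C) 2^-1 @ \oo --> (0 : R).
    by apply: cvg_geometric; rewrite ger0_norm ?invr_ge0 // invf_lt1 ?ltr1n.
  by apply: cvg_trans; apply: near_eq_cvg; near=> k; rewrite /e /geometric /= exprVn.
pose v k := u k - e k; pose w k := u k + e k.
have vS : {homo v : n m / (n <= m)%N >-> n <= m}.
  apply/nondecreasing_seqP => k; rewrite /v eS; have := H k; have := eE k.
  by rewrite ler_norml => ? /andP[? ?]; lra.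
have wS : {homo w : n m / (n <= m)%N >-> m <= n}.
  apply/nonincreasing_seqP => k; rewrite /w eS; have := H k; have := eE k.
  by rewrite ler_norml => ? /andP[? ?]; lra.
have vc : cvgn v.
  apply: nondecreasing_is_cvgn => //; exists (w 0%N) => _ [k _ <-].
  by apply: le_trans (wS _ _ (leq0n k)); rewrite /v /w; have := e0 k; lra.
exists (limn v).
have uc : u @ \oo --> limn v.
  have -> : u = (fun k => v k + e k) by apply/funext => k; rewrite /v subrK.
  by rewrite -[limn v]addr0; apply: cvgD.
have wc : w @ \oo --> limn v.
  by rewrite -[limn v]addr0; apply: cvgD.
split=> // k; rewrite -/(e k).
have h1 := nondecreasing_cvgn_le vS vc k.
have h2 : limn v <= w k.
  have := nonincreasing_cvgn_ge wS (cvgP _ wc) k; by rewrite (cvg_lim _ wc).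
by rewrite ler_norml; move: h1 h2; rewrite /v /w => ? ?; apply/andP; split; lra.
Unshelve. all: by end_near. Qed.

End gronwall.

Lemma rV_subE (R : realType) n (A B : 'rV[R]_n) i : (A - B) 0 i = A 0 i - B 0 i.
Proof. by rewrite !mxE. Qed.

(** * Picard iteration for one path *)

Section picard.
Context (R : realType) (n : nat) (s T kap : R).
Local Notation mu := (@lebesgue_measure R).
Hypothesis sT : s <= T.
Hypothesis kap0 : 0 <= kap.

Definition norm1 (z : 'rV[R]_n) := \sum_i `|z 0 i|.
Definition cpath (Y : R -> 'rV[R]_n) := forall i, continuous (fun t => Y t 0 i).

Lemma norm1_ge0 z : 0 <= norm1 z.
Proof. by rewrite /norm1 sumr_ge0. Qed.

Lemma ler_norm1 (z : 'rV[R]_n) i : `|z 0 i| <= norm1 z.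
Proof. by rewrite /norm1 (bigD1 i) //= lerDl sumr_ge0. Qed.

Lemma cpath_norm1 Y : cpath Y -> continuous (fun t => norm1 (Y t)).
Proof.
move=> cY t; apply: cvg_big => [|i _]; first exact: add_continuous.
apply: cvg_norm; exact: cY.
Qed.

Lemma cpathB Y Z : cpath Y -> cpath Z -> cpath (fun t => Y t - Z t).
Proof.
move=> cY cZ i t.
have -> : (fun t => (Y t - Z t) 0 i) = (fun t => Y t 0 i - Z t 0 i).
  by apply/funext => u; rewrite !mxE.
by apply: cvgB; [exact: cY|exact: cZ].
Qed.

Variables (g : R -> 'rV[R]_n -> 'I_n -> R) (m : R -> 'I_n -> R).
Hypothesis glip : forall r z z' i, s <= r <= T ->
  `|g r z i - g r z' i| <= kap * norm1 (z - z').
Hypothesis gint : forall Y, cpath Y ->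
  forall i, mu.-integrable `[s, T] (EFin \o (fun r => g r (Y r) i)).
Hypothesis mcont : forall i, continuous (m ^~ i).
Hypothesis mclip : forall t i, m (clip s T t) i = m t i.

(** The noise is additive, so for a fixed outcome it enters only through the continuous path [m],
    and the stochastic equation becomes an ordinary integral equation. *)
Definition picard_step (Y : R -> 'rV[R]_n) (t : R) : 'rV[R]_n :=
  \row_i (m t i + \int[mu]_(r in `[s, clip s T t]) g r (Y r) i).

Definition picard_iter k := iter k picard_step (fun t => \row_i m t i).

Lemma picard_iterS k : picard_iter k.+1 = picard_step (picard_iter k).
Proof. by []. Qed.

Lemma clip_clip t : clip s T (clip s T t) = clip s T t.
Proof. by rewrite clip_id // clip_bounds. Qed.

Lemma picard_iter_clip k t : picard_iter k (clip s T t) = picard_iter k t.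
Proof.
by case: k => [|k]; apply/rowP => i; rewrite !mxE mclip // clip_clip.
Qed.

Let sub_clip t : `[s, clip s T t] `<=` `[s, T].
Proof.
apply: subset_itvl; rewrite bnd_simp; by have /andP[] := clip_bounds t sT.
Qed.

Let gint_sub Y i t : cpath Y ->
  mu.-integrable `[s, clip s T t] (EFin \o (fun r => g r (Y r) i)).
Proof. by move=> cY; apply: integrableS (gint cY i). Qed.

Lemma picard_step_cpath Y : cpath Y -> cpath (picard_step Y).
Proof.
move=> cY i t.
have -> : (fun u => picard_step Y u 0 i) =
    (fun u => m u i + \int[mu]_(r in `[s, clip s T u]) g r (Y r) i).
  by apply/funext => u; rewrite mxE.
apply: cvgD; first exact: mcont.
exact: (continuous_primitive sT (gint cY i)).
Qed.

Lemma picard_iter_cpath k : cpath (picard_iter k).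
Proof.
elim: k => [|k]; last exact: picard_step_cpath.
move=> i; have -> : (fun t => picard_iter 0 t 0 i) = m^~ i; last exact: mcont.
by apply/funext => t; rewrite mxE.
Qed.

Lemma picard_step_diff Y Z t i : cpath Y -> cpath Z ->
  `|picard_step Y t 0 i - picard_step Z t 0 i| <=
    kap * \int[mu]_(r in `[s, clip s T t]) norm1 (Y r - Z r).
Proof.
move=> cY cZ; rewrite !mxE opprD addrACA subrr add0r.
have iY := gint_sub i t cY; have iZ := gint_sub i t cZ.
rewrite -RintegralB //.
have cN := cpath_norm1 (cpathB cY cZ).
have iN : mu.-integrable `[s, clip s T t] (EFin \o (fun r => norm1 (Y r - Z r))).
  exact: continuous_integrable.
have iD : mu.-integrable `[s, clip s T t] (EFin \o (fun r => g r (Y r) i - g r (Z r) i)).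
  by have := integrableB _ iY iZ; apply.
apply: le_trans (le_normr_Rintegral _ iD) _ => //.
rewrite -RintegralZl //; apply: le_Rintegral => //.
- by have := integrable_norm iD.
- by have := @integrableZl _ _ _ mu _ _ kap _ iN; apply.
- move=> r rt; apply: glip; have := sub_clip rt.
  by rewrite /= in_itv.
Qed.

(** The iterates converge geometrically in a supremum norm with exponential weight. The limit is
    recorded as a pointwise limit of the iterates because that is how measurability in the outcome
    passes to the solution. *)
Lemma picard_limit : exists X : R -> 'rV[R]_n,
  [/\ forall t i, (fun k => picard_iter k t 0 i) @ \oo --> X t 0 i,
      cpath X & forall t, X t = picard_step X t].
Proof.
(* For the weight [expR (a (t - s))] one step multiplies the distance by at most
   [n kap / a <= 1 / 2]; the summand 1 keeps [a] positive. *)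
pose a := 2 * n%:R * kap + 1.
have a0 : 0 < a by rewrite ltr_wpDl // !mulr_ge0.
have cD k : cpath (fun t => picard_iter k.+1 t - picard_iter k t).
  by apply: cpathB; exact: picard_iter_cpath.
have [M M0 HM] := continuous_bounded sT (cpath_norm1 (cD 0%N)).
have p2 k : 0 < 2 ^+ k :> R by rewrite exprn_gt0.
have cexp : continuous ((fun u => expR (a * (u - s))) : R -> R).
  move=> x; apply: (@continuous_comp R R R (fun u => a * (u - s)) expR); last exact: continuous_expR.
  by apply: cvgM; [exact: cvg_cst|apply: cvgB; [exact: cvg_id|exact: cvg_cst]].
have dec k t : s <= t <= T ->
    norm1 (picard_iter k.+1 t - picard_iter k t) <= M / 2 ^+ k * expR (a * (t - s)).
  elim: k t => [|k IH] t st.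
    rewrite expr0 divr1; apply: le_trans (HM t st) _; rewrite ler_peMr //.
    by rewrite -expR0 ler_expR mulr_ge0 ?(ltW a0) // subr_ge0; case/andP: st.
  pose c := M / 2 ^+ k.
  have c0 : 0 <= c by rewrite divr_ge0 // ltW.
  have step i : `|(picard_iter k.+2 t - picard_iter k.+1 t) 0 i| <=
      kap * (c * (a^-1 * expR (a * (t - s)))).
    rewrite rV_subE.
    have := picard_step_diff t i (@picard_iter_cpath k.+1) (@picard_iter_cpath k).
    rewrite -!picard_iterS => /le_trans; apply.
    rewrite ler_wpM2l // clip_id //.
    have iE : mu.-integrable `[s, t] (EFin \o (fun r => expR (a * (r - s)))).
      exact: continuous_integrable.
    apply: (@le_trans _ _ (\int[mu]_(r in `[s, t]) (c * expR (a * (r - s))))).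
      apply: le_Rintegral => //.
      - by apply: continuous_integrable; apply: cpath_norm1; exact: (cD k).
      - by have := @integrableZl _ _ _ mu _ _ c _ iE; apply.
      - move=> r; rewrite /= in_itv /= => /andP[sr rt]; apply: IH.
        by rewrite sr (le_trans rt) //; case/andP: st.
    rewrite RintegralZl // ler_wpM2l // integral_exp //.
    by case/andP: st.
  apply: (le_trans (ler_sum _ (fun i _ => step i))).
  rewrite sumr_const card_ord -[_ *+ n]mulr_natl.
  have -> : M / 2 ^+ k.+1 * expR (a * (t - s)) = c * expR (a * (t - s)) / 2.
    by rewrite /c exprS; field; rewrite gt_eqF.
  have -> : n%:R * (kap * (c * (a^-1 * expR (a * (t - s))))) =
      c * expR (a * (t - s)) * (n%:R * kap / a) by ring.
  rewrite ler_wpM2l ?mulr_ge0 ?expR_ge0 // ler_pdivrMr //.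
  by rewrite /a; lra.
pose C := M * expR (a * (T - s)).
have C0 : 0 <= C by rewrite mulr_ge0 // expR_ge0.
have inc t i k : `|picard_iter k.+1 t 0 i - picard_iter k t 0 i| <= C / 2 ^+ k.
  rewrite -(picard_iter_clip k.+1 t) -(picard_iter_clip k t).
  have ct := clip_bounds t sT.
  have -> : picard_iter k.+1 (clip s T t) 0 i - picard_iter k (clip s T t) 0 i =
      (picard_iter k.+1 (clip s T t) - picard_iter k (clip s T t)) 0 i by rewrite rV_subE.
  apply: le_trans (ler_norm1 _ _) _; apply: (le_trans (dec k _ ct)).
  rewrite /C mulrAC ler_wpM2r ?invr_ge0 ?(ltW (p2 k)) // ler_wpM2l // ler_expR.
  by rewrite ler_wpM2l ?(ltW a0) // lerB //; case/andP: ct.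
have /choice[l Hl] : forall ti : R * 'I_n, exists l,
    (fun k => picard_iter k ti.1 0 ti.2) @ \oo --> l /\
    forall k, `|l - picard_iter k ti.1 0 ti.2| <= 2 * C / 2 ^+ k.
  by move=> ti; apply: geometric_cvg; exact: inc.
pose X t : 'rV[R]_n := \row_i l (t, i).
have Xc t i : (fun k => picard_iter k t 0 i) @ \oo --> X t 0 i.
  by rewrite mxE; exact: (Hl (t, i)).1.
have Xd t i k : `|X t 0 i - picard_iter k t 0 i| <= 2 * C / 2 ^+ k.
  by rewrite mxE; exact: (Hl (t, i)).2.
have small e : 0 < e -> exists k, 2 * C / 2 ^+ k < e.
  move=> e0.
  have : geometric (2 * C) 2^-1 @ \oo --> (0 : R).
    by apply: cvg_geometric; rewrite ger0_norm ?invr_ge0 // invf_lt1 ?ltr1n.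
  move=> /cvgrPdist_lt /(_ _ e0) [k _ /(_ k (leqnn k))].
  rewrite /= sub0r normrN ger0_norm ?mulr_ge0 ?exprn_ge0 ?invr_ge0 // exprVn => h.
  by exists k.
have cX : cpath X.
  move=> i t; apply/cvgrPdist_lt => e e0.
  have e30 : 0 < e / 3 by rewrite divr_gt0.
  have [k Hk] := small _ e30.
  have := @picard_iter_cpath k i t; move=> /cvgrPdist_lt /(_ _ e30).
  apply: filterS => u /= Hu.
  have H1 := le_lt_trans (Xd t i k) Hk; have H2 := le_lt_trans (Xd u i k) Hk.
  move: H1 H2 Hu; rewrite !ltr_norml => /andP[? ?] /andP[? ?] /andP[? ?].
  by apply/andP; split; lra.
exists X; split=> // t; apply/rowP => i.
apply/eqP; rewrite -subr_eq0 -normr_le0; apply/ler_addgt0Pr => e e0; rewrite add0r.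
pose q := 1 + kap * (n%:R * (T - s)).
have q0 : 0 < q.
  by rewrite ltr_pwDl // !mulr_ge0 // subr_ge0.
have [k Hk] := small (e / q) (divr_gt0 e0 q0).
have bnd r : norm1 (X r - picard_iter k r) <= n%:R * (2 * C / 2 ^+ k).
  apply: (@le_trans _ _ (\sum_(j < n) 2 * C / 2 ^+ k)).
    by apply: ler_sum => j _; rewrite rV_subE; exact: Xd.
  by rewrite sumr_const card_ord -[_ *+ n]mulr_natl.
have ct := clip_bounds t sT.
have h2 : `|picard_step X t 0 i - picard_iter k.+1 t 0 i| <=
    kap * (n%:R * (2 * C / 2 ^+ k) * (T - s)).
  have := picard_step_diff t i cX (@picard_iter_cpath k).
  rewrite -picard_iterS => /le_trans; apply.
  rewrite ler_wpM2l //.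
  apply: (@le_trans _ _ (\int[mu]_(r in `[s, clip s T t]) (n%:R * (2 * C / 2 ^+ k)))).
    apply: le_Rintegral => //.
    - by apply: continuous_integrable; apply: cpath_norm1; apply: cpathB => //; exact: picard_iter_cpath.
    - by apply: continuous_integrable => ?; exact: cvg_cst.
  rewrite Rintegral_cst_itv; last by case/andP: ct.
  by rewrite ler_wpM2l ?mulr_ge0 ?invr_ge0 ?(ltW (p2 _)) // lerB //; case/andP: ct.
have -> : X t 0 i - picard_step X t 0 i =
  (X t 0 i - picard_iter k.+1 t 0 i) - (picard_step X t 0 i - picard_iter k.+1 t 0 i) by ring.
apply: le_trans (ler_normB _ _) _.
apply: (@le_trans _ _ (2 * C / 2 ^+ k * q)); last by rewrite -ler_pdivlMr // ltW.
have h1 : `|X t 0 i - picard_iter k.+1 t 0 i| <= 2 * C / 2 ^+ k.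
  apply: (le_trans (Xd _ _ _)); rewrite ler_wpM2l ?mulr_ge0 // lef_pV2 ?posrE //.
  by rewrite exprS ler_peMl ?(ltW (p2 k)) // ler1n.
by move: h1 h2; rewrite /q; move: (2 * C / 2 ^+ k) => z; lra.
Qed.

End picard.

Section real_integrable.
Context d (S : measurableType d) (R : realType) (mu : {measure set S -> \bar R}) (D : set S).
Hypothesis mD : measurable D.

Lemma real_integrableD (f g : S -> R) : mu.-integrable D (EFin \o f) ->
  mu.-integrable D (EFin \o g) -> mu.-integrable D (EFin \o (fun x => f x + g x)).
Proof. by move=> fi gi; have := integrableD mD fi gi; apply. Qed.

Lemma real_integrableZ (k : R) (f : S -> R) : mu.-integrable D (EFin \o f) ->
  mu.-integrable D (EFin \o (fun x => k * f x)).
Proof. by move=> fi; have := integrableZl mD k fi; apply. Qed.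

Lemma real_integrable_norm (f : S -> R) : mu.-integrable D (EFin \o f) ->
  mu.-integrable D (EFin \o (fun x => `|f x|)).
Proof. by move=> fi; have := integrable_norm fi; apply. Qed.

End real_integrable.

(** * The same control drives the system at every noise level *)

Section particles.
Context (R : realType) (T sigma K : R) (f : R -> R -> R -> P2 R -> R).
Hypothesis T0 : 0 < T.
Hypothesis K0 : 0 <= K.
Hypothesis fK : drift_lipschitz T K f.
Local Notation mu := (@lebesgue_measure R).

Lemma drift_norm1 n t th (z z' : 'rV[R]_n.+1) i : 0 <= t <= T ->
  `|f t th (z 0 i) (emp z) - f t th (z' 0 i) (emp z')| <= 2 * K * norm1 (z - z').
Proof.
move=> tT; apply: (le_trans (fK _ _ _ _ _ _ tT tT)).
rewrite !subrr !normr0 !add0r [2 * K]mulrC -mulrA ler_wpM2l //.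
have h1 : `|z 0 i - z' 0 i| <= norm1 (z - z') by rewrite -rV_subE ler_norm1.
have h2 : mean (fun i => `|z 0 i - z' 0 i|) <= norm1 (z - z').
  rewrite /norm1; under [leRHS]eq_bigr do rewrite rV_subE.
  exact: mean_le_sum.
by move: h1 h2; lra.
Qed.

Variables (s : R) (c : weak_control R).
Hypothesis sT : 0 <= s <= T.
Hypothesis basis : is_control_basis s T c.
Let P := wc_P c.
Let s_ge0 : 0 <= s. Proof. by case/andP: sT. Qed.
Let sleT : s <= T. Proof. by case/andP: sT. Qed.

(** The generators of the augmented filtration at time [t], named separately so that adaptedness can
    be stated by [gmeas]. *)
Definition history (t : R) : set (set (wc_Om c)) :=
  [set A | (exists i, exists2 r, s <= r <= t & preimage_sets (wc_W c i r) A)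
           \/ P.-negligible A].

Lemma history_measurable t A : t <= T -> history t A -> measurable A.
Proof.
have [complete bm _ _ _] := basis.
move=> tT [[i [r /andP[sr rt] [B mB <-]]]|]; last exact: complete.
have [mW _ _ _ _] := bm i.
rewrite -[X in measurable X]setTI; apply: mW => //.
by rewrite sr (le_trans rt).
Qed.

Lemma history_negligible t A : P.-negligible A -> history t A.
Proof. by right. Qed.

Lemma gmeas_history_measurable t (X : wc_Om c -> R) :
  t <= T -> gmeas (history t) X -> measurable_fun setT X.
Proof. by move=> tT; apply: gmeas_measurable => A; exact: history_measurable. Qed.

Lemma gmeas_history_le r t (X : wc_Om c -> R) : r <= t -> gmeas (history r) X -> gmeas (history t) X.
Proof.
move=> rt /gmeasP H; apply/gmeasP; apply: (subset_trans H).
apply: sub_smallest2r; first exact: smallest_sigma_algebra.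
move=> A [[i [q /andP[sq qr] HA]]|nA]; last by right.
by left; exists i, q => //; rewrite sq (le_trans qr).
Qed.

Lemma adaptedP (X : R -> wc_Om c -> R) :
  adapted s T (augmented_filtration P s (wc_W c)) X <->
  forall t, s <= t <= T -> gmeas (history t) (X t).
Proof. by split=> H t st; [apply/gmeasP|apply/gmeasP]; exact: H. Qed.

Lemma gmeas_W i r t : s <= r <= t -> gmeas (history t) (wc_W c i r).
Proof.
by move=> rt; apply/gmeasP => A HA; apply: sub_gen_smallest; left; exists i, r.
Qed.

Lemma ae_W_continuous :
  {ae P, forall w, forall i, {within `[s, T], continuous (fun t => wc_W c i t w)}}.
Proof. by apply: ae_foralln => i; have [_ bm _ _ _] := basis; have [] := bm i. Qed.

Lemma theta_section w :
  measurable_fun `[s, T] (fun r => wc_theta c r w).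
Proof.
have [_ _ _ mth _] := basis.
apply: (@measurable_comp _ _ _ _ _ _ (`[s, T] `*` setT) (fun z => wc_theta c z.1 z.2)
  _ (fun r => (r, w))) => //.
- exact: measurableX.
- by move=> _ [r rs <-].
- exact: measurable_funTS (measurable_pair2 w).
Qed.

Lemma theta_gmeas r t : s <= r <= t -> t <= T -> gmeas (history t) (wc_theta c r).
Proof.
have [_ _ _ _ /adaptedP ath] := basis.
move=> /andP[sr rt] tT; apply: (gmeas_history_le rt); apply: ath.
by rewrite sr (le_trans rt).
Qed.

Lemma continuous_clip_path n (Y : R -> 'rV[R]_n) :
  (forall i, {within `[s, T], continuous (fun t => Y t 0 i)}) ->
  cpath (fun t => Y (clip s T t)).
Proof. by move=> cY i; exact: (continuous_clip_comp sleT (cY i)). Qed.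

(** Along two continuous paths the drifts differ by at most [2 K] times the continuous distance of
    the paths, so integrability in time passes from one path to the other whatever the control
    is. *)
Lemma drift_integrable n w (Y Z : R -> 'rV[R]_n.+1) i :
  cpath Y -> cpath Z ->
  mu.-integrable `[s, T] (EFin \o (fun r => f r (wc_theta c r w) (Y r 0 i) (emp (Y r)))) ->
  mu.-integrable `[s, T] (EFin \o (fun r => f r (wc_theta c r w) (Z r 0 i) (emp (Z r)))).
Proof.
move=> cY cZ iY.
pose h r := `|f r (wc_theta c r w) (Y r 0 i) (emp (Y r))| + 2 * K * norm1 (Z r - Y r).
have iN : mu.-integrable `[s, T] (EFin \o (fun r => norm1 (Z r - Y r))).
  by apply: continuous_integrable; apply: cpath_norm1; exact: cpathB.
have ih : mu.-integrable `[s, T] (EFin \o h).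
  apply: real_integrableD => //; first exact: real_integrable_norm.
  exact: real_integrableZ.
have mZ : measurable_fun `[s, T] (fun r => f r (wc_theta c r w) (Z r 0 i) (emp (Z r))).
  apply: (measurable_drift (K := K) i (ltW T0)) => //.
  - by move=> r; rewrite /= in_itv /= => /andP[sr rT]; rewrite rT (le_trans s_ge0).
  - exact: theta_section.
  - by move=> j; apply: measurable_funTS; apply: continuous_measurable_fun; exact: cZ.
apply: (le_integrable _ _ _ ih) => //.
  by apply/measurable_EFinP; exact: mZ.
move=> r; rewrite /= in_itv /= => /andP[sr rT].
rewrite lee_fin [leRHS]ger0_norm; last by rewrite addr_ge0 // !mulr_ge0 // norm1_ge0.
have rT' : 0 <= r <= T by rewrite rT (le_trans s_ge0).
have := drift_norm1 (wc_theta c r w) (Z r) (Y r) i rT'.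
rewrite /h => H; rewrite addrC -lerBlDr; apply: le_trans H.
exact: lerB_dist.
Qed.

(* The solution Y is needed only because it makes the drift integrable in time, which is not assumed of theta. *)
Lemma transfer_solution (n : nat) (x : 'rV[R]_n.+1) (eps eps' : R) Y :
  @is_solution R T sigma f eps s c n x Y ->
  exists X, @is_solution R T sigma f eps' s c n x X.
Proof.
have [complete _ _ mth _] := basis.
move=> [_ Yc Ye].
(* On the null event where a path is discontinuous or the drift is not integrable, the indicator
   [chi] switches off noise and drift, so that the iteration is defined for every outcome. As null
   sets belong to every [history t], the indicator is adapted. *)
pose good w := (forall i, {within `[s, T], continuous (fun t => wc_W c i t w)}) /\
  (forall i, {within `[s, T], continuous (fun t => Y t w 0 i)}) /\
  (forall i, mu.-integrable `[s, T]
    (EFin \o (fun r => f r (wc_theta c r w) (Y r w 0 i) (emp (Y r w))))).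
have nbad : P.-negligible (~` [set w | good w]).
  have : {ae P, forall w, good w}.
    move: ae_W_continuous Yc Ye; apply: filterS3 => w h1 h2 h3; split => //; split => // i.
    by have [] := h3 i T; rewrite ?sleT ?lexx.
  by [].
pose chi w : R := if `[< good w >] then 1 else 0.
have chi1 w : good w -> chi w = 1 by move=> gw; rewrite /chi asboolT.
have chi0 w : ~ good w -> chi w = 0 by move=> gw; rewrite /chi asboolF.
have chi_le w : `|chi w| <= 1.
  by rewrite /chi; case: ifP => _; rewrite ?normr1 ?normr0.
have gchi t : gmeas (history t) chi.
  apply: (@gmeas_ae _ _ _ P _ (@history_negligible t) (cst 1) chi _ _ nbad).
    exact: measurable_cst.
  by move=> w /= ngw; rewrite chi1 //; apply: contrapT.
pose m w t (i : 'I_n.+1) := chi w * (x 0 i + sigma * (wc_W c 0%N (clip s T t) w - wc_W c 0%N s w)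
  + eps' * (wc_W c i.+1 (clip s T t) w - wc_W c i.+1 s w)).
pose g w r (z : 'rV[R]_n.+1) i := chi w * f (clip s T r) (wc_theta c r w) (z 0 i) (emp z).
have clipT r : 0 <= clip s T r <= T.
  by have /andP[h1 h2] := clip_bounds r sleT; rewrite h2 (le_trans s_ge0).
have k0 : 0 <= 2 * K by rewrite mulr_ge0.
have glip w r z z' i : s <= r <= T -> `|g w r z i - g w r z' i| <= 2 * K * norm1 (z - z').
  move=> _; rewrite /g -mulrBr normrM -[leRHS]mul1r.
  by apply: ler_pM => //; exact: drift_norm1.
have gint w Z : cpath Z -> forall i,
    mu.-integrable `[s, T] (EFin \o (fun r => g w r (Z r) i)).
  move=> cZ i; have [gw|gw] := pselect (good w); last first.
    rewrite (_ : _ \o _ = EFin \o (fun=> 0)).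
      by apply: continuous_integrable => ?; exact: cvg_cst.
    by apply/funext => r; rewrite /g /= chi0 // mul0r.
  have [_ [h2 h3]] := gw.
  have cY := continuous_clip_path h2.
  have iY : mu.-integrable `[s, T] (EFin \o (fun r =>
      f r (wc_theta c r w) (Y (clip s T r) w 0 i) (emp (Y (clip s T r) w)))).
    apply: eq_integrable (h3 i) => // r; rewrite inE /= in_itv /= => rT.
    by rewrite clip_id.
  apply: eq_integrable (drift_integrable cY cZ iY) => // r; rewrite inE /= in_itv /= => rT.
  by rewrite /g chi1 // mul1r clip_id.
have mcont w i : continuous (fun t => m w t i).
  have [gw|gw] := pselect (good w); last first.
    rewrite (_ : (fun t => _) = fun=> 0); first by move=> ?; exact: cvg_cst.
    by apply/funext => t; rewrite /m chi0 // mul0r.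
  have [h1 _] := gw.
  have cW j : continuous (fun t => wc_W c j (clip s T t) w).
    exact: (continuous_clip_comp sleT (h1 j)).
  move=> t; apply: cvgM; first exact: cvg_cst.
  apply: cvgD.
    apply: cvgD; first exact: cvg_cst.
    by apply: cvgM; [exact: cvg_cst|apply: cvgB; [exact: cW|exact: cvg_cst]].
  by apply: cvgM; [exact: cvg_cst|apply: cvgB; [exact: cW|exact: cvg_cst]].
have mclip w t i : m w (clip s T t) i = m w t i by rewrite /m clip_clip.
pose it w k := picard_iter s T (g w) (m w) k.
have itc w k : cpath (it w k) := @picard_iter_cpath _ _ _ _ sleT _ _ (gint w) (mcont w) k.
have itclip w k t : it w k (clip s T t) = it w k t.
  by apply: (picard_iter_clip sleT) => t' i; exact: mclip.
have /choice[X HX] : forall w, exists X : R -> 'rV[R]_n.+1,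
    [/\ forall t i, (fun k => it w k t 0 i) @ \oo --> X t 0 i,
      cpath X & forall t, X t = picard_step s T (g w) (m w) X t].
  move=> w; exact: (picard_limit sleT k0 (glip w) (gint w) (mcont w) (mclip w)).
have gm t i : s <= t <= T -> gmeas (history t) (fun w => m w t i).
  move=> st; apply: measurable_funM; first exact: gchi.
  have st' : s <= clip s T t <= t by rewrite clip_id // lexx andbT; case/andP: st.
  have st0 : s <= s <= t by rewrite lexx; case/andP: st.
  apply: measurable_funD.
    apply: measurable_funD; first exact: measurable_cst.
    apply: measurable_funM; first exact: measurable_cst.
    by apply: measurable_funB; exact: gmeas_W.
  apply: measurable_funM; first exact: measurable_cst.
  by apply: measurable_funB; exact: gmeas_W.
(* Adaptedness by induction over the iterates. Joint measurability, required of the integrand by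
   [gmeas_Rintegral], holds because each iterate is continuous in time and measurable at each
   time. *)
have git k : forall t i, s <= t <= T -> gmeas (history t) (fun w => it w k t 0 i).
  elim: k => [|k IH] t i st.
    by rewrite /it /picard_iter /=; under eq_fun do rewrite mxE; exact: gm.
  have [st1 tT] := andP st.
  rewrite /it; under eq_fun do rewrite picard_iterS mxE.
  apply: measurable_funD; first exact: gm.
  rewrite clip_id //.
  have mit j : measurable_fun setT (fun z : R * wc_Om c => it z.2 k z.1 0 j).
    apply: (@measurable_caratheodory R _ (wc_Om c) (fun r w => it w k r 0 j)).
      by move=> w; exact: itc.
    move=> r; have cr := clip_bounds r sleT.
    under eq_fun do rewrite -itclip.
    by apply: (@gmeas_history_measurable (clip s T r)); [case/andP: cr|exact: IH].
  apply: (gmeas_Rintegral (P := P)).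
  - by move=> A; exact: history_measurable.
  - exact: history_negligible.
  - have mchi : measurable_fun setT chi.
      exact: gmeas_history_measurable (lexx T) (gchi T).
    have mchi2 : measurable_fun (`[s, t] `*` setT) (fun z : R * wc_Om c => chi z.2).
      by apply: measurable_funTS; exact: measurableT_comp mchi measurable_snd.
    apply: (measurable_funM mchi2).
    apply: (@measurable_drift R T K f n i _ _ _ (fun z => clip s T z.1) (fun z => wc_theta c z.1 z.2)
      (fun z : R * wc_Om c => it z.2 k z.1) (ltW T0) K0 fK) => //.
    + apply: measurable_funTS; apply: measurableT_comp measurable_fst.
      by apply: continuous_measurable_fun; exact: clip_continuous.
    + apply: measurable_funS mth; first exact: measurableX.
      move=> [r w] /= [rt _]; split => //; move: rt.
      by rewrite !in_itv /= => /andP[-> rt]; rewrite (le_trans rt).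
    + by move=> j; exact: measurable_funTS (mit j).
  - move=> r rt; have [sr rt'] := andP rt.
    have sr' : s <= r <= T by rewrite sr (le_trans rt').
    apply: (measurable_funM (gchi t)).
    apply: (@measurable_drift R T K f n i _ (g_sigma_algebraType (history t)) setT
      (fun=> clip s T r) (wc_theta c r) (fun w => it w k r) (ltW T0) K0 fK) => //.
    + exact: theta_gmeas.
    + by move=> j; apply: (gmeas_history_le rt'); exact: IH.
exists (fun t w => X w t); split.
- move=> i; apply/adaptedP => t st.
  apply: (@measurable_fun_cvg _ (g_sigma_algebraType (history t)) _ _ (fun k w => it w k t 0 i)).
    by move=> k; exact: git.
  by move=> w _; have [h _ _] := HX w; exact: h.
- apply: aeW => w i; apply: continuous_subspaceT.
  by have [_ h _] := HX w; exact: h.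
- have : {ae P, forall w, good w} by [].
  apply: filterS => w gw i t st; have [st1 tT] := andP st; have [_ cX eX] := HX w.
  have E r : s <= r <= t -> g w r (X w r) i = f r (wc_theta c r w) (X w r 0 i) (emp (X w r)).
    by move=> /andP[sr rt]; rewrite /g chi1 // mul1r clip_id // sr (le_trans rt).
  split.
    have sub : `[s, t] `<=` `[s, T] by apply: subset_itvl; rewrite bnd_simp.
    have H : mu.-integrable `[s, t] (EFin \o (fun r => g w r (X w r) i)).
      by apply: integrableS (gint w (X w) cX i).
    apply: eq_integrable H => //.
    by move=> r; rewrite inE /= in_itv /= => rt; rewrite E.
  rewrite {1}eX mxE /m chi1 // mul1r clip_id //.
  under eq_Rintegral => r.
    by rewrite inE /= in_itv /= => rt; rewrite E //; over.
  by ring.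
Qed.

End particles.

(** * Stability and growth of the particle system path by path *)

Lemma real_integrableB d (S : measurableType d) (R : realType)
    (mu : {measure set S -> \bar R}) (D : set S) (f g : S -> R) : measurable D ->
  mu.-integrable D (EFin \o f) -> mu.-integrable D (EFin \o g) ->
  mu.-integrable D (EFin \o (fun x => f x - g x)).
Proof. by move=> mD fi gi; have := integrableB mD fi gi; apply. Qed.

Lemma le_subset_Rintegral d (S : measurableType d) (R : realType)
    (mu : {measure set S -> \bar R}) (A B : set S) (f : S -> R) :
  measurable A -> measurable B -> A `<=` B -> mu.-integrable B (EFin \o f) ->
  (forall x, 0 <= f x) ->
  \int[mu]_(x in A) f x <= \int[mu]_(x in B) f x.
Proof.
move=> mA mB AB fi f0; rewrite /Rintegral.
have mf := measurable_int _ fi.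
apply: fine_le.
- by apply: integrable_fin_num => //; exact: integrableS fi.
- exact: integrable_fin_num.
- by apply: ge0_subset_integral => // x _; rewrite lee_fin.
Qed.

Lemma sum_affine (R : realType) n (a b : 'I_n -> R) (q e : R) :
  \sum_i (a i + q + e * b i) = \sum_i a i + n%:R * q + e * \sum_i b i.
Proof. by rewrite !big_split /= sumr_const card_ord -[q *+ n]mulr_natl mulr_sumr. Qed.

Section stability.
Context (R : realType) (T sigma K : R) (f : R -> R -> R -> P2 R -> R).
Hypothesis T0 : 0 < T.
Hypothesis K0 : 0 <= K.
Hypothesis fK : drift_lipschitz T K f.
Local Notation mu := (@lebesgue_measure R).
Variables (s : R) (c : weak_control R).
Hypothesis sT : 0 <= s <= T.
Hypothesis basis : is_control_basis s T c.
Let P := wc_P c.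
Let s_ge0 : 0 <= s. Proof. by case/andP: sT. Qed.
Let sleT : s <= T. Proof. by case/andP: sT. Qed.

(** The system for one fixed outcome [w], which makes the estimates below deterministic. *)
Definition path_solution (n : nat) (x : 'rV[R]_n.+1) (eps : R) (w : wc_Om c)
    (X : R -> 'rV[R]_n.+1) :=
  (forall i, {within `[s, T], continuous (fun t => X t 0 i)}) /\
  (forall i t, s <= t <= T ->
    let b := fun r => f r (wc_theta c r w) (X r 0 i) (emp (X r)) in
    mu.-integrable `[s, t] (EFin \o b) /\
    X t 0 i = x 0 i + \int[mu]_(r in `[s, t]) b r
      + sigma * (wc_W c 0%N t w - wc_W c 0%N s w)
      + eps * (wc_W c i.+1 t w - wc_W c i.+1 s w)).

Definition continuous_noise (w : wc_Om c) :=
  forall i, {within `[s, T], continuous (fun t => wc_W c i t w)}.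

Lemma ae_path_solution n (x : 'rV[R]_n.+1) eps X :
  @is_solution R T sigma f eps s c n x X ->
  {ae P, forall w, continuous_noise w /\ path_solution x eps w (X ^~ w)}.
Proof.
move=> [_ Xc Xe]; move: (ae_W_continuous basis) Xc Xe.
by apply: filterS3 => w h1 h2 h3; split => //; split.
Qed.

Definition increment (w : wc_Om c) (j : nat) (t : R) : R :=
  wc_W c j (clip s T t) w - wc_W c j s w.

Definition idio_noise (n : nat) (w : wc_Om c) (t : R) : R :=
  \sum_(i < n.+1) `|increment w i.+1 t|.

(** The Lipschitz constant of the drift for [norm1]: there are [n + 1] coordinates, each with
    constant [2 K]. *)
Definition rate (n : nat) : R := n.+1%:R * (2 * K).
Definition gronwall_cst (n : nat) : R := rate n * expR (rate n * (T - s)).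

Lemma rate_ge0 n : 0 <= rate n.
Proof. by rewrite !mulr_ge0. Qed.

Lemma gronwall_cst_ge0 n : 0 <= gronwall_cst n.
Proof. by rewrite mulr_ge0 ?expR_ge0 // rate_ge0. Qed.

Lemma continuous_increment w j : continuous_noise w -> continuous (increment w j).
Proof.
move=> cw t; apply: cvgB; last exact: cvg_cst.
exact: (continuous_clip_comp sleT (cw j)).
Qed.

Lemma continuous_idio_noise n w : continuous_noise w -> continuous (idio_noise n w).
Proof.
move=> cw t; apply: cvg_big => [|i _]; first exact: add_continuous.
by apply: cvg_norm; exact: continuous_increment.
Qed.

Lemma idio_noise_ge0 n w t : 0 <= idio_noise n w t.
Proof. by rewrite sumr_ge0. Qed.

Lemma gronwall_cst_bound n (D beta : R -> R) :
  continuous D -> continuous beta -> (forall t, s <= t <= T -> 0 <= beta t) ->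
  (forall t, s <= t <= T -> D t <= rate n * \int[mu]_(r in `[s, t]) D r + beta t) ->
  forall t, s <= t <= T ->
    D t <= beta t + gronwall_cst n * \int[mu]_(r in `[s, t]) beta r.
Proof.
move=> cD cb b0 H t st; apply: (le_trans (gronwall (rate_ge0 n) cD cb b0 H st)).
rewrite lerD2l ler_wpM2r //.
  apply: Rintegral_ge0 => r; rewrite /= in_itv /= => /andP[sr rt].
  by apply: b0; rewrite sr (le_trans rt) //; case/andP: st.
rewrite /gronwall_cst ler_wpM2l ?rate_ge0 // ler_expR ler_wpM2l ?rate_ge0 //.
by rewrite lerB //; case/andP: st.
Qed.

(** The initial value and the common noise cancel in the difference, and the two drifts share the
    control. What remains is [(e1 - e2)] times the idiosyncratic increments, so that Gronwall's
    inequality gives a bound free of the control. *)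
Lemma path_difference n (x : 'rV[R]_n.+1) e1 e2 w X Y t :
  continuous_noise w -> path_solution x e1 w X -> path_solution x e2 w Y ->
  s <= t <= T ->
  norm1 (X t - Y t) <= `|e1 - e2| * (idio_noise n w t +
    gronwall_cst n * \int[mu]_(r in `[s, t]) idio_noise n w r).
Proof.
move=> cw [cX eX] [cY eY] st.
have cX' := continuous_clip_path sT cX; have cY' := continuous_clip_path sT cY.
pose D u := norm1 (X (clip s T u) - Y (clip s T u)).
have cD : continuous D := cpath_norm1 (cpathB cX' cY').
have cN := @continuous_idio_noise n w cw.
pose beta u := `|e1 - e2| * idio_noise n w u.
have cb : continuous beta by move=> u; apply: cvgM; [exact: cvg_cst|exact: cN].
have H u : s <= u <= T -> D u <= rate n * \int[mu]_(r in `[s, u]) D r + beta u.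
  move=> su; have [sle uT] := andP su.
  have m_su : @measurable _ (measurableTypeR R) `[s, u] by exact: measurable_itv.
  have step i : `|(X u - Y u) 0 i| <= 2 * K * \int[mu]_(r in `[s, u]) D r
      + `|e1 - e2| * `|increment w i.+1 u|.
    rewrite rV_subE; have [iX ->] := eX i u su; have [iY ->] := eY i u su.
    rewrite /increment clip_id //.
    set bX := \int[mu]_(r in _) _; set bY := \int[mu]_(r in _) _.
    set B := wc_W c i.+1 u w - wc_W c i.+1 s w.
    rewrite (_ : _ - _ = (bX - bY) + (e1 - e2) * B); last by ring.
    apply: le_trans (ler_normD _ _) _; rewrite normrM lerD2r.
    rewrite /bX /bY -RintegralB //.
    have iD : mu.-integrable `[s, u] (EFin \o D) by exact: continuous_integrable.
    have iB : mu.-integrable `[s, u] (EFin \o (fun r => f r (wc_theta c r w) (X r 0 i) (emp (X r)) -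
        f r (wc_theta c r w) (Y r 0 i) (emp (Y r)))).
      exact: real_integrableB.
    have := le_normr_Rintegral m_su iB => /le_trans; apply.
    rewrite -RintegralZl //; apply: le_Rintegral => //.
    - exact: real_integrable_norm.
    - exact: real_integrableZ.
    - move=> r; rewrite /= in_itv /= => /andP[sr ru].
      have rT : r <= T := le_trans ru uT.
      rewrite /D clip_id ?sr //; apply: (drift_norm1 K0 fK).
      by rewrite rT (le_trans s_ge0).
  rewrite {1}/D clip_id //; apply: (le_trans (ler_sum _ (fun i _ => step i))).
  rewrite big_split /= sumr_const card_ord -[_ *+ n.+1]mulr_natl /rate -mulrA -!mulrA lerD2l.
  by rewrite -mulr_sumr.
have b0 u : s <= u <= T -> 0 <= beta u by move=> _; rewrite mulr_ge0 // idio_noise_ge0.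
have := gronwall_cst_bound cD cb b0 H st.
rewrite {1}/D clip_id // /beta RintegralZl //; last exact: continuous_integrable.
by rewrite mulrCA -mulrDr.
Qed.

(** The free term of Gronwall's inequality for [norm1 (Y t)]: the initial configuration, the drift
    at the origin, the time integral of [|theta|], and the noises. *)
Definition growth_noise n (w : wc_Om c) (x : 'rV[R]_n.+1) (eps t : R) : R :=
  norm1 x + n.+1%:R * ((`|f 0 0 0 (emp (0 : 'rV[R]_n.+1))| + K * T) * T
    + K * \int[mu]_(r in `[s, T]) `|wc_theta c r w|
    + `|sigma| * `|increment w 0 t|) + `|eps| * idio_noise n w t.

Lemma continuous_growth_noise n w (x : 'rV[R]_n.+1) eps :
  continuous_noise w -> continuous (growth_noise w x eps).
Proof.
move=> cw u; apply: cvgD; last first.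
  by apply: cvgM; [exact: cvg_cst|exact: continuous_idio_noise].
apply: cvgD; first exact: cvg_cst.
apply: cvgM; first exact: cvg_cst.
apply: cvgD; first exact: cvg_cst.
by apply: cvgM; [exact: cvg_cst|apply: cvg_norm; exact: continuous_increment].
Qed.

Lemma path_growth n (x : 'rV[R]_n.+1) eps w Y t :
  continuous_noise w -> path_solution x eps w Y ->
  mu.-integrable `[s, T] (EFin \o (fun r => wc_theta c r w)) ->
  s <= t <= T ->
  norm1 (Y t) <= growth_noise w x eps t +
    gronwall_cst n * \int[mu]_(r in `[s, t]) growth_noise w x eps r.
Proof.
move=> cw [cY eY] ith st.
have cY' := continuous_clip_path sT cY.
pose D u := norm1 (Y (clip s T u)).
have cD : continuous D := cpath_norm1 cY'.
have cN := @continuous_idio_noise n w cw.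
pose F0 := `|f 0 0 0 (emp (0 : 'rV[R]_n.+1))| + K * T.
have F00 : 0 <= F0 by rewrite addr_ge0 // mulr_ge0 // ltW.
pose A := \int[mu]_(r in `[s, T]) `|wc_theta c r w|.
have A0 : 0 <= A by apply: Rintegral_ge0.
have iath := real_integrable_norm ith.
have cb : continuous (growth_noise w x eps) by exact: continuous_growth_noise.
have b0 u : s <= u <= T -> 0 <= growth_noise w x eps u.
  move=> _; rewrite /growth_noise -/F0 -/A addr_ge0 ?mulr_ge0 ?idio_noise_ge0 //.
  by rewrite addr_ge0 ?norm1_ge0 // mulr_ge0 // !addr_ge0 ?mulr_ge0 // ltW.
have H u : s <= u <= T -> D u <= rate n * \int[mu]_(r in `[s, u]) D r + growth_noise w x eps u.
  move=> su; have [sle uT] := andP su.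
  have m_su : @measurable _ (measurableTypeR R) `[s, u] by exact: measurable_itv.
  have iD : mu.-integrable `[s, u] (EFin \o D) by exact: continuous_integrable.
  have iath' : mu.-integrable `[s, u] (EFin \o (fun r => `|wc_theta c r w|)).
    apply: integrableS iath => //; by apply: subset_itvl; rewrite bnd_simp.
  have step i : `|Y u 0 i| <= `|x 0 i| + (2 * K * \int[mu]_(r in `[s, u]) D r + (F0 * T
      + K * A + `|sigma| * `|increment w 0 u|)) + `|eps| * `|increment w i.+1 u|.
    have [iY ->] := eY i u su.
    rewrite /increment clip_id //.
    set bY := \int[mu]_(r in _) _.
    have HbY : `|bY| <= 2 * K * \int[mu]_(r in `[s, u]) D r + F0 * T + K * A.
      have := le_normr_Rintegral m_su iY; rewrite -/bY => /le_trans; apply.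
      have i1 : mu.-integrable `[s, u] (EFin \o (fun r => 2 * K * D r)) by exact: real_integrableZ.
      have i2 : mu.-integrable `[s, u] (EFin \o (fun r => F0)).
        by apply: continuous_integrable => ?; exact: cvg_cst.
      have i3 : mu.-integrable `[s, u] (EFin \o (fun r => K * `|wc_theta c r w|)).
        exact: real_integrableZ.
      have i12 := real_integrableD m_su i1 i2.
      have i123 := real_integrableD m_su i12 i3.
      apply: (@le_trans _ _ (\int[mu]_(r in `[s, u]) (2 * K * D r + F0 + K * `|wc_theta c r w|))).
        apply: le_Rintegral => //; first exact: real_integrable_norm.
        move=> r; rewrite /= in_itv /= => /andP[sr ru].
        have rT : r <= T := le_trans ru uT.
        have r0 : 0 <= r := le_trans s_ge0 sr.
        have rT' : 0 <= r <= T by rewrite r0.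
        have T00 : 0 <= (0 : R) <= T by rewrite lexx ltW.
        rewrite /D clip_id ?sr //.
        have := drift_norm1 K0 fK (wc_theta c r w) (Y r) 0 i rT'; rewrite subr0 => H1.
        have := fK (wc_theta c r w) 0 0 0 (0 : 'rV[R]_n.+1) 0 rT' T00.
        rewrite !subr0 normr0 addr0.
        have -> : mean (fun i : 'I_n.+1 => `|(0 : 'rV[R]_n.+1) 0 i - (0 : 'rV[R]_n.+1) 0 i|) = 0.
          by rewrite -[RHS](mean_cst n); apply: eq_mean => j; rewrite subrr normr0.
        rewrite addr0 (ger0_norm r0) => H2.
        have H3 : K * r <= K * T by rewrite ler_wpM2l.
        rewrite mxE in H1.
        set fy := f _ _ _ _ in H1 *; set f1 := f _ _ _ _ in H1 H2; set f2 := f _ _ _ _ in H2.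
        (* The drift is compared with its value at the zero configuration, and this in turn with its
           value at time 0 and control 0. *)
        have -> : fy = (fy - f1) + (f1 - f2) + f2 by ring.
        apply: le_trans (ler_normD _ _) _.
        apply: le_trans (lerD (ler_normD _ _) (lexx _)) _.
        by rewrite /F0 -/f2; move: H1 H2 H3; rewrite mulrDr; lra.
      rewrite RintegralD // RintegralD // RintegralZl // RintegralZl //.
      apply: lerD.
        rewrite lerD2l Rintegral_cst_itv //.
        by rewrite ler_wpM2l // lerBlDr; move: uT s_ge0; lra.
      rewrite ler_wpM2l // /A; apply: le_subset_Rintegral => //.
      by apply: subset_itvl; rewrite bnd_simp.
    set B := wc_W c i.+1 u w - wc_W c i.+1 s w; set B0 := wc_W c 0 u w - wc_W c 0 s w.
    apply: le_trans (ler_normD _ _) _; rewrite normrM lerD2r.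
    apply: le_trans (ler_normD _ _) _; rewrite normrM.
    apply: le_trans (lerD (ler_normD _ _) (lexx _)) _.
    by move: HbY; lra.
  rewrite {1}/D clip_id //; apply: (le_trans (ler_sum _ (fun i _ => step i))).
  rewrite sum_affine /growth_noise /rate -/F0 -/A -/(norm1 x) -/(idio_noise n w u).
  move: (\int[mu]_(r in _) _) (norm1 x) (idio_noise n w u) (`|increment w 0 u|) => I q1 q2 q3.
  rewrite le_eqVlt; apply/orP; left; apply/eqP; ring.
have := gronwall_cst_bound cD cb b0 H st.
by rewrite {1}/D clip_id.
Qed.

Lemma unique_solution n (x : 'rV[R]_n.+1) eps X Y :
  @is_solution R T sigma f eps s c n x X -> @is_solution R T sigma f eps s c n x Y ->
  {ae P, forall w t, s <= t <= T -> X t w = Y t w}.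
Proof.
move=> /ae_path_solution hX /ae_path_solution hY.
move: hX hY; apply: filterS2 => w [cw pX] [_ pY] t st.
have := path_difference cw pX pY st; rewrite subrr normr0 mul0r => H.
apply/rowP => i; apply/eqP; rewrite -subr_eq0 -normr_le0 -rV_subE.
exact: le_trans (ler_norm1 _ _) H.
Qed.

Lemma well_posed_transfer eps eps' :
  well_posed T sigma f eps s c -> well_posed T sigma f eps' s c.
Proof.
move=> wp n x; split; last by move=> X Y; exact: unique_solution.
have [[Y HY] _] := wp n x.
by apply: (transfer_solution T0 K0 fK sT basis _ HY).
Qed.

End stability.

(** * Comparison of the costs for two noise levels *)

Section lower_integral.
Context d (S : measurableType d) (R : realType) (P : {measure set S -> \bar R}).
Import HBNNSimple.

Lemma le_lower_integral (F G : S -> \bar R) : (forall w, 0 <= F w)%E ->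
  (forall w, F w <= G w)%E -> (\int[P]_w F w <= \int[P]_w G w)%E.
Proof.
move=> F0 FG; have G0 w : (0 <= G w)%E := le_trans (F0 w) (FG w).
rewrite !ge0_integralTE //; apply: le_ereal_sup => _ [h hF <-].
by exists h => // w; exact: le_trans (hF w) (FG w).
Qed.

(* The integral of a nonnegative function is the supremum over the simple functions below it, so that neither F nor G has to be measurable. *)
Lemma lower_integral_affine (F G r : S -> \bar R) (k : R) : 0 < k ->
  (forall w, 0 <= F w)%E -> (forall w, 0 <= G w)%E -> (forall w, 0 <= r w)%E ->
  measurable_fun setT r ->
  {ae P, forall w, (F w <= k%:E * G w + r w)%E} ->
  (\int[P]_w F w <= k%:E * \int[P]_w G w + \int[P]_w r w)%E.
Proof.
move=> k0 F0 G0 r0 mr [N [mN PN FN]].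
have ki : 0 <= k^-1 by rewrite invr_ge0 ltW.
rewrite [leLHS]ge0_integralTE //; apply: ge_ereal_sup => _ [h hF <-].
have -> : sintegral P h = (\int[P]_w (h w)%:E)%E by rewrite integral_nnsfun // patch_setT.
(* The positive part of [(h - r) / k], put to zero on the exceptional set, is measurable, lies below
   [G], and satisfies [h <= k H + r] almost everywhere. *)
pose H w := (if w \in N then 0 else k^-1%:E * maxe ((h w)%:E - r w) 0)%E.
have mh : measurable_fun setT (fun w => (h w)%:E) by apply/measurable_EFinP.
have mH : measurable_fun setT H.
  apply: measurable_fun_ifT => //; last first.
    apply: emeasurable_funM; first exact: measurable_cst.
    by apply: measurable_maxe => //; apply: emeasurable_funB.
  by apply: measurable_fun_bool true _; rewrite setTI preimage_mem_true.
have H0 w : (0 <= H w)%E.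
  by rewrite /H; case: ifP => // _; rewrite mule_ge0 // le_max lexx orbT.
have HG w : (H w <= G w)%E.
  rewrite /H; case: ifPn => // wN.
  have : (F w <= k%:E * G w + r w)%E.
    by apply: contrapT => h1; move/negP: wN; apply; rewrite inE; apply: FN.
  move=> /(le_trans (hF w)) hw.
  rewrite -[leRHS]mul1e -(mulVf (lt0r_neq0 k0)) EFinM -muleA.
  apply: lee_wpmul2l; first by rewrite lee_fin.
  rewrite ge_max; apply/andP; split; last by rewrite mule_ge0 // lee_fin ltW.
  have [rfin|] := boolP (r w \is a fin_num).
    by rewrite leeBlDr.
  rewrite ge0_fin_numE // -leNgt leye_eq => /eqP ->.
  exact: leNye.
apply: (@le_trans _ _ (\int[P]_w (k%:E * H w + r w))%E); last first.
  rewrite ge0_integralD //.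
  - rewrite ge0_integralZl_EFin ?(ltW k0) // leeD2r //.
    by apply: lee_wpmul2l; [rewrite lee_fin ltW|exact: le_lower_integral].
  - by move=> w _; rewrite mule_ge0 // lee_fin ltW.
  - by apply: emeasurable_funM.
apply: ae_ge0_le_integral => //.
- by move=> w _; rewrite lee_fin.
- by move=> w _; rewrite adde_ge0 // mule_ge0 // lee_fin ltW.
- by apply: emeasurable_funD => //; apply: emeasurable_funM.
exists N; split => // w /= nw; apply: contrapT => wN; apply: nw => _.
rewrite /H memNset // muleA -EFinM divff ?gt_eqF // mul1e.
have [rfin|] := boolP (r w \is a fin_num).
  by rewrite -leeBlDr // le_max lexx.
by rewrite ge0_fin_numE // -leNgt leye_eq => /eqP ->; rewrite addey ?leey // gt_eqF // (lt_le_trans (ltNy0)) // le_max lexx orbT.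
Qed.

End lower_integral.

(* Layer cake: both sides equal the double integral of 1_{0 <= t < h y}. *)
Lemma integral_density d (S : measurableType d) (R : realType)
    (mu : {sigma_finite_measure set S -> \bar R}) (nu : probability S R) (g h : S -> R) :
  measurable_fun setT g -> (forall y, 0 <= g y) ->
  (forall A, measurable A -> nu A = (\int[mu]_(y in A) (g y)%:E)%E) ->
  measurable_fun setT h -> (forall y, 0 <= h y) ->
  (\int[nu]_y (h y)%:E = \int[mu]_y (h y * g y)%:E)%E.
Proof.
move=> mg g0 nuE mh h0.
pose leb : {sigma_finite_measure set (measurableTypeR R) -> \bar R} := @lebesgue_measure R.
pose k (z : S * measurableTypeR R) : R := if (0 <= z.2) && (z.2 < h z.1) then 1 else 0.
have k0 z : 0 <= k z by rewrite /k; case: ifP.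
have mk : measurable_fun setT k.
  apply: measurable_fun_ifT; [|exact: measurable_cst|exact: measurable_cst].
  apply: measurable_and.
    apply: measurable_fun_ler; first exact: measurable_cst.
    by have := @measurable_snd _ _ S (measurableTypeR R); apply.
  apply: measurable_fun_ltr; first by have := @measurable_snd _ _ S (measurableTypeR R); apply.
  by apply: measurableT_comp => //; exact: measurable_fst.
have layer y : (\int[leb]_t (k (y, t))%:E = (h y)%:E)%E.
  rewrite -[RHS]adde0 -[X in (_ + X)%E]oppe0.
  have -> : (fun t => (k (y, t))%:E) = (fun t => (\1_(`[0, h y[%classic) t)%:E).
    apply/funext => t; rewrite indicE /k /=; congr (_%:E).
    by rewrite mem_setE in_itv /=; case: (_ && _).
  rewrite integral_indic // setIT.
  have := @lebesgue_measure_itv R `[0, h y[%R; rewrite /= => ->.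
  rewrite lte_fin; case: ltP => [_|h1]; first by rewrite -EFinD subr0.

  by have -> : h y = 0; [by apply/eqP; rewrite eq_le h1 h0|rewrite oppr0 addr0].
have mkE : measurable_fun setT (fun z => (k z)%:E) by apply/measurable_EFinP.
have kE0 z : (0 <= (k z)%:E)%E by rewrite lee_fin.
under eq_integral do rewrite -layer.
rewrite (@fubini_tonelli _ _ _ _ _ nu leb _ mkE kE0).
have inner t : (\int[nu]_y (k (y, t))%:E = \int[mu]_y (k (y, t) * g y)%:E)%E.
  pose A := [set y | k (y, t) = 1].
  have mkt : measurable_fun setT (fun y => k (y, t)) by exact: measurable_fun_pair1.
  have mA : measurable A.
    have -> : A = setT `&` (fun y => k (y, t)) @^-1` [set 1] by rewrite setTI.
    by apply: mkt.
  have kA y : k (y, t) = \1_A y.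
    rewrite indicE; have [|] := boolP (y \in A).
      by rewrite inE => ->.
    rewrite notin_setE /A /= /k /=; case: ifP => //.
  under eq_integral do rewrite kA.
  transitivity (nu A); first by rewrite integral_indic // setIT.
  rewrite nuE //.
  rewrite integral_mkcond; apply: eq_integral => y _.
  rewrite patchE kA indicE; case: ifP => _; by rewrite ?mul1r ?mul0r.
under eq_integral do rewrite inner.
have mkg : measurable_fun setT (fun z : S * measurableTypeR R => (k z * g z.1)%:E).
  apply/measurable_EFinP; apply: measurable_funM => //.
  by apply: measurableT_comp => //; exact: measurable_fst.
have kg0 (z : S * measurableTypeR R) : (0 <= (k z * g z.1)%:E)%E by rewrite lee_fin mulr_ge0.
rewrite -(@fubini_tonelli _ _ _ _ _ mu leb _ mkg kg0).
apply: eq_integral => y _ /=.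
under eq_integral do rewrite mulrC EFinM.
rewrite ge0_integralZl_EFin //; first by rewrite layer -EFinM mulrC.
apply/measurable_EFinP; exact: measurable_fun_pair2.
Qed.

(** With [u = x^2 / (4 sg^2)], the inequality [u expR (- u) <= 1] bounds [x^2] times the Gaussian by
    [4 sg^2] times the Gaussian of deviation [sqrt 2 * sg]. The ratio of the two normalisations is
    at most 2, which gives the factor 8. *)
Lemma normal_second_moment (R : realType) (sg : R) : 0 < sg ->
  (\int[normal_prob 0 sg]_x (x ^+ 2)%:E <= (8 * sg ^+ 2)%:E)%E.
Proof.
move=> sg0; have sgn : sg != 0 by rewrite gt_eqF.
pose q : R := Num.sqrt 2 * sg.
have q2 : q ^+ 2 = 2 * sg ^+ 2 by rewrite exprMn sqr_sqrtr.
have qn : q != 0 by rewrite mulf_neq0 // gt_eqF // sqrtr_gt0.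
rewrite (@integral_density _ _ R lebesgue_measure (normal_prob 0 sg) (normal_pdf 0 sg)) //.
- apply: (@le_trans _ _ (\int[lebesgue_measure]_x (8 * sg ^+ 2 * normal_pdf 0 q x)%:E)%E); last first.
    under eq_integral do rewrite EFinM.
    rewrite ge0_integralZl_EFin ?integral_normal_pdf ?mule1 ?mulr_ge0 ?sqr_ge0 //.
    + by move=> x _; rewrite lee_fin normal_pdf_ge0.
    + by apply/measurable_EFinP; exact: measurable_normal_pdf.
    + exact: ltW.
    + exact: ltW.
  apply: ge0_le_integral => //.
  + by move=> x _; rewrite lee_fin mulr_ge0 ?sqr_ge0 ?normal_pdf_ge0.
  + apply/measurable_EFinP; apply: measurable_funM; last exact: measurable_normal_pdf.
    exact: exprn_measurable.
  + by apply/measurable_EFinP; apply: measurable_funM => //; exact: measurable_normal_pdf.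
  move=> x _; rewrite lee_fin !normal_pdfE //=.
  have pk : normal_peak sg <= 2 * normal_peak q.
    rewrite /normal_peak q2.
    have -> : 2 * sg ^+ 2 * pi *+ 2 = 2 * (sg ^+ 2 * pi *+ 2) by rewrite -mulrnAr; ring.
    set B := sg ^+ 2 * pi *+ 2.
    have B0 : 0 < B by rewrite mulrn_wgt0 // mulr_gt0 ?pi_gt0 // exprn_gt0.
    rewrite sqrtrM // invfM mulrA ler_peMl ?invr_ge0 ?sqrtr_ge0 //.
    rewrite ler_pdivlMr ?sqrtr_gt0 // mul1r.
    rewrite -[leRHS](@ger0_norm _ 2) // -sqrtr_sqr ler_sqrt // expr2; lra.
  have fn : x ^+ 2 * normal_fun 0 sg x <= 4 * sg ^+ 2 * normal_fun 0 q x.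
    rewrite /normal_fun q2 !subr0.
    pose u := x ^+ 2 / (4 * sg ^+ 2).
    have s4 : 0 < 4 * sg ^+ 2 by rewrite mulr_gt0 // exprn_gt0.
    have -> : - x ^+ 2 / (sg ^+ 2 *+ 2) = - u - u.
      by rewrite /u; field; rewrite sgn.
    have -> : - x ^+ 2 / (2 * sg ^+ 2 *+ 2) = - u by rewrite /u; field; rewrite sgn.
    have -> : x ^+ 2 = 4 * sg ^+ 2 * u by rewrite /u; field; rewrite sgn.
    rewrite -mulrA ler_wpM2l ?(ltW s4) // expRD mulrA ler_piMl ?expR_ge0 //.
    rewrite expRN ler_pdivrMr ?expR_gt0 // mul1r.
    by apply: le_trans (expR_ge1Dx u); rewrite lerDr.
  have f0 := normal_fun_ge0 0 q x; have p0 := normal_peak_ge0 q; have p0' := normal_peak_ge0 sg.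
  have -> : x ^+ 2 * (normal_peak sg * normal_fun 0 sg x) = normal_peak sg * (x ^+ 2 * normal_fun 0 sg x) by ring.
  apply: (le_trans (ler_wpM2l p0' fn)).
  have -> : 8 * sg ^+ 2 * (normal_peak q * normal_fun 0 q x) = (2 * normal_peak q) * (4 * sg ^+ 2 * normal_fun 0 q x) by ring.
  by apply: ler_wpM2r pk; apply: mulr_ge0 => //; apply: mulr_ge0 => //; exact: sqr_ge0.
- exact: measurable_normal_pdf.
- by move=> x; exact: normal_pdf_ge0.
- by move=> x; exact: sqr_ge0.
Qed.

(** * Second moments of the Brownian increments *)

Section noise.
Context (R : realType) (T : R) (s : R) (c : weak_control R).
Hypothesis sT : 0 <= s <= T.
Hypothesis basis : is_control_basis s T c.
Local Notation mu := (@lebesgue_measure R).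
Let P := wc_P c.
Let s_ge0 : 0 <= s. Proof. by case/andP: sT. Qed.
Let sleT : s <= T. Proof. by case/andP: sT. Qed.

Lemma measurable_increment j t :
  measurable_fun setT (fun w : wc_Om c => increment T s w j t).
Proof.
have [_ bm _ _ _] := basis; have [mW _ _ _ _] := bm j.
apply: measurable_funB; apply: mW; first exact: clip_bounds.
by rewrite lexx.
Qed.

Lemma increment_second_moment j t :
  (\int[P]_(w in setT) (increment T s w j t ^+ 2)%:E <= (8 * T)%:E)%E.
Proof.
have [_ bm _ _ _] := basis; have [_ _ _ law _] := bm j.
have T_ge0 : 0 <= T := le_trans s_ge0 sleT.
have /andP[st tT] := clip_bounds t sleT.
have [ts|sc] := leP (clip s T t) s.
  under eq_integral => w _ do rewrite /increment (le_anti (introT andP (conj ts st))) subrr expr0n.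
  by rewrite integral0 lee_fin mulr_ge0.
pose D (w : wc_Om c) : measurableTypeR R := increment T s w j t.
have mD : measurable_fun setT D by exact: measurable_increment.
pose g (y : measurableTypeR R) : \bar R := ((y : R) ^+ 2)%:E.
have mg : measurable_fun setT g.
  have m2 : measurable_fun setT (fun y : R => (y ^+ 2)%:E).
    by apply/measurable_EFinP; exact: exprn_measurable.
  exact: m2.
have := @ge0_integral_pushforward _ _ _ _ R D mD P setT g measurableT mg.
rewrite preimage_setT => <-; last by move=> y _; rewrite lee_fin sqr_ge0.
rewrite (@eq_measure_integral _ _ _ setT (normal_prob 0 (Num.sqrt (clip s T t - s)))); last first.
  by move=> A mA _; apply: law => //; rewrite lexx.
apply: le_trans (normal_second_moment _) _; first by rewrite sqrtr_gt0 subr_gt0.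
rewrite lee_fin sqr_sqrtr ?subr_ge0 //; apply: ler_wpM2l => //; rewrite lerBlDr.
by rewrite (le_trans tT) // lerDl.
Qed.

Definition noise_sq (n : nat) (w : wc_Om c) (t : R) : R :=
  \sum_(j < n) increment T s w j t ^+ 2.

Lemma noise_sq_ge0 n w t : 0 <= noise_sq n w t.
Proof. by apply: sumr_ge0 => j _; exact: sqr_ge0. Qed.

Lemma noise_second_moment n t : (\int[P]_w (noise_sq n w t)%:E <= (n%:R * (8 * T))%:E)%E.
Proof.
rewrite /noise_sq; under eq_integral do rewrite -sumEFin.
rewrite ge0_integral_sum //.
- apply: (@le_trans _ _ (\sum_(j < n) (8 * T)%:E)%E).
    by apply: lee_sum => j _; exact: increment_second_moment.
  by rewrite sumEFin lee_fin sumr_const card_ord (mulr_natl (8 * T)).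
- move=> j; apply/measurable_EFinP; apply: measurable_funX; exact: measurable_increment.
- by move=> j w _; rewrite lee_fin sqr_ge0.
Qed.

(** [Q] is a measurable version of the noise term in the comparison of costs, with expectation
    bounded independently of the control. Setting the noise to zero on the null set of discontinuous
    paths makes it jointly measurable, as Tonelli's theorem requires. *)
Lemma noise_budget n : exists Q : wc_Om c -> \bar R,
  [/\ measurable_fun setT Q, (forall w, 0 <= Q w)%E,
    (\int[P]_w Q w <= (n%:R * (8 * T) * (1 + T) + 1)%:E)%E &
    {ae P, forall w, continuous_noise T s w /\
      (1%:E + (noise_sq n w T)%:E + \int[mu]_(r in `[s, T]) (noise_sq n w r)%:E = Q w)%E}].
Proof.
have T_ge0 : 0 <= T := le_trans s_ge0 sleT.
have [N [mN PN CN]] : {ae P, forall w, continuous_noise T s w}.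
  exact: ae_W_continuous.
pose X t w := if w \in N then 0 else noise_sq n w t.
have X0 t w : 0 <= X t w by rewrite /X; case: ifP => // _; exact: noise_sq_ge0.
have mX t : measurable_fun setT (X t).
  apply: measurable_fun_ifT; first by apply: (measurable_fun_bool true); rewrite setTI preimage_mem_true.
    exact: measurable_cst.
  apply: measurable_sum => j; apply: measurable_funX; exact: measurable_increment.
have cX w : continuous (X^~ w).
  rewrite /X; case: (boolP (w \in N)) => wN t; first exact: cvg_cst.
  apply: cvg_big => [|j _]; first exact: add_continuous.
  have cw : continuous_noise T s w.
    by apply: contrapT => h; move/negP: wN; apply; rewrite inE; exact: CN.
  by apply: cvgM; exact: continuous_increment.
have mXX := @measurable_caratheodory R _ _ X cX mX.
have XE t : (\int[P]_w (X t w)%:E <= (n%:R * (8 * T))%:E)%E.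
  apply: le_trans (noise_second_moment n t).
  apply: ge0_le_integral => //.
  - by move=> w _; rewrite lee_fin.
  - by apply/measurable_EFinP; exact: mX.
  - apply/measurable_EFinP; apply: measurable_sum => j; apply: measurable_funX; exact: measurable_increment.
  - by move=> w _; rewrite lee_fin /X; case: ifP => // _; exact: noise_sq_ge0.
pose leb : {sigma_finite_measure set (measurableTypeR R) -> \bar R} := @lebesgue_measure R.
pose h (z : wc_Om c * measurableTypeR R) : \bar R := (X z.2 z.1 * \1_(`[s, T]%classic) z.2)%:E.
have h0 z : (0 <= h z)%E by rewrite lee_fin mulr_ge0.
have mh : measurable_fun setT h.
  apply/measurable_EFinP; apply: measurable_funM.
    apply: (@measurableT_comp _ _ _ _ _ _ (fun z : R * wc_Om c => X z.1 z.2) _ (fun z => (z.2, z.1))).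
      exact: mXX.
    by apply: measurable_fun_pair; [exact: measurable_snd|exact: measurable_fst].
  apply: (@measurableT_comp _ _ _ _ _ _ (\1_(`[s, T]%classic) : measurableTypeR R -> R) _ snd).
    by apply: measurable_indic; exact: measurable_itv.
  exact: measurable_snd.
have hI w : (\int[leb]_t h (w, t) = \int[mu]_(t in `[s, T]) (X t w)%:E)%E.
  rewrite [RHS]integral_mkcond; apply: eq_integral => t _.
  by rewrite /h /= patchE indicE; case: ifP => _; rewrite ?mulr1 ?mulr0.
pose Q w := (1%:E + (X T w)%:E + \int[leb]_t h (w, t))%E.
have mI : measurable_fun setT (fun w => \int[leb]_t h (w, t))%E.
  by apply: (@measurable_fun_fubini_tonelli_F _ _ _ _ _ leb h).
have I0 w : (0 <= \int[leb]_t h (w, t))%E by exact: integral_ge0.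
have m1X : measurable_fun setT (fun w => 1%:E + (X T w)%:E)%E.
  by apply: emeasurable_funD; [exact: measurable_cst|apply/measurable_EFinP; exact: mX].
exists Q; split.
- exact: emeasurable_funD.
- by move=> w; apply: adde_ge0; [apply: adde_ge0; rewrite lee_fin|exact: I0].
- rewrite /Q ge0_integralD //; last by move=> w _; rewrite adde_ge0 // lee_fin.
  rewrite ge0_integralD //; [|by move=> w _; rewrite lee_fin|by apply/measurable_EFinP; exact: mX].
  have -> : (\int[P]_(w in setT) 1 = 1)%E by rewrite integral_cst // mul1e; exact: probability_setT.
  rewrite (@fubini_tonelli _ _ _ _ R P leb h mh h0).
  apply: (@le_trans _ _ (1 + (n%:R * (8 * T))%:E + (n%:R * (8 * T) * T)%:E)%E); last first.
    by rewrite -!EFinD lee_fin; lra.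
  apply: leeD; first by rewrite leeD2l.
  apply: (@le_trans _ _ (\int[leb]_(t in `[s, T]) (n%:R * (8 * T))%:E)%E).
    rewrite [leRHS]integral_mkcond; apply: ge0_le_integral => //.
    + by move=> t _; exact: integral_ge0.
    + by apply: (@measurable_fun_fubini_tonelli_G _ _ _ _ _ P h).
    + apply/(@measurable_restrictT _ _ (measurableTypeR R) _ `[s, T]%classic) => //.
    + move=> t _; rewrite /h /= patchE indicE; case: ifP => _.
        by under eq_integral do rewrite mulr1; exact: XE.
      by under eq_integral do rewrite mulr0; rewrite integral0.
  rewrite integral_cst //.
  have := @lebesgue_measure_itv R `[s, T]%R; rewrite /= /leb => ->.
  rewrite lte_fin; case: ltP => _; last by rewrite mule0 lee_fin !mulr_ge0.
  rewrite -EFinD -EFinM lee_fin; apply: ler_wpM2l; first by rewrite !mulr_ge0.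
  by rewrite lerBlDr lerDl.
- exists N; split => // w /= nw; apply: contrapT => wN; apply: nw; split.
    by apply: contrapT => h1; apply: wN; exact: CN.
  rewrite /Q hI /X memNset //.
Qed.

End noise.

(** * Comparison of the costs along one path *)

Section cost.
Context (R : realType) (phi : R -> R) (C11 C10 C20 : R).
Hypothesis cphi : cost_assumption phi C11 C10 C20.

Lemma cost_coef_ge0 : 0 <= C11 /\ 0 <= C10.
Proof.
split; last first.
  have [_ _ _ H _] := cphi 0.
  by move: H; rewrite normr0 mulr0 add0r; apply: le_trans.
rewrite leNgt; apply/negP => C0.
(* If [C11 < 0], the bound on the derivative at this point equals [C10 - |C10| - 1 < 0], which is
   absurd. *)
have [_ _ _ H _] := cphi ((`|C10| + 1) / - C11).
have := le_trans (normr_ge0 _) H.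
have y0 : 0 <= (`|C10| + 1) / - C11.
  by apply: divr_ge0; [rewrite addr_ge0|rewrite oppr_ge0 ltW].
rewrite (ger0_norm y0) invrN mulrN mulrN mulrCA divff ?lt_eqF // mulr1 => h.
by have := ler_norm C10; lra.
Qed.

Lemma cost_continuous : continuous phi.
Proof.
by move=> y; have [_ d _ _ _] := cphi y; apply: differentiable_continuous; apply/derivable1_diffP.
Qed.

Lemma cost_growth a b :
  `|phi a - phi b| <= (C11 * (`|a| + `|b|) + C10) * `|a - b|.
Proof.
have [C11_ge0 C10_ge0] := cost_coef_ge0.
wlog ba : a b / b <= a.
  by case/orP: (le_total a b) => h H; [rewrite distrC (distrC a) (addrC `|a|)|]; exact: H.
rewrite (ger0_norm (_ : 0 <= a - b)) ?subr_ge0 //; apply: derivable_lipschitz => // y.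
rewrite in_itv /= => /andP[b_y ya]; have [_ d _ H _] := cphi y; split => //.
apply: (le_trans H); rewrite lerD2r; apply: ler_wpM2l => //.
have := normr_ge0 a; have := normr_ge0 b.
by rewrite ler_norml; move: (ler_norm a) (lerNnormlW (lexx `|b|)); lra.
Qed.

End cost.

(** The Cauchy-Schwarz inequality, obtained by expanding the nonnegative integral of [(h - I / T)^2]
    over an interval of length [T - s <= T]. *)
Lemma sqr_Rintegral_le (R : realType) (s T : R) (h : R -> R) : 0 <= s <= T -> 0 < T ->
  lebesgue_measure.-integrable `[s, T] (EFin \o h) ->
  lebesgue_measure.-integrable `[s, T] (EFin \o (fun r => h r ^+ 2)) ->
  (\int[lebesgue_measure]_(r in `[s, T]) h r) ^+ 2 <=
    T * \int[lebesgue_measure]_(r in `[s, T]) (h r ^+ 2).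
Proof.
move=> /andP[s0 sT] T0 ih ih2.
pose I := \int[lebesgue_measure]_(r in `[s, T]) h r.
pose I2 := \int[lebesgue_measure]_(r in `[s, T]) (h r ^+ 2).
rewrite -/I -/I2.
have mD : @measurable _ (measurableTypeR R) `[s, T] by exact: measurable_itv.
have ic k : lebesgue_measure.-integrable `[s, T] (EFin \o (fun _ : R => k)).
  by apply: continuous_integrable => ?; exact: cvg_cst.
have ih1 := real_integrableZ mD (- (2 * (I / T))) ih.
have ih12 := real_integrableD mD ih2 ih1.
have : 0 <= \int[lebesgue_measure]_(r in `[s, T]) (h r ^+ 2 + - (2 * (I / T)) * h r + (I / T) ^+ 2).
  apply: Rintegral_ge0 => r _.
  have -> : h r ^+ 2 + - (2 * (I / T)) * h r + (I / T) ^+ 2 = (h r - I / T) ^+ 2 by ring.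
  exact: sqr_ge0.
rewrite RintegralD // RintegralD // RintegralZl // -/I -/I2.
rewrite Rintegral_cst_itv //.
have q0 : 0 <= (I / T) ^+ 2 by exact: sqr_ge0.
have e : I = I / T * T by rewrite mulfVK // gt_eqF.
move: q0; set u := I / T in e *; rewrite {2}e => q0 H.
have -> : (u * T) ^+ 2 = T * (u ^+ 2 * T) by ring.
apply: ler_wpM2l; first exact: ltW.
have := mulr_ge0 q0 s0; rewrite e in H; move: H; rewrite expr2; lra.
Qed.

Lemma sqr_sum_le (R : realType) n (a : 'I_n -> R) :
  (\sum_i a i) ^+ 2 <= n%:R * \sum_i a i ^+ 2.
Proof.
elim: n a => [|n IH] a; first by rewrite !big_ord0 expr0n mul0r.
rewrite !big_ord_recr /=; have := IH (fun i => a (widen_ord (leqnSn n) i)).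
set S := \sum_i _; set Q := \sum_i _ ^+ 2; set b := a _ => H.
have Q0 : 0 <= Q by apply: sumr_ge0 => i _; exact: sqr_ge0.
rewrite -natr1; have [n0|] := posnP n.
  have -> : S = 0.
    by apply/eqP; rewrite -sqrf_eq0 eq_le sqr_ge0 andbT; move: H; rewrite n0 mul0r.
  by rewrite n0 !add0r mul1r lerDr.
rewrite -(ltr0n R); move: (n%:R : R) H => N H N0.
have h : 2 * S * b <= N * b ^+ 2 + Q.
  rewrite -(ler_pM2l N0); have := sqr_ge0 (N * b - S); move: H; rewrite !expr2; lra.
by move: H h; rewrite !expr2; lra.
Qed.

Section path_cost.
Context (R : realType) (T lambda sigma K : R) (f : R -> R -> R -> P2 R -> R)
  (L U : R -> R) (CL11 CL10 CL20 CU11 CU10 CU20 : R).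
Hypothesis T0 : 0 < T.
Hypothesis lambda0 : 0 < lambda.
Hypothesis K0 : 0 <= K.
Hypothesis fK : drift_lipschitz T K f.
Hypothesis costL : cost_assumption L CL11 CL10 CL20.
Hypothesis costU : cost_assumption U CU11 CU10 CU20.
Local Notation mu := (@lebesgue_measure R).
Variable s : R.
Hypothesis sT : 0 <= s <= T.
Let s_ge0 : 0 <= s. Proof. by case/andP: sT. Qed.
Let sleT : s <= T. Proof. by case/andP: sT. Qed.
Let T_ge0 : 0 <= T := ltW T0.
Let m_sT : @measurable _ (measurableTypeR R) `[s, T]. Proof. exact: measurable_itv. Qed.

(** Chosen large enough to serve both the growth bound and the difference bound; it depends on the
    number of particles and on [x], but not on the control. *)
Definition state_cst n (x : 'rV[R]_n.+1) : R :=
  (1 + gronwall_cst T K s n * T) *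
    (norm1 x + n.+1%:R * ((`|f 0 0 0 (emp (0 : 'rV[R]_n.+1))| + K * T) * T) + n.+1%:R * K)
  + n.+1%:R * (`|sigma| + 1) * (1 + gronwall_cst T K s n).

Lemma state_cst_ge0 n (x : 'rV[R]_n.+1) : 0 <= state_cst x.
Proof.
have g0 := gronwall_cst_ge0 T K0 s n.
by rewrite /state_cst !(addr_ge0, mulr_ge0, norm1_ge0).
Qed.

(** The 4 comes from squaring the four terms of [path_scale], the two products from the growth of
    [L] and [U] at states of size [state_cst], and [(1 + T)^2] from time integration. The factor
    [n.+2] counts the noises: the common one and [n + 1] idiosyncratic ones. *)
Definition cost_cst n (x : 'rV[R]_n.+1) : R :=
  4 * ((2 * (CL11 * state_cst x) + CL10) * state_cst x + (2 * (CU11 * state_cst x) + CU10) * state_cst x)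
   * (1 + T) ^+ 2 * n.+2%:R.

Lemma cost_cst_ge0 n (x : 'rV[R]_n.+1) : 0 <= cost_cst x.
Proof.
have [L1 L0] := cost_coef_ge0 costL; have [U1 U0] := cost_coef_ge0 costU.
have c0 := state_cst_ge0 x.
rewrite /cost_cst; apply: mulr_ge0 => //; apply: mulr_ge0; last exact: sqr_ge0.
apply: mulr_ge0 => //; rewrite -mulrDl; apply: mulr_ge0 => //.
by rewrite addr_ge0 // addr_ge0 // mulr_ge0 // mulr_ge0.
Qed.

Section control.
Variable c : weak_control R.

Definition noise_sum n (w : wc_Om c) (t : R) : R := \sum_(j < n) `|increment T s w j t|.

Lemma noise_sum_sq n w t : noise_sum n w t ^+ 2 <= n%:R * noise_sq T s n w t.
Proof.
have := sqr_sum_le (fun j : 'I_n => `|increment T s w j t|).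
by under [X in _ <= _ * X -> _]eq_bigr do rewrite real_normK ?num_real //.
Qed.

Lemma noise_sum_ge0 n w t : 0 <= noise_sum n w t.
Proof. exact: sumr_ge0. Qed.

Lemma continuous_noise_sum n w : continuous_noise T s w -> continuous (noise_sum n w).
Proof.
move=> cw t; apply: cvg_big => [|i _]; first exact: add_continuous.
by apply: cvg_norm; exact: continuous_increment.
Qed.

Lemma continuous_noise_sq n w : continuous_noise T s w -> continuous (@noise_sq R T s c n w).
Proof.
move=> cw t; apply: cvg_big => [|j _]; first exact: add_continuous.
by apply: cvgM; exact: continuous_increment.
Qed.

Lemma idio_noise_le n w t : idio_noise T s n w t <= noise_sum n.+2 w t.
Proof. by rewrite /noise_sum big_ord_recl lerDr. Qed.

Lemma increment0_le n (w : wc_Om c) t : `|increment T s w 0 t| <= noise_sum n.+1 w t.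
Proof. by rewrite /noise_sum big_ord_recl lerDl sumr_ge0. Qed.

(* Up to a constant, this bounds both the states of the particle systems with noise levels e1, e2 and their difference divided by |e1 - e2|. *)
Definition path_scale n (w : wc_Om c) (t : R) : R :=
  1 + \int[mu]_(r in `[s, T]) `|wc_theta c r w| + noise_sum n.+2 w t
    + \int[mu]_(r in `[s, T]) noise_sum n.+2 w r.

Lemma state_bound n (x : 'rV[R]_n.+1) e w X t :
  continuous_noise T s w -> path_solution T sigma f s x e w X ->
  mu.-integrable `[s, T] (EFin \o (fun r => wc_theta c r w)) -> `|e| <= 1 ->
  s <= t <= T -> norm1 (X t) <= state_cst x * path_scale n w t.
Proof.
move=> cw pX ith e1 st; have [sle tT] := andP st.
apply: (le_trans (path_growth T0 K0 fK sT cw pX ith st)).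
set g := gronwall_cst T K s n; have g0 : 0 <= g := gronwall_cst_ge0 T K0 s n.
rewrite /state_cst -/g /path_scale.
set A := \int[mu]_(r in `[s, T]) `|wc_theta c r w|.
set m := \int[mu]_(r in `[s, T]) noise_sum n.+2 w r.
set F0 := `|f 0 0 0 _| + K * T.
have A0 : 0 <= A by apply: Rintegral_ge0.
have m0 : 0 <= m by apply: Rintegral_ge0 => r _; exact: noise_sum_ge0.
pose G1 := norm1 x + n.+1%:R * (F0 * T) + n.+1%:R * K * A.
pose c1 := n.+1%:R * (`|sigma| + 1).
have N1 : (1 : R) <= n.+1%:R by rewrite ler1n.
have c10 : 0 <= c1 by rewrite mulr_ge0 ?addr_ge0.
have growth r : growth_noise T sigma K f s w x e r <= G1 + c1 * noise_sum n.+2 w r.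
  rewrite /growth_noise -/F0 -/A /G1 /c1.
  have h1 := idio_noise_le n w r; have h2 := @increment0_le n.+1 w r.
  have h3 : `|e| * idio_noise T s n w r <= n.+1%:R * noise_sum n.+2 w r.
    apply: (@le_trans _ _ (1 * noise_sum n.+2 w r)).
      by apply: ler_pM => //; exact: idio_noise_ge0.
    by apply: ler_wpM2r => //; exact: noise_sum_ge0.
  have h4 : n.+1%:R * (`|sigma| * `|increment T s w 0 r|) <= n.+1%:R * (`|sigma| * noise_sum n.+2 w r).
    by rewrite !ler_wpM2l.
  by move: h3 h4; lra.
have cN := @continuous_noise_sum n.+2 w cw.
have G10 : 0 <= G1.
  by rewrite /G1 !(addr_ge0, mulr_ge0, norm1_ge0) // ltW.
have int_le : \int[mu]_(r in `[s, t]) growth_noise T sigma K f s w x e r <= G1 * T + c1 * m.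
  have m_st : @measurable _ (measurableTypeR R) `[s, t] by exact: measurable_itv.
  have ic : mu.-integrable `[s, t] (EFin \o (fun _ : R => G1)).
    by apply: continuous_integrable => ?; exact: cvg_cst.
  have iN : mu.-integrable `[s, t] (EFin \o (noise_sum n.+2 w)) by exact: continuous_integrable.
  have iN1 := real_integrableZ m_st c1 iN.
  apply: (@le_trans _ _ (\int[mu]_(r in `[s, t]) (G1 + c1 * noise_sum n.+2 w r))).
    apply: le_Rintegral => //; last exact: real_integrableD.
    by apply: continuous_integrable; exact: continuous_growth_noise.
  rewrite RintegralD // RintegralZl //; apply: lerD.
    rewrite Rintegral_cst_itv //.
    by rewrite ler_wpM2l // lerBlDr; move: tT s_ge0; lra.
  apply: ler_wpM2l => //; apply: le_subset_Rintegral => //.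
  - by apply: subset_itvl; rewrite bnd_simp.
  - exact: continuous_integrable.
  - by move=> r; exact: noise_sum_ge0.
apply: (le_trans (lerD (growth t) (ler_wpM2l g0 int_le))).
have nu0 := noise_sum_ge0 n.+2 w t; move: (noise_sum n.+2 w t) nu0 => nu nu0.
pose B := norm1 x + n.+1%:R * (F0 * T) + n.+1%:R * K.
have b1 : 0 <= norm1 x := norm1_ge0 x.
have b2 : 0 <= n.+1%:R * (F0 * T) by rewrite !mulr_ge0 ?addr_ge0 ?mulr_ge0 // ltW.
have b3 : 0 <= n.+1%:R * K by rewrite mulr_ge0.
have GB : G1 <= B * (1 + A).
  rewrite /G1 /B; have := mulr_ge0 b1 A0; have := mulr_ge0 b2 A0; move: b1 b2 b3; lra.
have gT : 0 <= g * T by rewrite mulr_ge0 // ltW.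
have B0 : 0 <= B by rewrite !addr_ge0.
have p1 : (1 + g * T) * G1 <= (1 + g * T) * (B * (1 + A + nu + m)).
  apply: ler_wpM2l; first by rewrite addr_ge0.
  by apply: (le_trans GB); rewrite ler_wpM2l // -addrA lerDl addr_ge0.
have p2 : c1 * (nu + g * m) <= c1 * ((1 + g) * (1 + A + nu + m)).
  apply: ler_wpM2l => //; have := mulr_ge0 g0 A0; have := mulr_ge0 g0 nu0.
  by move: g0 A0 nu0 m0; lra.
by move: p1 p2; rewrite -/B -/c1; lra.
Qed.

Lemma difference_bound n (x : 'rV[R]_n.+1) e1 e2 w X Y t :
  continuous_noise T s w -> path_solution T sigma f s x e1 w X ->
  path_solution T sigma f s x e2 w Y -> s <= t <= T ->
  norm1 (X t - Y t) <= `|e1 - e2| * (state_cst x * path_scale n w t).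
Proof.
move=> cw pX pY st; have [sle tT] := andP st.
apply: (le_trans (path_difference K0 fK sT cw pX pY st)).
apply: ler_wpM2l => //.
rewrite /state_cst; set g := gronwall_cst T K s n; have g0 : 0 <= g := gronwall_cst_ge0 T K0 s n.
rewrite /path_scale.
set A := \int[mu]_(r in `[s, T]) `|wc_theta c r w|.
set m := \int[mu]_(r in `[s, T]) noise_sum n.+2 w r.
set F0 := `|f 0 0 0 _| + K * T.
have A0 : 0 <= A by apply: Rintegral_ge0.
have m0 : 0 <= m by apply: Rintegral_ge0 => r _; exact: noise_sum_ge0.
have cN := @continuous_noise_sum n.+2 w cw.
have cI := @continuous_idio_noise R T s c sT n w cw.
have Im : \int[mu]_(r in `[s, t]) idio_noise T s n w r <= m.
  have m_st : @measurable _ (measurableTypeR R) `[s, t] by exact: measurable_itv.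
  apply: (@le_trans _ _ (\int[mu]_(r in `[s, t]) noise_sum n.+2 w r)).
    apply: le_Rintegral => //; [exact: continuous_integrable|exact: continuous_integrable|].
    by move=> r _; exact: idio_noise_le.
  apply: le_subset_Rintegral => //.
  - by apply: subset_itvl; rewrite bnd_simp.
  - exact: continuous_integrable.
  - by move=> r; exact: noise_sum_ge0.
apply: (le_trans (lerD (idio_noise_le n w t) (ler_wpM2l g0 Im))).
have nu0 := noise_sum_ge0 n.+2 w t; move: (noise_sum n.+2 w t) nu0 => nu nu0.
pose B := norm1 x + n.+1%:R * (F0 * T) + n.+1%:R * K.
have B0 : 0 <= B.
  by rewrite /B !(addr_ge0, mulr_ge0, norm1_ge0) // ltW.
have gT : 0 <= g * T by rewrite mulr_ge0 // ltW.
have M0 : 0 <= 1 + A + nu + m by rewrite !addr_ge0.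
have N1 : (1 : R) <= n.+1%:R by rewrite ler1n.
have c1 : 1 <= n.+1%:R * (`|sigma| + 1).
  by rewrite -[leLHS]mulr1; apply: ler_pM => //; rewrite lerDr.
have p1 : 0 <= (1 + g * T) * B * (1 + A + nu + m) by rewrite !mulr_ge0 // addr_ge0.
have p2 : (1 + g) * (1 + A + nu + m) <= n.+1%:R * (`|sigma| + 1) * ((1 + g) * (1 + A + nu + m)).
  by rewrite ler_peMl // mulr_ge0 // addr_ge0.
have p3 : nu + g * m <= (1 + g) * (1 + A + nu + m).
  by have := mulr_ge0 g0 A0; have := mulr_ge0 g0 nu0; move: g0 A0 nu0 m0; lra.
by move: p1 p2 p3; rewrite -/B; lra.
Qed.

Definition run_cost n (w : wc_Om c) (X : R -> 'rV[R]_n.+1) : \bar R :=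
  ((n.+1%:R^-1)%:E * (\sum_(i < n.+1) \int[mu]_(t in `[s, T]) (L (X t 0 i))%:E)
   + (n.+1%:R^-1)%:E * (\sum_(i < n.+1) (U (X T 0 i))%:E)
   + (lambda / 2)%:E * \int[mu]_(t in `[s, T]) (`|wc_theta c t w| ^+ 2)%:E)%E.

(** The part of the cost that is always finite; the energy of the control, possibly infinite, is
    kept apart from it. *)
Definition particle_cost n (X : R -> 'rV[R]_n.+1) : R :=
  mean (fun i => \int[mu]_(t in `[s, T]) L (X (clip s T t) 0 i)) + mean (fun i => U (X T 0 i)).

Lemma particle_cost_ge0 n (X : R -> 'rV[R]_n.+1) : 0 <= particle_cost X.
Proof.
apply: addr_ge0; apply: mean_ge0 => i; last by have [] := costU (X T 0 i).
by apply: Rintegral_ge0 => t _; have [] := costL (X (clip s T t) 0 i).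
Qed.

Lemma continuous_running_cost n (X : R -> 'rV[R]_n.+1) i :
  (forall i, {within `[s, T], continuous (fun t => X t 0 i)}) ->
  continuous (fun t => L (X (clip s T t) 0 i)).
Proof.
move=> cX t; apply: (@continuous_comp _ _ _ (fun t => X (clip s T t) 0 i) L).
  exact: continuous_clip_path.
exact: cost_continuous.
Qed.

Lemma run_costE n w (X : R -> 'rV[R]_n.+1) :
  (forall i, {within `[s, T], continuous (fun t => X t 0 i)}) ->
  (run_cost w X = (particle_cost X)%:E
    + (lambda / 2)%:E * \int[mu]_(t in `[s, T]) (`|wc_theta c t w| ^+ 2)%:E)%E.
Proof.
move=> cX; rewrite /run_cost /particle_cost /mean sumEFin -EFinM EFinD; congr (_ + _ + _)%E.
rewrite EFinM -sumEFin; congr (_ * _)%E; apply: eq_bigr => i _.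
rewrite /Rintegral fineK; last first.
  apply: integrable_fin_num => //; apply: continuous_integrable; exact: continuous_running_cost.
apply: eq_integral => t; rewrite inE /= in_itv /= => tT.
by rewrite clip_id.
Qed.

Lemma path_scale_ge1 n (w : wc_Om c) t : 1 <= path_scale n w t.
Proof.
rewrite /path_scale -!addrA lerDl !addr_ge0 ?noise_sum_ge0 //; apply: Rintegral_ge0 => // r _.
exact: noise_sum_ge0.
Qed.

(** Both states have size at most [S M] and differ by at most [|e1 - e2| S M], where [S] is
    [state_cst x] and [M] the path scale. As [phi] has at most quadratic growth, its difference is
    of order [|e1 - e2| M^2], using [M >= 1] to absorb [C10]. *)
Lemma cost_difference n (x : 'rV[R]_n.+1) phi C11 C10 C20 e1 e2 w X Y t i :
  cost_assumption phi C11 C10 C20 ->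
  continuous_noise T s w -> path_solution T sigma f s x e1 w X ->
  path_solution T sigma f s x e2 w Y ->
  mu.-integrable `[s, T] (EFin \o (fun r => wc_theta c r w)) ->
  `|e1| <= 1 -> `|e2| <= 1 -> s <= t <= T ->
  phi (X t 0 i) <= phi (Y t 0 i) + `|e1 - e2| *
    ((2 * (C11 * state_cst x) + C10) * state_cst x * path_scale n w t ^+ 2).
Proof.
move=> cphi cw pX pY ith h1 h2 st.
have [C11_ge0 C10_ge0] := cost_coef_ge0 cphi.
have M1 := path_scale_ge1 n w t.
have bX := le_trans (ler_norm1 (X t) i) (state_bound cw pX ith h1 st).
have bY := le_trans (ler_norm1 (Y t) i) (state_bound cw pY ith h2 st).
have := le_trans (ler_norm1 (X t - Y t) i) (difference_bound cw pX pY st).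
rewrite rV_subE; move: (path_scale n w t) M1 bX bY (state_cst_ge0 x) => M M1 bX bY S0 bD.
move: (state_cst x) S0 bX bY bD => S S0 bX bY bD.
rewrite -lerBlDl; apply: le_trans (ler_norm _) _.
apply: (le_trans (cost_growth cphi _ _)).
have M0 : 0 <= M := le_trans ler01 M1.
have C2 : 0 <= 2 * (C11 * S) + C10 by rewrite addr_ge0 // mulr_ge0 // mulr_ge0.
apply: (@le_trans _ _ ((2 * (C11 * S) + C10) * M * (`|e1 - e2| * (S * M)))); last first.
  rewrite le_eqVlt; apply/orP; left; apply/eqP; ring.
apply: ler_pM => //.
  by rewrite addr_ge0 // mulr_ge0 // addr_ge0.
have h := ler_wpM2l C11_ge0 (lerD bX bY).
have h' := ler_peMr C10_ge0 M1.
by move: h h'; lra.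
Qed.

Lemma path_scale_sq n w t :
  continuous_noise T s w ->
  mu.-integrable `[s, T] (EFin \o (fun r => wc_theta c r w)) ->
  mu.-integrable `[s, T] (EFin \o (fun r => wc_theta c r w ^+ 2)) ->
  path_scale n w t ^+ 2 <= 4 * (1 + T * \int[mu]_(r in `[s, T]) (wc_theta c r w ^+ 2)
    + n.+2%:R * noise_sq T s n.+2 w t + T * (n.+2%:R * \int[mu]_(r in `[s, T]) noise_sq T s n.+2 w r)).
Proof.
move=> cw ith ith2; rewrite /path_scale.
have hn := noise_sum_sq n.+2 w t.
have iN : mu.-integrable `[s, T] (EFin \o (noise_sum n.+2 w)).
  by apply: continuous_integrable; exact: continuous_noise_sum.
have cN2 : continuous (fun r => noise_sum n.+2 w r ^+ 2).
  by move=> r; apply: cvgM; exact: continuous_noise_sum.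
have iN2 : mu.-integrable `[s, T] (EFin \o (fun r => noise_sum n.+2 w r ^+ 2)).
  exact: continuous_integrable.
have iq : mu.-integrable `[s, T] (EFin \o (noise_sq T s n.+2 w)).
  by apply: continuous_integrable; exact: continuous_noise_sq.
have hm := sqr_Rintegral_le sT T0 iN iN2.
have hm' : \int[mu]_(r in `[s, T]) (noise_sum n.+2 w r ^+ 2) <=
    n.+2%:R * \int[mu]_(r in `[s, T]) noise_sq T s n.+2 w r.
  rewrite -RintegralZl //; apply: le_Rintegral => //.
    exact: real_integrableZ.
  by move=> r _; exact: noise_sum_sq.
have iA := real_integrable_norm ith.
have ith2' : mu.-integrable `[s, T] (EFin \o (fun r => `|wc_theta c r w| ^+ 2)).
  by under [X in EFin \o X]eq_fun do rewrite real_normK ?num_real //.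
have hA := sqr_Rintegral_le sT T0 iA ith2'.
have eA : \int[mu]_(r in `[s, T]) (`|wc_theta c r w| ^+ 2) = \int[mu]_(r in `[s, T]) (wc_theta c r w ^+ 2).
  by apply: eq_Rintegral => r _; rewrite real_normK ?num_real.
rewrite eA in hA.
have := le_trans hm (ler_wpM2l T_ge0 hm').
move: hA hn; set A := \int[mu]_(r in _) `|_|; set m := \int[mu]_(r in _) noise_sum _ _ _.
move: (noise_sum n.+2 w t) => nu.
move: (n.+2%:R * _) (T * _) (T * _) A m => q1 q2 q3 A m hA hn hm2.
have := sqr_ge0 (1 - A); have := sqr_ge0 (1 - nu); have := sqr_ge0 (1 - m).
have := sqr_ge0 (A - nu); have := sqr_ge0 (A - m); have := sqr_ge0 (nu - m).
by move: hA hn hm2; rewrite !expr2; lra.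
Qed.

Lemma Rintegral_affine_le (k0 k1 : R) (q : R -> R) : 0 <= k0 -> continuous q ->
  \int[mu]_(t in `[s, T]) (k0 + k1 * q t) <= k0 * T + k1 * \int[mu]_(t in `[s, T]) q t.
Proof.
move=> k00 cq.
have ic : mu.-integrable `[s, T] (EFin \o (fun _ : R => k0)).
  by apply: continuous_integrable => ?; exact: cvg_cst.
have iq : mu.-integrable `[s, T] (EFin \o q) by exact: continuous_integrable.
have iq1 := real_integrableZ m_sT k1 iq.
rewrite RintegralD // RintegralZl // lerD2r Rintegral_cst_itv //.
by rewrite ler_wpM2l // lerBlDr lerDl.
Qed.

Lemma particle_cost_difference n (x : 'rV[R]_n.+1) e1 e2 w X Y :
  continuous_noise T s w -> path_solution T sigma f s x e1 w X ->
  path_solution T sigma f s x e2 w Y ->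
  mu.-integrable `[s, T] (EFin \o (fun r => wc_theta c r w)) ->
  mu.-integrable `[s, T] (EFin \o (fun r => wc_theta c r w ^+ 2)) ->
  `|e1| <= 1 -> `|e2| <= 1 ->
  particle_cost X <= particle_cost Y + `|e1 - e2| * (cost_cst x *
    (1 + \int[mu]_(r in `[s, T]) (wc_theta c r w ^+ 2) + noise_sq T s n.+2 w T
     + \int[mu]_(r in `[s, T]) noise_sq T s n.+2 w r)).
Proof.
move=> cw pX pY ith ith2 h1 h2.
have [L1 L0] := cost_coef_ge0 costL; have [U1 U0] := cost_coef_ge0 costU.
have S0 := state_cst_ge0 x.
set Th := \int[mu]_(r in _) (_ ^+ 2); set I := \int[mu]_(r in _) noise_sq _ _ _ _ _.
have Th0 : 0 <= Th by apply: Rintegral_ge0 => r _; exact: sqr_ge0.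
have I0 : 0 <= I by apply: Rintegral_ge0 => r _; exact: noise_sq_ge0.
pose N : R := n.+2%:R.
have N1 : 1 <= N by rewrite ler1n.
have N0 : 0 <= N by exact: le_trans N1.
pose k0 := 4 * (1 + T * Th + T * (N * I)).
have TTh0 : 0 <= T * Th by rewrite mulr_ge0.
have TNI0 : 0 <= T * (N * I) by rewrite mulr_ge0 // mulr_ge0.
have k00 : 0 <= k0 by rewrite mulr_ge0 // !addr_ge0.
have hM t : path_scale n w t ^+ 2 <= k0 + 4 * N * noise_sq T s n.+2 w t.
  by have := path_scale_sq n t cw ith ith2; rewrite -/Th -/I -/N /k0; lra.
have cq := @continuous_noise_sq n.+2 w cw.
set S := state_cst x in S0.
pose CL := (2 * (CL11 * S) + CL10) * S; pose CU := (2 * (CU11 * S) + CU10) * S.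
have CL_ge0 : 0 <= CL by apply: mulr_ge0 => //; rewrite addr_ge0 // mulr_ge0 // mulr_ge0.
have CU_ge0 : 0 <= CU by apply: mulr_ge0 => //; rewrite addr_ge0 // mulr_ge0 // mulr_ge0.
set del := `|e1 - e2|; have del0 : 0 <= del by exact: normr_ge0.
pose Z := (1 + T) ^+ 2 * N * (1 + Th + noise_sq T s n.+2 w T + I).
have q0 := noise_sq_ge0 T s n.+2 w T.
have TI : 0 <= T * I by rewrite mulr_ge0.
have NI : 0 <= N * I by rewrite mulr_ge0.
(* This single factor dominates all coefficients that occur below: 1, [T], [T^2], [N], [T N] and
   [(T^2 + 1) N]. *)
pose P := (1 + T) ^+ 2 * N.
have TN : T <= T * N by rewrite ler_peMr.
have TTN : 0 <= T * T * N by rewrite !mulr_ge0.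
have TTN' : T * T <= T * T * N by rewrite ler_peMr // mulr_ge0.
have TN0 : 0 <= T * N by rewrite mulr_ge0.
have PE : P = N + 2 * (T * N) + T * T * N by rewrite /P; ring.
have P1 : 1 <= P by rewrite PE; lra.
have PT : T <= P by rewrite PE; lra.
have PTT : T * T <= P by rewrite PE; lra.
have PN : N <= P by rewrite PE; lra.
have PTN : T * N <= P by rewrite PE; lra.
have PTTN : (T * T + 1) * N <= P by rewrite PE; lra.
have Zq : k0 + 4 * N * noise_sq T s n.+2 w T <= 4 * Z.
  have a1 := ler_wpM2r Th0 PT; have a2 := ler_wpM2r q0 PN; have a3 := ler_wpM2r I0 PTN.
  by rewrite /k0 /Z -/P; move: a1 a2 a3; lra.
have ZI : k0 * T + 4 * N * I <= 4 * Z.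
  have a1 := ler_wpM2r Th0 PTT; have a3 := ler_wpM2r I0 PTTN.
  have a2 := mulr_ge0 (le_trans ler01 P1) q0.
  by rewrite /k0 /Z -/P; move: a1 a2 a3; lra.
have cX := proj1 pX; have cY := proj1 pY.
have HL i : \int[mu]_(t in `[s, T]) L (X (clip s T t) 0 i) <=
    \int[mu]_(t in `[s, T]) L (Y (clip s T t) 0 i) + del * (CL * (4 * Z)).
  have iX : mu.-integrable `[s, T] (EFin \o (fun t => L (X (clip s T t) 0 i))).
    by apply: continuous_integrable; exact: continuous_running_cost.
  have iY : mu.-integrable `[s, T] (EFin \o (fun t => L (Y (clip s T t) 0 i))).
    by apply: continuous_integrable; exact: continuous_running_cost.
  have cB : continuous (fun t => k0 + 4 * N * noise_sq T s n.+2 w t).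
    by move=> t; apply: cvgD; [exact: cvg_cst|apply: cvgM; [exact: cvg_cst|exact: cq]].
  have iB : mu.-integrable `[s, T] (EFin \o (fun t => k0 + 4 * N * noise_sq T s n.+2 w t)).
    exact: continuous_integrable.
  have iB1 := real_integrableZ m_sT (del * CL) iB.
  apply: (@le_trans _ _ (\int[mu]_(t in `[s, T]) (L (Y (clip s T t) 0 i) +
      del * CL * (k0 + 4 * N * noise_sq T s n.+2 w t)))).
    apply: le_Rintegral => //; first exact: real_integrableD.
    move=> t; rewrite /= in_itv /= => st; rewrite clip_id //.
    apply: (le_trans (cost_difference i costL cw pX pY ith h1 h2 st)).
    rewrite -/S -/CL -/del lerD2l -[_ * CL * _]mulrA; apply: ler_wpM2l => //.
    exact: ler_wpM2l.
  rewrite RintegralD // RintegralZl // lerD2l [del * (CL * _)]mulrA.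
  apply: ler_wpM2l; first by rewrite mulr_ge0.
  by apply: le_trans ZI; exact: Rintegral_affine_le.
have HU i : U (X T 0 i) <= U (Y T 0 i) + del * (CU * (4 * Z)).
  have st : s <= T <= T by rewrite lexx sleT.
  apply: (le_trans (cost_difference i costU cw pX pY ith h1 h2 st)).
  rewrite lerD2l; apply: ler_wpM2l => //; apply: ler_wpM2l => //; exact: le_trans (hM T) Zq.
have := lerD (ler_mean HL) (ler_mean HU); rewrite !meanD !mean_cst => H.
apply: (le_trans H); rewrite /particle_cost /cost_cst -/S -/CL -/CU.
rewrite le_eqVlt; apply/orP; left; apply/eqP; rewrite /Z /N; ring.
Qed.

(** The energy in the error is at most [2 / lambda] times the cost of [Y] and goes into the
    multiplicative factor; only the noise remains as an additive term. If the energy is infinite,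
    both costs are; otherwise the control is square integrable, hence integrable, on [[s, T]], and
    the real estimate applies. *)
Lemma run_cost_difference n (x : 'rV[R]_n.+1) e1 e2 w X Y :
  is_control_basis s T c ->
  continuous_noise T s w -> path_solution T sigma f s x e1 w X ->
  path_solution T sigma f s x e2 w Y -> `|e1| <= 1 -> `|e2| <= 1 ->
  (run_cost w X <= (1 + `|e1 - e2| * (cost_cst x * (2 / lambda)))%:E * run_cost w Y
    + (`|e1 - e2| * cost_cst x)%:E * (1%:E + (noise_sq T s n.+2 w T)%:E
     + \int[mu]_(r in `[s, T]) (noise_sq T s n.+2 w r)%:E))%E.
Proof.
move=> basis cw pX pY h1 h2; rewrite (run_costE w (proj1 pX)) (run_costE w (proj1 pY)).
set del := `|e1 - e2|; have del0 : 0 <= del by exact: normr_ge0.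
have C0 := cost_cst_ge0 x.
have cq := @continuous_noise_sq n.+2 w cw.
have iq : mu.-integrable `[s, T] (EFin \o (noise_sq T s n.+2 w)) by exact: continuous_integrable.
have -> : (\int[mu]_(r in `[s, T]) (noise_sq T s n.+2 w r)%:E =
    (\int[mu]_(r in `[s, T]) noise_sq T s n.+2 w r)%:E)%E.
  by rewrite /Rintegral fineK //; exact: integrable_fin_num.
set I := \int[mu]_(r in _) noise_sq _ _ _ _ _.
have I0 : 0 <= I by apply: Rintegral_ge0 => r _; exact: noise_sq_ge0.
have q0 := noise_sq_ge0 T s n.+2 w T.
have l2 : 0 < lambda / 2 by rewrite divr_gt0.
have l2' : 0 < 2 / lambda by rewrite divr_gt0.
have k0 : 0 < 1 + del * (cost_cst x * (2 / lambda)).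
  by apply: ltr_pwDl => //; rewrite mulr_ge0 // mulr_ge0 // ltW.
have Y0 := particle_cost_ge0 Y.
set Th := (\int[mu]_(t in _) _)%E.
have Th0 : (0 <= Th)%E by apply: integral_ge0 => r _; rewrite lee_fin sqr_ge0.
have mth := theta_section basis w.
have mth2 : measurable_fun (`[s, T] : set (measurableTypeR R)) (EFin \o (fun r => wc_theta c r w ^+ 2)).
  by apply/measurable_EFinP; apply: measurable_funX.
have [Thoo|Thfin] := eqVneq Th +oo%E.
  by rewrite Thoo !gt0_muley ?lte_fin // !addey // !gt0_muley ?lte_fin // addye // leey.
have ith2 : mu.-integrable `[s, T] (EFin \o (fun r => wc_theta c r w ^+ 2)).
  apply/integrableP; split => //.
  apply: (@le_lt_trans _ _ Th); last by rewrite ltey.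
  by rewrite le_eqVlt; apply/orP; left; apply/eqP; apply: eq_integral => r _; rewrite /= normrX.
have ith : mu.-integrable `[s, T] (EFin \o (fun r => wc_theta c r w)).
  have ic : mu.-integrable `[s, T] (EFin \o (fun _ : R => (1 : R))).
    by apply: continuous_integrable => ?; exact: cvg_cst.
  have ih := real_integrableD m_sT ic ith2.
  apply: (le_integrable _ _ _ ih) => //; first by apply/measurable_EFinP; exact: mth.
  move=> r _; rewrite lee_fin [leRHS]ger0_norm; last by rewrite addr_ge0 // sqr_ge0.
  rewrite -(real_normK (num_real (wc_theta c r w))).
  by have := sqr_ge0 (1 - `|wc_theta c r w|); have := normr_ge0 (wc_theta c r w); rewrite !expr2; lra.
have ThE : Th = (\int[mu]_(r in `[s, T]) (wc_theta c r w ^+ 2))%:E.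
  rewrite /Rintegral fineK; last exact: integrable_fin_num.
  by apply: eq_integral => r _; rewrite real_normK ?num_real.
have := particle_cost_difference cw pX pY ith ith2 h1 h2.
rewrite ThE -/I -/del; move: (particle_cost X) (particle_cost Y) Y0 => pcX pcY Y0.
have : 0 <= \int[mu]_(r in `[s, T]) (wc_theta c r w ^+ 2).
  by apply: Rintegral_ge0 => r _; exact: sqr_ge0.
move: (\int[mu]_(r in _) _) => t t0 H.
rewrite -!(EFinM, EFinD) lee_fin.
have h : 0 <= del * (cost_cst x * (2 / lambda)) * pcY.
  by rewrite mulr_ge0 // mulr_ge0 // mulr_ge0 // ltW.
have e' : del * (cost_cst x * (2 / lambda)) * (pcY + lambda / 2 * t) =
   del * (cost_cst x * (2 / lambda)) * pcY + del * cost_cst x * t.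
  by field; rewrite gt_eqF.
by rewrite [(1 + _) * _]mulrDl mul1r e'; move: H h; lra.
Qed.

End control.
End path_cost.

(** * Continuity of the value in the noise level *)

(** If [I 0] is infinite, the second comparison makes [I e] infinite as well, and [fine] sends both
    to 0. If it is finite, the first comparison bounds [I e] uniformly for [e] in [[0, 1]], which
    turns the multiplicative errors into additive ones. *)
Lemma comparison_continuous (R : realType) (I : R -> \bar R) (a b : R) : 0 <= a -> 0 <= b ->
  (forall e, (0 <= I e)%E) ->
  (forall e : R, 0 <= e <= 1 -> (I e <= (1 + e * a)%:E * I 0%R + (e * b)%:E)%E) ->
  (forall e : R, 0 <= e <= 1 -> (I 0%R <= (1 + e * a)%:E * I e + (e * b)%:E)%E) ->
  exists2 C : R, 0 <= C & forall e : R, 0 <= e <= 1 -> `|fine (I e) - fine (I 0)| <= e * C.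
Proof.
move=> a_ge0 b_ge0 I0 cmp1 cmp2.
have [Ioo|Ifin] := eqVneq (I 0) +oo%E.
  exists 0 => // e he; rewrite mulr0 Ioo.
  have -> : I e = +oo%E.
    apply/eqP; apply: contraT => ne; have := cmp2 e he; rewrite Ioo.
    have ef : I e \is a fin_num by rewrite ge0_fin_numE ?I0 // ltey.
    by rewrite -(fineK ef) -EFinM -EFinD leye_eq.
  by rewrite /= subrr normr0.
have f0 : I 0 \is a fin_num by rewrite ge0_fin_numE ?I0 // ltey.
have v0 e : 0 <= fine (I e) by exact: fine_ge0.
pose B := (1 + a) * fine (I 0) + b.
have B0 : 0 <= B by rewrite addr_ge0 // mulr_ge0 // addr_ge0.
exists (a * B + b); first by rewrite addr_ge0 // mulr_ge0.
move=> e he.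
have ef : I e \is a fin_num.
  rewrite ge0_fin_numE ?I0 //; apply: le_lt_trans (cmp1 e he) _.
  by rewrite -(fineK f0) -EFinM -EFinD ltry.
have := cmp1 e he; have := cmp2 e he; move: (v0 e) (v0 0) B0; rewrite /B.
rewrite -(fineK f0) -(fineK ef) -!(EFinM, EFinD) !lee_fin /=.
move: (fine (I e)) (fine (I 0)) => v w v_ge0 w_ge0 B_ge0 H2 H1.
have [e0 e1] := andP he.
have vB : v <= (1 + a) * w + b.
  apply: (le_trans H1); apply: lerD; last by rewrite ler_piMl.
  by apply: ler_wpM2r => //; rewrite lerD2l ler_piMl.
have wB : w <= (1 + a) * w + b by have := mulr_ge0 a_ge0 w_ge0; lra.
have ea0 : 0 <= e * a by rewrite mulr_ge0.
have m1 := ler_wpM2l ea0 vB; have m2 := ler_wpM2l ea0 wB.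
by rewrite ler_norml; move: H1 H2 m1 m2; lra.
Qed.

Section vanishing_noise.
Context (R : realType) (T lambda sigma K : R) (f : R -> R -> R -> P2 R -> R)
  (L U : R -> R) (CL11 CL10 CL20 CU11 CU10 CU20 : R).
Hypothesis T0 : 0 < T.
Hypothesis lambda0 : 0 < lambda.
Hypothesis K0 : 0 <= K.
Hypothesis fK : drift_lipschitz T K f.
Hypothesis costL : cost_assumption L CL11 CL10 CL20.
Hypothesis costU : cost_assumption U CU11 CU10 CU20.
Variables (s : R) (n : nat) (x : 'rV[R]_n.+1).
Hypothesis sT : 0 <= s <= T.
Let T_ge0 : 0 <= T := ltW T0.

Let Cx := cost_cst T sigma K f CL11 CL10 CU11 CU10 s x.
Let Cx_ge0 : 0 <= Cx := @cost_cst_ge0 R T sigma K f L U _ _ CL20 _ _ CU20 T0 K0 costL costU s n x.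
Let a := Cx * (2 / lambda).
Let b := Cx * (n.+2%:R * (8 * T) * (1 + T) + 1).
Let a_ge0 : 0 <= a. Proof. by rewrite mulr_ge0 // divr_ge0 // ltW. Qed.
Let b_ge0 : 0 <= b.
Proof. by apply: mulr_ge0 => //; rewrite addr_ge0 // !mulr_ge0 // addr_ge0. Qed.

Lemma run_cost_ge0 (c : weak_control R) (w : wc_Om c) (X : R -> 'rV[R]_n.+1) :
  (0 <= run_cost T lambda L U s w X)%E.
Proof.
have ge0i (phi : R -> R) C1 C2 C3 : cost_assumption phi C1 C2 C3 -> forall y, 0 <= phi y.
  by move=> h y; have [] := h y.
apply: adde_ge0; first apply: adde_ge0.
- apply: mule_ge0; first by rewrite lee_fin invr_ge0.
  apply: sume_ge0 => i _; apply: integral_ge0 => t _; rewrite lee_fin; exact: ge0i costL _.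
- apply: mule_ge0; first by rewrite lee_fin invr_ge0.
  apply: sume_ge0 => i _; rewrite lee_fin; exact: ge0i costU _.
- apply: mule_ge0; first by rewrite lee_fin divr_ge0 // ltW.
  by apply: integral_ge0 => t _; rewrite lee_fin sqr_ge0.
Qed.

Lemma J_comparison (c : weak_control R) e1 e2 : `|e1| <= 1 -> `|e2| <= 1 ->
  is_control_basis s T c -> well_posed T sigma f e1 s c -> well_posed T sigma f e2 s c ->
  (J T lambda sigma f L U e1 s c x <=
    (1 + `|e1 - e2| * a)%:E * J T lambda sigma f L U e2 s c x + (`|e1 - e2| * b)%:E)%E.
Proof.
move=> h1 h2 basis wp1 wp2.
have [Q [mQ Q0 EQ aeQ]] := noise_budget sT basis n.+2.
have S1 := xgetPex (fun _ _ => 0) (proj1 (wp1 n x)).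
have S2 := xgetPex (fun _ _ => 0) (proj1 (wp2 n x)).
have p1 := ae_path_solution basis S1; have p2 := ae_path_solution basis S2.
have d0 : 0 <= `|e1 - e2| by exact: normr_ge0.
have k0 : 0 < 1 + `|e1 - e2| * a by apply: ltr_pwDl => //; exact: mulr_ge0.
have mr : measurable_fun setT (fun w => (`|e1 - e2| * Cx)%:E * Q w)%E.
  by apply: emeasurable_funM.
have r0 w : (0 <= (`|e1 - e2| * Cx)%:E * Q w)%E.
  by apply: mule_ge0 => //; rewrite lee_fin mulr_ge0.
have := @lower_integral_affine _ _ R (wc_P c)
  (fun w => run_cost T lambda L U s w (fun t => @state R T sigma f e1 s c n x t w))
  (fun w => run_cost T lambda L U s w (fun t => @state R T sigma f e2 s c n x t w))
  _ _ k0 (fun w => run_cost_ge0 _ _) (fun w => run_cost_ge0 _ _) r0 mr.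
move=> H; apply: le_trans (H _) _.
  move: p1 p2 aeQ; apply: filterS3 => w [cw q1] [_ q2] [_ <-].
  have := run_cost_difference T0 lambda0 K0 fK costL costU sT basis cw q1 q2 h1 h2.
  exact.
apply: leeD => //.
have dC0 : 0 <= `|e1 - e2| * Cx by exact: mulr_ge0.
rewrite ge0_integralZl_EFin //.
apply: (@le_trans _ _ ((`|e1 - e2| * Cx)%:E * (n.+2%:R * (8 * T) * (1 + T) + 1)%:E)%E).
  by apply: lee_wpmul2l; first by rewrite lee_fin.
by rewrite -EFinM -(mulrA `|e1 - e2| Cx).
Qed.

(** The value before [fine] is applied: the comparison has to be made in the extended reals, where
    an infinite infimum is not confused with 0. *)
Definition value_inf (e : R) : \bar R := ereal_inf
  [set j | exists c : weak_control R, admissible T sigma f e s c /\ j = J T lambda sigma f L U e s c x].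

Lemma value_inf_ge0 e : (0 <= value_inf e)%E.
Proof.
apply: le_ereal_inf_tmp => _ [c [_ ->]].
by apply: integral_ge0 => w _; exact: run_cost_ge0.
Qed.

Lemma value_inf_comparison e1 e2 : `|e1| <= 1 -> `|e2| <= 1 ->
  (value_inf e1 <= (1 + `|e1 - e2| * a)%:E * value_inf e2 + (`|e1 - e2| * b)%:E)%E.
Proof.
move=> h1 h2.
have k0 : 0 < 1 + `|e1 - e2| * a by apply: ltr_pwDl => //; exact: mulr_ge0.
rewrite -leeBlDr // -lee_pdivrMl //.
apply: le_ereal_inf_tmp => _ [c [[basis wp2] ->]].
rewrite lee_pdivrMl // leeBlDr //.
have wp1 : well_posed T sigma f e1 s c := well_posed_transfer T0 K0 fK sT basis e1 wp2.
apply: le_trans (J_comparison h1 h2 basis wp1 wp2).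
by apply: ereal_inf_lbound; exists c.
Qed.

Lemma value_vanishing_noise : exists2 C : R, 0 <= C &
  forall e : R, 0 <= e <= 1 -> `|V T lambda sigma f L U e s x - V T lambda sigma f L U 0 s x| <= e * C.
Proof.
have h0 : `|0 : R| <= 1 by rewrite normr0.
have norm_e (e : R) : 0 <= e <= 1 -> `|e| <= 1 by move=> /andP[e0 e1]; rewrite ger0_norm.
apply: (@comparison_continuous R value_inf a b a_ge0 b_ge0 value_inf_ge0) => e he.
  have := value_inf_comparison (norm_e e he) h0.
  by rewrite subr0 ger0_norm //; case/andP: he.
have := value_inf_comparison h0 (norm_e e he).
by rewrite sub0r normrN ger0_norm //; case/andP: he.
Qed.

End vanishing_noise.

(** * The matching bound for the value function without idiosyncratic noise *)

Section value_lipschitz.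
Context (R : realType) (T lambda sigma : R) (f : R -> R -> R -> P2 R -> R)
  (fmu : R -> R -> R -> P2 R -> R -> R) (L U : R -> R)
  (CL11 CL10 CL20 CU11 CU10 CU20 C2 : R).
Hypothesis T0 : 0 < T.
Hypothesis lambda0 : 0 < lambda.
Hypothesis standing : standing_assumption T f fmu L U CL11 CL10 CL20 CU11 CU10 CU20.
Hypothesis grad : gradient_bound T lambda sigma f L U CL11 CL10 CU11 CU10 C2.

(** The sign of [C2] is not prescribed. For a single particle at the origin the gradient bound says
    that the sum of the two constants is nonnegative; if [C2] is negative, both are nonpositive and
    therefore zero. *)
Lemma gradient_cst_ge0 : 0 <= C2 * (CL11 + CU11) /\ 0 <= C2 * (CL10 + CU10).
Proof.
have [_ _ costL costU _] := standing.
have [L1 L0] := cost_coef_ge0 costL; have [U1 U0] := cost_coef_ge0 costU.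
have t0 : 0 <= (0 : R) <= T by rewrite lexx ltW.
have [_ G0] := grad ord0 (0 : 'rV[R]_1) ltr01 t0.
have := le_trans (normr_ge0 _) G0; rewrite /G.
rewrite big_ord_recl big_ord0 mxE normr0 expr0n /= !addr0 mulr0 addr0 sqrtr1 !divr1 mulr1 => H.
have [C0|C0] := leP 0 C2; first by split; rewrite mulr_ge0 // addr_ge0.
have h1 : C2 * (CL11 + CU11) <= 0 by rewrite nmulr_rle0 // addr_ge0.
have h2 : C2 * (CL10 + CU10) <= 0 by rewrite nmulr_rle0 // addr_ge0.
by split; move: H h1 h2; lra.
Qed.

Lemma value_lipschitz t n (x y : 'rV[R]_n.+1) : 0 <= t <= T ->
  `|V T lambda sigma f L U 0 t y - V T lambda sigma f L U 0 t x| <=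
    (C2 * (CL11 + CU11) * (1 + (mean (fun i => x 0 i ^+ 2) + mean (fun i => y 0 i ^+ 2)) / 2)
      + C2 * (CL10 + CU10)) * Num.sqrt (mean (fun i => (y 0 i - x 0 i) ^+ 2)).
Proof.
move=> tT; have [_ bd costL costU _] := standing.
have [K K0 fK] := bounded_derivatives_lipschitz T0 bd.
have [a0 b0] := gradient_cst_ge0.
have [Cx Cx0 Hx] := value_vanishing_noise sigma T0 lambda0 K0 fK costL costU x tT.
have [Cy Cy0 Hy] := value_vanishing_noise sigma T0 lambda0 K0 fK costL costU y tT.
apply/ler_addgt0Pr => e e0.
(* The noise level is small enough for the errors at [x] and at [y] to add up to at most [e]. *)
pose eps := Num.min 1 (e / (Cx + Cy + 1)).
have D0 : 0 < Cx + Cy + 1 by rewrite ltr_wpDl // addr_ge0.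
have eps0 : 0 < eps by rewrite lt_min ltr01 divr_gt0.
have eps1 : 0 <= eps <= 1 by rewrite (ltW eps0) ge_min lexx.
have epsD : eps * (Cx + Cy + 1) <= e.
  by rewrite -ler_pdivlMr // ge_min lexx orbT.
have gp : forall i z, derivable (fun z : 'rV[R]_n.+1 => V T lambda sigma f L U eps t z) z (delta_mx 0 i) /\
    `|'D_(delta_mx 0 i) (fun z : 'rV[R]_n.+1 => V T lambda sigma f L U eps t z) z| <=
     C2 * (CL11 + CU11) / n.+1%:R *
      Num.sqrt (1 + `|z 0 i| ^+ 2 + n.+1%:R^-1 * \sum_j `|z 0 j| ^+ 2) + C2 * (CL10 + CU10) / n.+1%:R.
  by move=> i z; exact: (grad i z eps0 tT).
have := gradient_path_bound a0 b0 gp x y.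
move: (Hx _ eps1) (Hy _ eps1).
set B := (_ + _) * Num.sqrt _.
move: (V T lambda sigma f L U eps t x) (V T lambda sigma f L U eps t y).
move: (V T lambda sigma f L U 0 t x) (V T lambda sigma f L U 0 t y) => v0x v0y vx vy h1 h2 h3.
have -> : v0y - v0x = (vy - vx) - (vy - v0y) + (vx - v0x) by ring.
apply: le_trans (ler_normD _ _) _; apply: le_trans (lerD (ler_normB _ _) (lexx _)) _.
have eps_ge0 := ltW eps0; move: h1 h2 h3 epsD; lra.
Qed.

End value_lipschitz.

(** * Approximation of couplings by matchings *)

Lemma empirical_weights (R : realType) (X : Type) (m N : nat) (k : 'I_m -> nat)
    (v : 'I_m -> X) (v0 : X) : (\sum_j k j <= N.+1)%N ->
  exists e : 'I_N.+1 -> X, forall g : X -> R,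
    \sum_i g (e i) = \sum_j (k j)%:R * g (v j) + (N.+1 - \sum_j k j)%:R * g v0.
Proof.
move=> kN; pose l := flatten [seq nseq (k j) (v j) | j <- enum 'I_m] ++ nseq (N.+1 - \sum_j k j) v0.
have sl (g : X -> R) : \sum_(x <- l) g x = \sum_j (k j)%:R * g (v j) + (N.+1 - \sum_j k j)%:R * g v0.
  have it (q : nat) y : iter q (+%R (g y)) 0 = q%:R * g y by rewrite mulr_natl iter_addr_0.
  rewrite big_cat big_flatten big_map /= big_nseq it; congr (_ + _).
  by rewrite big_enum; apply: eq_bigr => j _; rewrite big_nseq it.
have size_l : size l = N.+1.
  rewrite size_cat size_nseq size_flatten /shape -map_comp sumnE big_map big_enum /=.
  by under eq_bigr do rewrite size_nseq; rewrite subnKC.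
exists (fun i => nth v0 l i) => g.
by rewrite -sl (big_nth v0) size_l big_mkord.
Qed.

Section wasserstein.
Context (R : realType).
Implicit Types mu nu : P2 R.

Lemma measurable_sq : measurable_fun setT (fun y : R => (y ^+ 2)%:E).
Proof. by apply/measurable_EFinP; exact: exprn_measurable. Qed.

Lemma ge0_integral_law d (S : measurableType d) (P : probability S R) (X : S -> R) mu
    (h : R -> \bar R) : measurable_fun setT X ->
  (forall A, measurable A -> P (X @^-1` A) = mu A) ->
  measurable_fun setT h -> (forall y, (0 <= h y)%E) ->
  (\int[P]_z h (X z) = \int[mu]_y h y)%E.
Proof.
move=> mX lX mh h0.
have := @ge0_integral_pushforward _ _ _ _ R X mX P setT h measurableT mh.
rewrite preimage_setT => <-; last by move=> y _; exact: h0.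
by apply: eq_measure_integral => A mA _; exact: lX.
Qed.

Lemma coupling_fst mu nu g A : coupling mu nu g -> measurable A -> g (fst @^-1` A) = mu A.
Proof.
move=> cg mA; rewrite -(proj1 (cg A mA)); congr (g _).
by apply/seteqP; split => z //= [].
Qed.

Lemma coupling_snd mu nu g A : coupling mu nu g -> measurable A -> g (snd @^-1` A) = nu A.
Proof.
move=> cg mA; rewrite -(proj2 (cg A mA)); congr (g _).
by apply/seteqP; split => z //= [].
Qed.

Lemma ge0_integral_coupling_fst mu nu g (h : R -> \bar R) : coupling mu nu g ->
  measurable_fun setT h -> (forall y, (0 <= h y)%E) ->
  (\int[g]_z h z.1 = \int[mu]_y h y)%E.
Proof.
by move=> cg; apply: ge0_integral_law => [|A]; [exact: measurable_fst|exact: coupling_fst cg].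
Qed.

Lemma ge0_integral_coupling_snd mu nu g (h : R -> \bar R) : coupling mu nu g ->
  measurable_fun setT h -> (forall y, (0 <= h y)%E) ->
  (\int[g]_z h z.2 = \int[nu]_y h y)%E.
Proof.
by move=> cg; apply: ge0_integral_law => [|A]; [exact: measurable_snd|exact: coupling_snd cg].
Qed.

Lemma second_momentE mu : (\int[mu]_y (y ^+ 2)%:E = (second_moment mu)%:E)%E.
Proof.
rewrite /second_moment /Rintegral fineK // ge0_fin_numE; first exact: P2_fin.
by apply: integral_ge0 => y _; rewrite lee_fin sqr_ge0.
Qed.

Lemma transport_cost_ge0 (g : probability (R * R)%type R) : (0 <= transport_cost g)%E.
Proof. by apply: integral_ge0 => z _; rewrite lee_fin sqr_ge0. Qed.

Lemma measurable_cost : measurable_fun setT (fun z : R * R => ((z.2 - z.1) ^+ 2)%:E).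
Proof.
apply/measurable_EFinP; apply: measurable_funX; apply: measurable_funB; [exact: measurable_snd|exact: measurable_fst].
Qed.

Lemma transport_cost_fin mu nu g : coupling mu nu g -> transport_cost g \is a fin_num.
Proof.
move=> cg; rewrite ge0_fin_numE ?transport_cost_ge0 //.
have m1 : measurable_fun setT (fun z : R * R => (2%:E * (z.1 ^+ 2)%:E)%E).
  by apply: emeasurable_funM => //; apply: measurableT_comp measurable_sq _; exact: measurable_fst.
have m2 : measurable_fun setT (fun z : R * R => (2%:E * (z.2 ^+ 2)%:E)%E).
  by apply: emeasurable_funM => //; apply: measurableT_comp measurable_sq _; exact: measurable_snd.
apply: (@le_lt_trans _ _ (\int[g]_z (2%:E * (z.1 ^+ 2)%:E + 2%:E * (z.2 ^+ 2)%:E))%E).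
  apply: ge0_le_integral => //.
  - by move=> z _; rewrite lee_fin sqr_ge0.
  - exact: measurable_cost.
  - exact: emeasurable_funD.
  move=> z _; rewrite -!(EFinM, EFinD) lee_fin; have := sqr_ge0 (z.1 + z.2); rewrite !expr2; lra.
rewrite ge0_integralD //; try by move=> z _; rewrite -EFinM lee_fin mulr_ge0 // sqr_ge0.
rewrite (@ge0_integral_coupling_fst mu nu g (fun y => 2%:E * (y ^+ 2)%:E)%E) //; last 2 first.
- by apply: emeasurable_funM => //; exact: measurable_sq.
- by move=> y; rewrite -EFinM lee_fin mulr_ge0 // sqr_ge0.
rewrite (@ge0_integral_coupling_snd mu nu g (fun y => 2%:E * (y ^+ 2)%:E)%E) //; last 2 first.
- by apply: emeasurable_funM => //; exact: measurable_sq.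
- by move=> y; rewrite -EFinM lee_fin mulr_ge0 // sqr_ge0.
rewrite !ge0_integralZl_EFin //; try exact: measurable_sq; try by move=> y _; rewrite lee_fin sqr_ge0.
by rewrite !second_momentE -!(EFinM, EFinD) ltry.
Qed.

Lemma W2_le mu nu g (c : R) : coupling mu nu g -> (transport_cost g <= c%:E)%E ->
  W2 mu nu <= Num.sqrt c.
Proof.
move=> cg gc; apply: ler_wsqrtr.
have inf_c : (ereal_inf [set transport_cost g | g in coupling mu nu] <= c%:E)%E.
  by apply: le_trans gc; apply: ereal_inf_lbound; exists g.
have inf0 : (0 <= ereal_inf [set transport_cost g | g in coupling mu nu])%E.
  by apply: le_ereal_inf_tmp => _ [h _ <-]; exact: transport_cost_ge0.
rewrite -lee_fin fineK // ge0_fin_numE //; exact: le_lt_trans inf_c (ltry _).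
Qed.

Lemma exists_coupling mu nu : exists g, coupling mu nu g.
Proof.
exists (mu \x nu : probability (R * R)%type R)%E => A mA.
have E1 := product_measure1E mu nu mA measurableT.
have E2 := product_measure1E mu nu measurableT mA.
split.
  rewrite -[RHS]mule1; exact: (etrans E1 (f_equal (fun q => mu A * q)%E (probability_setT nu))).
by rewrite -[RHS]mul1e; exact: (etrans E2 (f_equal (fun q => q * nu A)%E (probability_setT mu))).
Qed.

Lemma near_optimal_coupling mu nu (d : R) : 0 < d ->
  exists2 g, coupling mu nu g & (transport_cost g <= (W2 mu nu ^+ 2 + d)%:E)%E.
Proof.
move=> d0; pose S := [set transport_cost g | g in coupling mu nu].
have inf0 : (0 <= ereal_inf S)%E.
  by apply: le_ereal_inf_tmp => _ [h _ <-]; exact: transport_cost_ge0.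
have fin : ereal_inf S \is a fin_num.
  have [g cg] := exists_coupling mu nu.
  rewrite ge0_fin_numE //; apply: (@le_lt_trans _ _ (transport_cost g)).
    by apply: ereal_inf_lbound; exists g.
  by rewrite -ge0_fin_numE ?transport_cost_ge0 //; exact: transport_cost_fin cg.
have [_ [g cg <-] gd] := lb_ereal_inf_adherent d0 fin.
exists g => //; rewrite /W2 -/S sqr_sqrtr ?fine_ge0 // EFinD fineK //; exact: ltW.
Qed.

Section joint_law.
Context d (Om : measurableType d) (P : probability Om R) (X Y : Om -> R).
Hypothesis mX : measurable_fun setT X.
Hypothesis mY : measurable_fun setT Y.

Definition joint_map (w : Om) : R * R := (X w, Y w).

Lemma measurable_joint_map : measurable_fun setT joint_map.
Proof. exact: measurable_fun_pair. Qed.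

HB.instance Definition _ := isMeasurableFun.Build _ _ _ _ joint_map measurable_joint_map.

(** The joint law of two random variables is a coupling of their laws, so the L^2 distance on any
    probability space bounds the Wasserstein distance. *)
Lemma W2_joint_law mu nu (c : R) :
  (forall A, measurable A -> P (X @^-1` A) = mu A) ->
  (forall A, measurable A -> P (Y @^-1` A) = nu A) ->
  (\int[P]_w ((Y w - X w) ^+ 2)%:E <= c%:E)%E -> W2 mu nu <= Num.sqrt c.
Proof.
move=> lX lY h; apply: (@W2_le mu nu (distribution P joint_map)).
  move=> A mA; rewrite /distribution /pushforward; split.
    by rewrite -lX //; congr (P _); apply/seteqP; split => w //= [].
  by rewrite -lY //; congr (P _); apply/seteqP; split => w //= [].
rewrite /transport_cost ge0_integral_distribution //; first exact: measurable_cost.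
by move=> z; rewrite lee_fin sqr_ge0.
Qed.

End joint_law.

End wasserstein.

(** * Rounding the line to finitely many values *)

Section simple_rounding.
Context (R : realType).
Import HBNNSimple.

Let pospart (y : R) : \bar R := (Num.max y 0)%:E.
Let mpospart : measurable_fun setT pospart.
Proof. by apply/measurable_EFinP; apply: measurable_maxr. Qed.
Let g n : R -> R := nnsfun_approx measurableT mpospart n.

Let g_ge0 n y : 0 <= g n y. Proof. exact: fun_ge0. Qed.

Let g_cvg y : g n y @[n --> \oo] --> Num.max y 0.
Proof.
have h0 x : setT x -> (0 <= pospart x)%E by move=> _; rewrite lee_fin le_max lexx orbT.
by have /fine_cvgP[_] := cvg_nnsfun_approx measurableT mpospart h0 (x := y) I.
Qed.

Let g_le n y : g n y <= Num.max y 0.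
Proof.
have nd : nondecreasing_seq (fun n => g n y).
  move=> m p mp; have := nd_nnsfun_approx measurableT mpospart mp.
  by move=> /lefP /(_ y).
have cv : cvgn (fun n => g n y) by apply/cvg_ex; eexists; exact: g_cvg.
have := nondecreasing_cvgn_le nd cv n.
by rewrite (cvg_lim (@norm_hausdorff _ _) (@g_cvg y)).
Qed.

(** Simple approximations from below of the positive and the negative part. Rounding thus moves
    every point towards the origin: second moments do not increase, and the squared error is
    dominated by [y^2]. *)
Definition rounding n (y : R) : R := g n y - g n (- y).

Lemma measurable_rounding n : measurable_fun setT (rounding n).
Proof.
apply: measurable_funB; first exact: measurable_funPT.
by apply: (@measurableT_comp _ _ _ _ _ _ (g n)); [exact: measurable_funPT|exact: oppr_measurable].
Qed.

Lemma rounding_range n : exists s : seq R, forall y, rounding n y \in s.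
Proof.
have /finite_seqP[s sE] := @fimfunP _ _ (nnsfun_approx measurableT mpospart n).
exists [seq a - b | a <- s, b <- s] => y; apply: allpairs_f.
  by have : range (g n) (g n y) by []; rewrite sE.
by have : range (g n) (g n (- y)) by []; rewrite sE.
Qed.

Lemma rounding_cvg y : rounding n y @[n --> \oo] --> y.
Proof.
have e : Num.max y 0 - Num.max (- y) 0 = y.
  have [h|h] := leP 0 y.
    by rewrite max_r ?oppr_le0 // subr0.
  by rewrite max_l ?oppr_ge0 ?(ltW h) // sub0r opprK.
suff : rounding n y @[n --> \oo] --> Num.max y 0 - Num.max (- y) 0 by rewrite e.
by apply: cvgB; exact: g_cvg.
Qed.

Lemma rounding_sq_le n y : rounding n y ^+ 2 <= y ^+ 2 /\ (y - rounding n y) ^+ 2 <= y ^+ 2.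
Proof.
have h1 := g_ge0 n y; have h2 := g_ge0 n (- y); have h3 := g_le n y; have h4 := g_le n (- y).
rewrite /rounding; case: (leP 0 y) => y0.
  rewrite max_l // in h3; rewrite max_r ?oppr_le0 // in h4.
  have -> : g n (- y) = 0 by apply/eqP; rewrite eq_le h4.
  rewrite subr0; split; rewrite ler_sqr ?nnegrE //; rewrite ?subr_ge0 // lerBlDr; lra.
rewrite max_r ?(ltW y0) // in h3; rewrite max_l ?oppr_ge0 ?(ltW y0) // in h4.
have -> : g n y = 0 by apply/eqP; rewrite eq_le h3.
rewrite sub0r opprK sqrrN -[y ^+ 2]sqrrN; split.
  by rewrite ler_sqr ?nnegrE // oppr_ge0 ltW.
have -> : (y + g n (- y)) ^+ 2 = (- y - g n (- y)) ^+ 2 by ring.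
by rewrite ler_sqr ?nnegrE ?subr_ge0 // ?oppr_ge0 ?(ltW y0) //; lra.
Qed.

Lemma rounding_error (mu : P2 R) :
  (\int[mu]_y ((y - rounding n y) ^+ 2)%:E)%E @[n --> \oo] --> 0%E.
Proof.
have := @dominated_cvg _ _ R mu setT measurableT
  (fun n y => ((y - rounding n y) ^+ 2)%:E) (fun=> 0%E) (fun y => (y ^+ 2)%:E).
rewrite integral0; apply.
- move=> n; apply/measurable_EFinP; apply: measurable_funX; apply: measurable_funB => //.
  exact: measurable_rounding.
- move=> y _; apply: cvg_EFin; first by near=> n.
  rewrite /= (_ : 0 = (y - y) ^+ 2); last by rewrite subrr expr0n.
  have h : y - rounding n y @[n --> \oo] --> y - y by apply: cvgB; [exact: cvg_cst|exact: rounding_cvg].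
  exact: (cvgM h h).
- by [].
- apply/integrableP; split; first exact: measurable_sq.
  under eq_integral do rewrite gee0_abs ?lee_fin ?sqr_ge0 //.
  exact: P2_fin.
- by move=> n y _; rewrite gee0_abs ?lee_fin ?sqr_ge0 //; have [_] := rounding_sq_le n y.
Unshelve. all: by end_near. Qed.

Lemma simple_rounding (mu nu : P2 R) (d : R) : 0 < d -> exists r : R -> R,
  [/\ measurable_fun setT r, exists s : seq R, forall y, r y \in s,
    forall y, r y ^+ 2 <= y ^+ 2,
    (\int[mu]_y ((y - r y) ^+ 2)%:E <= d%:E)%E & (\int[nu]_y ((y - r y) ^+ 2)%:E <= d%:E)%E].
Proof.
move=> d0.
have near_d (m : P2 R) : \forall n \near \oo, (\int[m]_y ((y - rounding n y) ^+ 2)%:E <= d%:E)%E.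
  have := rounding_error m; move/fine_cvgP => [finm /cvgrPdist_lt cvm].
  near=> n.
  have fn : (\int[m]_y ((y - rounding n y) ^+ 2)%:E)%E \is a fin_num by near: n; exact: finm.
  rewrite -(fineK fn) lee_fin; apply: le_trans (ler_norm _) _; apply: ltW.
  have -> : `|fine (\int[m]_y ((y - rounding n y) ^+ 2)%:E)%E| =
     `|0 - fine (\int[m]_y ((y - rounding n y) ^+ 2)%:E)%E| by rewrite sub0r normrN.
  by near: n; exact: (cvm d d0).
have [n [h1 h2]] : exists n, (\int[mu]_y ((y - rounding n y) ^+ 2)%:E <= d%:E)%E /\
    (\int[nu]_y ((y - rounding n y) ^+ 2)%:E <= d%:E)%E.
  by have [N _ H] := filterI (near_d mu) (near_d nu); exists N; apply: H => /=.
exists (rounding n); split => //; first exact: measurable_rounding.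
  exact: rounding_range.
by move=> y; have [] := rounding_sq_le n y.
Unshelve. all: by end_near. Qed.

End simple_rounding.

(** * Randomised choice between two maps *)

Section mixture.
Context (R : realType) d (S : measurableType d) (gam : probability S R) (rho : S -> R).
Hypothesis mrho : measurable_fun setT rho.
Hypothesis rho01 : forall z, 0 <= rho z <= 1.

Definition unif01 : probability (measurableTypeR R) R := uniform_prob (ltr01 : 0 < 1 :> R).

(** The second coordinate, uniform on [[0, 1]] and independent of the first, selects [F1] with
    probability [rho] and [F0] otherwise. *)
Definition mix (T : Type) (F1 F0 : S -> T) (w : S * measurableTypeR R) : T :=
  if w.2 <= rho w.1 then F1 w.1 else F0 w.1.

Lemma measurable_mix d' (T : measurableType d') (F1 F0 : S -> T) : measurable_fun setT F1 ->
  measurable_fun setT F0 -> measurable_fun setT (mix F1 F0).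
Proof.
move=> m1 m0; apply: measurable_fun_ifT.
- apply: measurable_fun_ler; first by have := @measurable_snd _ _ S (measurableTypeR R); apply.
  by apply: measurableT_comp => //; exact: measurable_fst.
- by apply: measurableT_comp => //; exact: measurable_fst.
- by apply: measurableT_comp => //; exact: measurable_fst.
Qed.

Lemma integral_threshold (t a b : R) : 0 <= t <= 1 -> 0 <= a -> 0 <= b ->
  (\int[unif01]_u (if (u <= t)%R then a else b)%:E = (t * a + (1 - t) * b)%:E)%E.
Proof.
move=> /andP[t0 t1] a0 b0.
have mf : @measurable_fun _ _ (measurableTypeR R) _ setT (fun u : R => (if (u <= t)%R then a else b)%:E).
  apply/measurable_EFinP; apply: measurable_fun_ifT => //.
  by apply: measurable_fun_ler.
rewrite integral_uniform //; last by move=> u; rewrite lee_fin; case: ifP.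
rewrite subr0 invr1 mul1e.
have -> : `[0, 1]%classic = `[0, t] `|` `]t, 1] :> set R.
  by rewrite -itv_bndbnd_setU ?bnd_simp.
rewrite ge0_integral_setU //; last first.
- apply/disj_setPLR => u /=; rewrite !in_itv /= => /andP[_ ut]; rewrite ltNge ut //.
- by move=> u _; rewrite lee_fin; case: ifP.
- exact: measurable_funTS.
rewrite (eq_integral (fun=> a%:E)); last first.
  by move=> u; rewrite inE /= in_itv /= => /andP[_ ->].
rewrite [X in (_ + X)%E](eq_integral (fun=> b%:E)); last first.
  by move=> u; rewrite inE /= in_itv /= => /andP[tu _]; rewrite leNgt tu.
rewrite !integral_cst //= !lebesgue_measure_itv /= !lte_fin.
have -> : (if 0 < t then (t%:E + (- 0)%:E)%E else 0%E) = t%:E.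
  by case: ltP => h; rewrite ?oppr0 ?adde0 //; congr (_%:E); apply/eqP; rewrite eq_le t0 h.
have -> : (if t < 1 then (1%:E + (- t)%:E)%E else 0%E) = (1 - t)%:E.
  by case: ltP => h; rewrite // (_ : t = 1) ?subrr //; apply/eqP; rewrite eq_le t1 h.
by rewrite -!EFinM -EFinD mulrC [b * _]mulrC.
Qed.

Lemma integral_mix (G1 G0 : S -> R) : measurable_fun setT G1 -> measurable_fun setT G0 ->
  (forall z, 0 <= G1 z) -> (forall z, 0 <= G0 z) ->
  (\int[gam \x unif01]_w (mix G1 G0 w)%:E =
    \int[gam]_z (rho z * G1 z + (1 - rho z) * G0 z)%:E)%E.
Proof.
move=> m1 m0 G10 G00; rewrite fubini_tonelli1.
- by apply: eq_integral => z _; rewrite /fubini_F /mix /= integral_threshold.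
- by apply/measurable_EFinP; exact: measurable_mix.
- by move=> w; rewrite lee_fin /mix; case: ifP.
Qed.

End mixture.

(** * From a coupling to a finite matching *)

Section quantization.
Context (R : realType) (gam : probability (R * R)%type R) (r : R -> R) (s : seq R).
Hypothesis mr : measurable_fun setT r.
Hypothesis rs : forall y, r y \in s.

Definition labels : seq (R * R) := undup [seq (a, b) | a <- s, b <- s].
Definition label (j : 'I_(size labels)) : R * R := nth (0, 0) labels j.
Definition cell (j : 'I_(size labels)) : set (R * R) :=
  (fun z => r z.1) @^-1` [set (label j).1] `&` (fun z => r z.2) @^-1` [set (label j).2].
Definition weight j : R := fine (gam (cell j)).

Lemma measurable_round_fst : measurable_fun setT (fun z : R * R => r z.1).
Proof. by apply: measurableT_comp => //; exact: measurable_fst. Qed.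

Lemma measurable_round_snd : measurable_fun setT (fun z : R * R => r z.2).
Proof. by apply: measurableT_comp => //; exact: measurable_snd. Qed.

Lemma measurable_cell j : measurable (cell j).
Proof.
apply: measurableI; rewrite -[X in measurable X]setTI.
  exact: measurable_round_fst.
exact: measurable_round_snd.
Qed.

Lemma exists_label (z : R * R) : exists j, (r z.1, r z.2) = label j.
Proof.
have h : (r z.1, r z.2) \in labels by rewrite mem_undup allpairs_f.
have hi : (index (r z.1, r z.2) labels < size labels)%N by rewrite index_mem.
by exists (Ordinal hi); rewrite /label /= nth_index.
Qed.

Lemma sum_cell (F : 'I_(size labels) -> R) (z : R * R) j : (r z.1, r z.2) = label j ->
  \sum_i \1_(cell i) z * F i = F j.
Proof.
move=> zj; rewrite (bigD1 j) //= big1 => [|i ij].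
  by rewrite addr0 indicE mem_set ?mul1r //; split => /=; rewrite -zj.
rewrite indicE memNset ?mul0r //; case=> /= e1 e2; move/eqP: ij; apply; apply/val_inj/eqP.
rewrite -(nth_uniq (0, 0) (ltn_ord i) (ltn_ord j)) ?undup_uniq //; apply/eqP.
rewrite -/(label i) -/(label j) -zj e1 e2; by case: (label i).
Qed.

Lemma sum_cell_label (g : R * R -> R) (z : R * R) :
  \sum_i \1_(cell i) z * g (label i) = g (r z.1, r z.2).
Proof. by have [j zj] := exists_label z; rewrite (sum_cell _ zj) zj. Qed.

Lemma weight_ge0 j : 0 <= weight j.
Proof. by rewrite fine_ge0. Qed.

Lemma weightE j : gam (cell j) = (weight j)%:E.
Proof. by rewrite /weight fineK // fin_num_measure //; exact: measurable_cell. Qed.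

Lemma integral_cell (F : 'I_(size labels) -> R) : (forall j, 0 <= F j) ->
  (\int[gam]_z (\sum_j \1_(cell j) z * F j)%:E = (\sum_j weight j * F j)%:E)%E.
Proof.
move=> F0; under eq_integral do rewrite -sumEFin.
rewrite ge0_integral_sum //.
- rewrite -sumEFin; apply: eq_bigr => j _.
  under eq_integral do rewrite mulrC EFinM.
  rewrite ge0_integralZl_EFin //.
    have -> : (\int[gam]_z (\1_(cell j) z)%:E = (weight j)%:E)%E.
      by rewrite -weightE integral_indic ?setIT //; exact: measurable_cell.
    by rewrite -EFinM mulrC.
  by apply/measurable_EFinP; apply: measurable_indic; exact: measurable_cell.
- move=> j; apply/measurable_EFinP; apply: measurable_funM => //.
  by apply: measurable_indic; exact: measurable_cell.
- by move=> j z _; rewrite lee_fin mulr_ge0.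
Qed.

Lemma sum_weight : \sum_j weight j = 1.
Proof.
have := @integral_cell (fun=> 1) (fun=> ler01).
under eq_integral do rewrite (sum_cell_label (fun=> 1)).
rewrite integral_cst // mul1e; under [X in _ = X%:E]eq_bigr do rewrite mulr1.
by move=> h; apply/esym/EFin_inj; rewrite -h; exact/esym/probability_setT.
Qed.

Section sampling.
Variables (eta : R) (eta_gt0 : 0 < eta).

(** Large enough for [eta * M * weight j >= 1] in every cell of positive weight, so that rounding
    [M * weight j] down loses at most the fraction [eta] of it. Cells of weight 0 add nothing to the
    sum, the inverse of 0 being 0. *)
Definition sample_size : nat := Num.bound (\sum_j (eta * weight j)^-1).
Local Notation M := (sample_size.+1%:R : R).
(* The sample contains the label of cell j multiplicity j times and is filled up with (0, 0). A point of the cell keeps its label with probability retention j and is sent to (0, 0) otherwise, so that the labels get exactly the weights multiplicity j / M. *)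
Definition multiplicity j : nat := Num.truncn (M * weight j).
Definition retention j : R :=
  if weight j == 0 then 1 else (multiplicity j)%:R / (M * weight j).

Lemma multiplicity_bounds j : (multiplicity j)%:R <= M * weight j < (multiplicity j).+1%:R.
Proof. by apply: truncn_itv; rewrite mulr_ge0 // weight_ge0. Qed.

Lemma retention_bounds j : 0 <= retention j <= 1.
Proof.
rewrite /retention; case: eqP => [_|/eqP w0]; first by rewrite ler01 lexx.
have w_gt0 : 0 < weight j by rewrite lt_neqAle eq_sym w0 weight_ge0.
have Mw : 0 < M * weight j by rewrite mulr_gt0.
apply/andP; split; first by apply: divr_ge0 => //; exact: ltW.
rewrite ler_pdivrMr // mul1r.
by have /andP[] := multiplicity_bounds j.
Qed.

Lemma retention_defect j : 1 - retention j <= eta.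
Proof.
rewrite /retention; case: eqP => [_|/eqP w0]; first by rewrite subrr ltW.
have w_gt0 : 0 < weight j by rewrite lt_neqAle eq_sym w0 weight_ge0.
have Mw : 0 < M * weight j by rewrite mulr_gt0.
have /andP[_ h] := multiplicity_bounds j.
rewrite -[X in X - _](divff (lt0r_neq0 Mw)) -mulrBl ler_pdivrMr //.
have h1 : (eta * weight j)^-1 <= M.
  have ge0 i : 0 <= (eta * weight i)^-1 by rewrite invr_ge0 mulr_ge0 ?weight_ge0 // ltW.
  apply: (@le_trans _ _ (\sum_j (eta * weight j)^-1)).
    by rewrite (bigD1 j) //= lerDl sumr_ge0.
  apply: (@le_trans _ _ sample_size%:R); last by rewrite ler_nat.
  by apply: ltW; apply: archi_boundP; rewrite sumr_ge0.
have h2 : 1 <= eta * (M * weight j).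
  rewrite mulrCA -ler_pdivrMr ?mulr_gt0 // div1r //.
by move: h h2; rewrite -natr1; lra.
Qed.

Lemma retention_weight j : weight j * retention j = (multiplicity j)%:R / M.
Proof.
rewrite /retention; case: eqP => [w0|/eqP w0].
  have /andP[h _] := multiplicity_bounds j; move: h; rewrite w0 mulr0 => h.
  have -> : (multiplicity j)%:R = 0 :> R by apply/eqP; rewrite eq_le h ler0n.
  by rewrite !mul0r.
by rewrite mulrCA invfM [X in _ * X]mulrCA divff // mulr1.
Qed.

Lemma sample : exists p q : 'rV[R]_sample_size.+1, forall g : R * R -> R,
  mean (fun i => g (p 0 i, q 0 i)) =
    \sum_j weight j * (retention j * g (label j) + (1 - retention j) * g (0, 0)).
Proof.
have kM : (\sum_j multiplicity j <= sample_size.+1)%N.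
  rewrite -(ler_nat R) natr_sum -[leRHS]mulr1 -[X in _ * X]sum_weight mulr_sumr; apply: ler_sum => j _.
  by have /andP[] := multiplicity_bounds j.
have [e He] := @empirical_weights R _ _ _ _ label (0, 0) kM.
exists (\row_i (e i).1), (\row_i (e i).2) => g.
have M0 : M != 0 by rewrite pnatr_eq0.
rewrite /mean; under eq_bigr do rewrite !mxE -surjective_pairing.
rewrite (He g) mulrDr mulr_sumr natrB // natr_sum.
have e1 j : weight j * (retention j * g (label j) + (1 - retention j) * g (0, 0)) =
    (multiplicity j)%:R / M * g (label j) + (weight j - (multiplicity j)%:R / M) * g (0, 0).
  by rewrite -retention_weight; ring.
under [RHS]eq_bigr do rewrite e1.
rewrite big_split /= -[in RHS]mulr_suml sumrB sum_weight -mulr_suml.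
congr (_ + _); first by apply: eq_bigr => j _; rewrite mulrA [_^-1 * _]mulrC.
by rewrite mulrA mulrBr mulVf // [_^-1 * _]mulrC.
Qed.

Definition retained (z : R * R) : R := \sum_j \1_(cell j) z * retention j.

Lemma retained_label z j : (r z.1, r z.2) = label j -> retained z = retention j.
Proof. exact: sum_cell. Qed.

Lemma measurable_retained : measurable_fun setT retained.
Proof.
apply: measurable_sum => j; apply: measurable_funM => //.
by apply: measurable_indic; exact: measurable_cell.
Qed.

Lemma retained_bounds z : 0 <= retained z <= 1.
Proof. by have [j zj] := exists_label z; rewrite (retained_label zj) retention_bounds. Qed.

Lemma retained_defect z : 1 - retained z <= eta.
Proof. by have [j zj] := exists_label z; rewrite (retained_label zj) retention_defect. Qed.

(** * Marginals of the sample, with [pr] standing for either projection *)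

Section marginal.
Variables (pr : R * R -> R) (m : P2 R) (d : R) (p : 'rV[R]_sample_size.+1).
Hypothesis mpr : measurable_fun setT pr.
Hypothesis pr_round : forall z, r (pr z) = pr (r z.1, r z.2).
Hypothesis law_pr : forall A, measurable A -> gam (pr @^-1` A) = m A.
Hypothesis r_sq : forall y, r y ^+ 2 <= y ^+ 2.
Hypothesis r_err : (\int[m]_y ((y - r y) ^+ 2)%:E <= d%:E)%E.
Hypothesis sample_p : forall g : R -> R, mean (fun i => g (p 0 i)) =
  \sum_j weight j * (retention j * g (pr (label j)) + (1 - retention j) * g 0).

Let m_rpr : measurable_fun setT (fun z => r (pr z)).
Proof. exact: measurableT_comp. Qed.

Lemma sample_second_moment : mean (fun i => p 0 i ^+ 2) <= second_moment m.
Proof.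
rewrite (sample_p (fun y => y ^+ 2)) expr0n -lee_fin -second_momentE.
apply: (@le_trans _ _ (\sum_j weight j * (pr (label j)) ^+ 2)%:E).
  rewrite lee_fin; apply: ler_sum => j _; apply: ler_wpM2l; first exact: weight_ge0.
  have /andP[h0 h1] := retention_bounds j.
  by rewrite mulr0 addr0 ler_piMl ?sqr_ge0.
rewrite -(@integral_cell (fun j => pr (label j) ^+ 2)); last by move=> j; exact: sqr_ge0.
rewrite -(@ge0_integral_law _ _ _ gam pr m (fun y => (y ^+ 2)%:E)); last 4 first.
- exact: mpr.
- exact: law_pr.
- exact: measurable_sq.
- by move=> y; rewrite lee_fin sqr_ge0.
apply: ge0_le_integral => //.
- by move=> z _; rewrite lee_fin (sum_cell_label (fun l => pr l ^+ 2)) sqr_ge0.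
- under eq_fun do rewrite (sum_cell_label (fun l => pr l ^+ 2)) -pr_round.
  by apply/measurable_EFinP; exact: measurable_funX.
- by apply/measurable_EFinP; exact: measurable_funX.
by move=> z _; rewrite lee_fin (sum_cell_label (fun l => pr l ^+ 2)) -pr_round.
Qed.

Lemma sample_law A : measurable A ->
  (gam \x unif01 R)%E (mix retained (fun z => r (pr z)) (fun=> 0) @^-1` A) = emp p A.
Proof.
move=> mA; rewrite emp_set (sample_p (\1_A)).
have mX : measurable_fun setT (mix retained (fun z => r (pr z)) (fun=> 0)).
  by apply: measurable_mix => //; exact: measurable_retained.
have mXA : measurable (mix retained (fun z => r (pr z)) (fun=> 0) @^-1` A).
  by rewrite -[X in measurable X]setTI; exact: mX.
transitivity (\int[gam \x unif01 R]_w (mix retained (fun z => \1_A (r (pr z))) (fun=> \1_A (0 : R)) w)%:E)%E.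
  rewrite -(setIT (_ @^-1` A)) -integral_indic //; apply: eq_integral => w _.
  have indic_pre (F : (R * R) * measurableTypeR R -> R) : \1_(F @^-1` A) w = \1_A (F w) :> R.
    by rewrite !indicE; congr (_%:R); apply/idP/idP; rewrite !inE.
  by rewrite indic_pre /mix; case: ifP.
rewrite integral_mix //; last 3 first.
- exact: measurable_retained.
- exact: retained_bounds.
- apply: measurableT_comp => //; exact: measurable_indic.
rewrite -(@integral_cell (fun j => retention j * \1_A (pr (label j)) + (1 - retention j) * \1_A 0)).
  apply: eq_integral => z _; have [j zj] := exists_label z.
  by rewrite (sum_cell _ zj) (retained_label zj) pr_round zj.
move=> j; have /andP[h0 h1] := retention_bounds j.
by rewrite addr_ge0 // mulr_ge0 // subr_ge0.
Qed.

(** On the product of [gam] with the uniform law, couple [pr z] with its rounding when the point is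
    retained and with 0 when it is not. The first case costs at most the rounding error [d]; the
    second has probability at most [eta] given [z] and costs [pr z ^+ 2]. *)
Lemma sample_W2 : W2 (emp p) m <= Num.sqrt (d + eta * second_moment m).
Proof.
pose X := mix retained (fun z => r (pr z)) (fun=> 0).
have mX : measurable_fun setT X by apply: measurable_mix => //; exact: measurable_retained.
pose Y (w : (R * R) * measurableTypeR R) := pr w.1.
have mY : measurable_fun setT Y by apply: measurableT_comp => //; exact: measurable_fst.
apply: (@W2_joint_law R _ _ (gam \x unif01 R)%E X Y mX mY).
- exact: sample_law.
- move=> A mA; rewrite -law_pr //.
  have -> : Y @^-1` A = (pr @^-1` A) `*` setT by apply/seteqP; split => w //= [].
  rewrite [LHS]product_measure1E //; last by rewrite -[X in measurable X]setTI; exact: mpr.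
  by rewrite -[RHS]mule1; congr (_ * _)%E; exact: probability_setT.
have -> : (\int[gam \x unif01 R]_w ((Y w - X w) ^+ 2)%:E =
    \int[gam \x unif01 R]_w (mix retained (fun z => (pr z - r (pr z)) ^+ 2) (fun z => pr z ^+ 2) w)%:E)%E.
  by apply: eq_integral => w _; rewrite /X /Y /mix; case: ifP; rewrite ?subr0.
have m1 : measurable_fun setT (fun z => (pr z - r (pr z)) ^+ 2).
  by apply: measurable_funX; exact: measurable_funB.
have m0 : measurable_fun setT (fun z => pr z ^+ 2) by exact: measurable_funX.
rewrite integral_mix //; last 4 first.
- exact: measurable_retained.
- exact: retained_bounds.
- by move=> z; exact: sqr_ge0.
- by move=> z; exact: sqr_ge0.
have e0 := ltW eta_gt0.
apply: (@le_trans _ _ (\int[gam]_z ((pr z - r (pr z)) ^+ 2 + eta * pr z ^+ 2)%:E)%E).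
  apply: ge0_le_integral => //.
  - move=> z _; have /andP[h0 h1] := retained_bounds z.
    by rewrite lee_fin addr_ge0 // mulr_ge0 // ?sqr_ge0 // subr_ge0.
  - apply/measurable_EFinP; apply: measurable_funD; apply: measurable_funM => //.
      exact: measurable_retained.
    by apply: measurable_funB => //; exact: measurable_retained.
  - by apply/measurable_EFinP; apply: measurable_funD => //; apply: measurable_funM.
  move=> z _; have /andP[h0 h1] := retained_bounds z; rewrite lee_fin; apply: lerD.
    by rewrite ler_piMl ?sqr_ge0.
  by apply: ler_wpM2r; [exact: sqr_ge0|exact: retained_defect].
under eq_integral do rewrite EFinD.
rewrite ge0_integralD //; last 4 first.
- by move=> z _; rewrite lee_fin sqr_ge0.
- exact/measurable_EFinP.
- by move=> z _; rewrite lee_fin mulr_ge0 // sqr_ge0.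
- by apply/measurable_EFinP; apply: measurable_funM.
rewrite EFinD; apply: leeD.
  rewrite (@ge0_integral_law _ _ _ gam pr m (fun y => ((y - r y) ^+ 2)%:E)) //.
    by apply/measurable_EFinP; apply: measurable_funX; exact: measurable_funB.
  by move=> y; rewrite lee_fin sqr_ge0.
under eq_integral do rewrite EFinM.
rewrite ge0_integralZl_EFin //; last 2 first.
- by move=> z _; rewrite lee_fin sqr_ge0.
- exact/measurable_EFinP.
rewrite (@ge0_integral_law _ _ _ gam pr m (fun y => (y ^+ 2)%:E)); last 4 first.
- exact: mpr.
- exact: law_pr.
- exact: measurable_sq.
- by move=> y; rewrite lee_fin sqr_ge0.
by rewrite second_momentE EFinM.
Qed.

End marginal.

(** Pairs that are not retained go to [(0, 0)], where the cost is zero, so only rounding can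
    increase the cost. Its effect is controlled by [(a + b)^2 <= (1 + kappa) a^2 + (1 + kappa^-1)
    b^2], with [b] the difference of the two rounding errors. *)
Lemma sample_cost (p q : 'rV[R]_sample_size.+1) (C d1 d2 kappa : R) : 0 < kappa ->
  (forall g : R * R -> R, mean (fun i => g (p 0 i, q 0 i)) =
    \sum_j weight j * (retention j * g (label j) + (1 - retention j) * g (0, 0))) ->
  (transport_cost gam <= C%:E)%E ->
  (\int[gam]_z ((z.1 - r z.1) ^+ 2)%:E <= d1%:E)%E ->
  (\int[gam]_z ((z.2 - r z.2) ^+ 2)%:E <= d2%:E)%E ->
  mean (fun i => (q 0 i - p 0 i) ^+ 2) <= (1 + kappa) * C + (1 + kappa^-1) * (2 * (d1 + d2)).
Proof.
move=> k0 pq hC h1 h2.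
rewrite (pq (fun z => (z.2 - z.1) ^+ 2)) /= subr0 expr0n -lee_fin.
have ki : 0 < kappa^-1 by rewrite invr_gt0.
have msq1 : measurable_fun setT (fun z : R * R => ((z.1 - r z.1) ^+ 2)%:E).
  apply/measurable_EFinP; apply: measurable_funX; apply: measurable_funB => //; exact: measurable_round_fst.
have msq2 : measurable_fun setT (fun z : R * R => ((z.2 - r z.2) ^+ 2)%:E).
  apply/measurable_EFinP; apply: measurable_funX; apply: measurable_funB => //; exact: measurable_round_snd.
apply: (@le_trans _ _ (\sum_j weight j * ((label j).2 - (label j).1) ^+ 2)%:E).
  rewrite lee_fin; apply: ler_sum => j _; apply: ler_wpM2l; first exact: weight_ge0.
  have /andP[r0 r1] := retention_bounds j.
  by rewrite mulr0 addr0 ler_piMl ?sqr_ge0.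
rewrite -(@integral_cell (fun j => ((label j).2 - (label j).1) ^+ 2)); last by move=> j; exact: sqr_ge0.
apply: (@le_trans _ _ (\int[gam]_z ((1 + kappa)%:E * ((z.2 - z.1) ^+ 2)%:E +
   (1 + kappa^-1)%:E * (2%:E * (((z.1 - r z.1) ^+ 2)%:E + ((z.2 - r z.2) ^+ 2)%:E))))%E).
  apply: ge0_le_integral => //.
  - by move=> z _; rewrite lee_fin (sum_cell_label (fun l => (l.2 - l.1) ^+ 2)) sqr_ge0.
  - under eq_fun do rewrite (sum_cell_label (fun l => (l.2 - l.1) ^+ 2)).
    apply/measurable_EFinP; apply: measurable_funX; apply: measurable_funB.
      exact: measurable_round_snd.
    exact: measurable_round_fst.
  - apply: emeasurable_funD; apply: emeasurable_funM => //; first exact: measurable_cost.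
    by apply: emeasurable_funM => //; exact: emeasurable_funD.
  move=> z _; rewrite (sum_cell_label (fun l => (l.2 - l.1) ^+ 2)) /=.
  rewrite -!(EFinM, EFinD) lee_fin.
  set a := z.2 - z.1; set e1 := z.1 - r z.1; set e2 := z.2 - r z.2.
  have -> : r z.2 - r z.1 = a + (e1 - e2) by rewrite /a /e1 /e2; ring.
  have q1 : 2 * a * (e1 - e2) <= kappa * a ^+ 2 + kappa^-1 * (e1 - e2) ^+ 2.
    have : 0 <= kappa^-1 * (kappa * a - (e1 - e2)) ^+ 2 by rewrite mulr_ge0 ?sqr_ge0 // ltW.
    have -> : kappa^-1 * (kappa * a - (e1 - e2)) ^+ 2 =
      kappa * a ^+ 2 + kappa^-1 * (e1 - e2) ^+ 2 - 2 * a * (e1 - e2) by field; rewrite gt_eqF.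
    lra.
  have q2 : (e1 - e2) ^+ 2 <= 2 * (e1 ^+ 2 + e2 ^+ 2).
    by have := sqr_ge0 (e1 + e2); rewrite !expr2; lra.
  have k1 : 0 <= 1 + kappa^-1 by rewrite addr_ge0 // ltW.
  have := ler_wpM2l k1 q2; move: q1; move: (e1 - e2) (e1 ^+ 2 + e2 ^+ 2) (kappa^-1) => b e k'.
  have -> : (a + b) ^+ 2 = a ^+ 2 + 2 * a * b + b ^+ 2 by ring.
  lra.
rewrite ge0_integralD //; last 4 first.
- by move=> z _; rewrite -EFinM lee_fin mulr_ge0 ?sqr_ge0 // addr_ge0 // ltW.
- by apply: emeasurable_funM => //; exact: measurable_cost.
- move=> z _; rewrite -!(EFinM, EFinD) lee_fin mulr_ge0 // ?addr_ge0 // ?(ltW ki) //.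
  by rewrite mulr_ge0 // addr_ge0 // sqr_ge0.
- by apply: emeasurable_funM => //; apply: emeasurable_funM => //; exact: emeasurable_funD.
rewrite ge0_integralZl_EFin //; last 3 first.
- by move=> z _; rewrite lee_fin sqr_ge0.
- exact: measurable_cost.
- by rewrite addr_ge0 // ltW.
rewrite ge0_integralZl_EFin //; last 3 first.
- by move=> z _; rewrite -!(EFinM, EFinD) lee_fin mulr_ge0 // addr_ge0 // sqr_ge0.
- by apply: emeasurable_funM => //; exact: emeasurable_funD.
- by rewrite addr_ge0 // ltW.
rewrite ge0_integralZl_EFin //; last 2 first.
- by move=> z _; rewrite -EFinD lee_fin addr_ge0 // sqr_ge0.
- exact: emeasurable_funD.
rewrite ge0_integralD //; try by move=> z _; rewrite lee_fin sqr_ge0.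
apply: (@le_trans _ _ ((1 + kappa)%:E * C%:E + (1 + kappa^-1)%:E * (2%:E * (d1%:E + d2%:E)))%E); last first.
  by rewrite -!(EFinM, EFinD).
apply: leeD; apply: lee_wpmul2l => //.
- by rewrite lee_fin addr_ge0 // ltW.
- by rewrite lee_fin addr_ge0 // ltW.
by apply: lee_wpmul2l => //; exact: leeD.
Qed.

End sampling.
End quantization.

Lemma second_moment_ge0 (R : realType) (mu : P2 R) : 0 <= second_moment mu.
Proof. by apply: Rintegral_ge0 => y _; exact: sqr_ge0. Qed.

Lemma coupling_quantization (R : realType) (mu nu : P2 R) (gam : probability (R * R)%type R)
    (C d : R) : coupling mu nu gam -> (transport_cost gam <= C%:E)%E -> 0 < d ->
  exists n (p q : 'rV[R]_n.+1),
    [/\ W2 (emp p) mu <= d, W2 (emp q) nu <= d,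
      mean (fun i => p 0 i ^+ 2) <= second_moment mu,
      mean (fun i => q 0 i ^+ 2) <= second_moment nu &
      mean (fun i => (q 0 i - p 0 i) ^+ 2) <= C + d].
Proof.
move=> cg hC d0.
have C0 : 0 <= C by rewrite -lee_fin; exact: le_trans (transport_cost_ge0 _) hC.
have m1 := second_moment_ge0 mu; have m2 := second_moment_ge0 nu.
have C1 : 0 < C + 1 by rewrite ltr_wpDl.
(* The constants are fixed in this order: [kappa] so that [kappa * C <= d / 2], then the rounding
   error [err] so that its contribution to the cost is at most [d / 2] and [err <= d^2 / 2], finally
   [eta] so that [eta] times either second moment is at most [d^2 / 2]. The added 1s exclude zero
   denominators. *)
pose kappa := d / (2 * (C + 1)).
have k0 : 0 < kappa by rewrite divr_gt0 // mulr_gt0.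
have kC : kappa * C <= d / 2.
  have : kappa * (C + 1) = d / 2 by rewrite /kappa; field; rewrite gt_eqF.
  by rewrite mulrDr mulr1 => <-; rewrite lerDl ltW.
pose K := 1 + kappa^-1.
have K0 : 0 < K by rewrite addr_gt0 ?invr_gt0.
pose err := Num.min (d ^+ 2 / 2) (d / (8 * K)).
have err0 : 0 < err by rewrite lt_min !divr_gt0 ?exprn_gt0 ?mulr_gt0.
have errK : K * (2 * (err + err)) <= d / 2.
  have : err <= d / (8 * K) by rewrite ge_min lexx orbT.
  by rewrite ler_pdivlMr ?mulr_gt0 //; lra.
have errd : err <= d ^+ 2 / 2 by rewrite ge_min lexx.
pose eta := d ^+ 2 / (2 * (second_moment mu + second_moment nu + 1)).
have M0 : 0 < second_moment mu + second_moment nu + 1 by rewrite ltr_wpDl // addr_ge0.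
have eta0 : 0 < eta by rewrite divr_gt0 ?exprn_gt0 // mulr_gt0.
have eta_m m : 0 <= m -> m <= second_moment mu + second_moment nu -> eta * m <= d ^+ 2 / 2.
  move=> m_ge0 hm; have e : eta * (second_moment mu + second_moment nu + 1) = d ^+ 2 / 2.
    by rewrite /eta; field; rewrite gt_eqF.
  rewrite -e; apply: ler_wpM2l; first exact: ltW.
  by rewrite (le_trans hm) // lerDl.
have [r [mr [s rs] rsq err1 err2]] := simple_rounding mu nu err0.
have [p [q pq]] := sample gam mr rs eta.
have mfst : measurable_fun setT (@fst R R) by exact: measurable_fst.
have msnd : measurable_fun setT (@snd R R) by exact: measurable_snd.
have law1 A := @coupling_fst R mu nu gam A cg.
have law2 A := @coupling_snd R mu nu gam A cg.
have sqrt_d m : 0 <= m -> m <= second_moment mu + second_moment nu ->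
    Num.sqrt (err + eta * m) <= d.
  move=> m_ge0 hm; rewrite -[leRHS](@ger0_norm _ d) ?(ltW d0) // -sqrtr_sqr; apply: ler_wsqrtr.
  by have := eta_m m m_ge0 hm; lra.
have merr : measurable_fun setT (fun y : R => ((y - r y) ^+ 2)%:E).
  by apply/measurable_EFinP; apply: measurable_funX; exact: measurable_funB.
have err_ge0 (y : R) : (0 <= ((y - r y) ^+ 2)%:E :> \bar R)%E by rewrite lee_fin sqr_ge0.
exists (sample_size gam r s eta), p, q; split.
- apply: le_trans (sqrt_d _ m1 _); last by rewrite lerDl.
  exact: (sample_W2 mr rs eta0 mfst (fun=> erefl) law1 err1 (fun g => pq (g \o fst))).
- apply: le_trans (sqrt_d _ m2 _); last by rewrite lerDr.
  exact: (sample_W2 mr rs eta0 msnd (fun=> erefl) law2 err2 (fun g => pq (g \o snd))).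
- exact: (sample_second_moment mr rs mfst (fun=> erefl) law1 rsq (fun g => pq (g \o fst))).
- exact: (sample_second_moment mr rs msnd (fun=> erefl) law2 rsq (fun g => pq (g \o snd))).
have := @sample_cost R gam r s mr rs eta p q C err err kappa k0 pq hC.
rewrite (ge0_integral_coupling_fst cg merr err_ge0) (ge0_integral_coupling_snd cg merr err_ge0).
move=> /(_ err1 err2) /le_trans; apply.
by rewrite -/K; move: kC errK; lra.
Qed.

(** * Passage to the Wasserstein distance and conclusion *)

(** Continuity of [F] is used only at the two fixed measures, so no modulus of continuity is
    required. Since quantization does not increase second moments, the prefactor of the matching
    bound is at most its value at [mu] and [nu]. *)
Lemma lift_lipschitz (R : realType) (F : P2 R -> R) (a b : R) : 0 <= a -> 0 <= b ->
  (forall mu e, 0 < e -> exists2 d, 0 < d & forall nu, W2 nu mu < d -> `|F nu - F mu| < e) ->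
  (forall n (x y : 'rV[R]_n.+1), `|F (emp y) - F (emp x)| <=
    (a * (1 + (mean (fun i => x 0 i ^+ 2) + mean (fun i => y 0 i ^+ 2)) / 2) + b) *
      Num.sqrt (mean (fun i => (y 0 i - x 0 i) ^+ 2))) ->
  forall mu nu, `|F mu - F nu| <=
    (a * (1 + (second_moment mu + second_moment nu) / 2) + b) * W2 mu nu.
Proof.
move=> a0 b0 Fc Fe mu nu; set W := W2 mu nu.
have W0 : 0 <= W by exact: sqrtr_ge0.
have m1 := second_moment_ge0 mu; have m2 := second_moment_ge0 nu.
set A := a * _ + b.
have A0 : 0 <= A by rewrite addr_ge0 // mulr_ge0 // addr_ge0 // divr_ge0 // addr_ge0.
apply/ler_addgt0Pr => e e0.
have e4 : 0 < e / 4 by rewrite divr_gt0.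
have [d1 d10 F1] := Fc mu _ e4; have [d2 d20 F2] := Fc nu _ e4.
have A1 : 0 < A + 1 by rewrite ltr_wpDl.
pose tau := e / (2 * (A + 1)).
have tau0 : 0 < tau by rewrite divr_gt0 // mulr_gt0.
have Atau : A * tau <= e / 2.
  have : (A + 1) * tau = e / 2 by rewrite /tau; field; rewrite gt_eqF.
  by rewrite mulrDl mul1r => <-; rewrite lerDl ltW.
(* The near-optimal coupling and its quantization each add [d] to the squared cost, and
   [2 d <= tau^2] gives [sqrt (W^2 + 2 d) <= W + tau]. The errors sum to [e / 4 + e / 4 + e / 2]. *)
pose d := Num.min (Num.min (d1 / 2) (d2 / 2)) (tau ^+ 2 / 2).
have d0 : 0 < d by rewrite !lt_min !divr_gt0 // exprn_gt0.
have dd1 : d < d1.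
  apply: (@le_lt_trans _ _ (d1 / 2)); first by rewrite !ge_min lexx.
  by rewrite ltr_pdivrMr // ltr_pMr // ltr1n.
have dd2 : d < d2.
  apply: (@le_lt_trans _ _ (d2 / 2)); first by rewrite !ge_min lexx orbT.
  by rewrite ltr_pdivrMr // ltr_pMr // ltr1n.
have dtau : d <= tau ^+ 2 / 2 by rewrite ge_min lexx orbT.
have [gam cg hg] := near_optimal_coupling mu nu d0.
have [n [p [q [Wp Wq mp mq cost]]]] := coupling_quantization cg hg d0.
have h1 := F1 _ (le_lt_trans Wp dd1); have h2 := F2 _ (le_lt_trans Wq dd2).
have h3 : `|F (emp q) - F (emp p)| <= A * (W + tau).
  apply: (le_trans (Fe n p q)); apply: ler_pM; rewrite ?sqrtr_ge0 //.
  - rewrite addr_ge0 // mulr_ge0 // addr_ge0 // divr_ge0 // addr_ge0 //; apply: mean_ge0 => i; exact: sqr_ge0.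
  - rewrite lerD2r; apply: ler_wpM2l => //; rewrite lerD2l ler_pM2r ?invr_gt0 //; exact: lerD.
  rewrite -[leRHS](@ger0_norm _ (W + tau)) ?addr_ge0 ?(ltW tau0) // -sqrtr_sqr; apply: ler_wsqrtr.
  apply: (le_trans cost); rewrite -/W.
  by have := mulr_ge0 W0 (ltW tau0); move: dtau; rewrite !expr2; lra.
have -> : F mu - F nu = - (F (emp p) - F mu) - (F (emp q) - F (emp p)) + (F (emp q) - F nu) by ring.
apply: le_trans (ler_normD _ _) _; apply: le_trans (lerD (ler_normB _ _) (lexx _)) _.
by rewrite normrN; move: h1 h2 h3 Atau; rewrite mulrDr; lra.
Qed.

Theorem corollary2p4 (R : realType) (T lambda sigma : R)
    (f : R -> R -> R -> P2 R -> R) (fmu : R -> R -> R -> P2 R -> R -> R)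
    (L U : R -> R) (CL11 CL10 CL20 CU11 CU10 CU20 C2 : R)
    (Vc : R -> P2 R -> R)
    (T_gt0 : 0 < T) (lambda_gt0 : 0 < lambda)
    (Hstanding :
       standing_assumption T f fmu L U CL11 CL10 CL20 CU11 CU10 CU20)
    (HR : exists Gam1 Gam2 : R,
       hypothesis_R T lambda f fmu CL11 CL10 CU11 CU10 Gam1 Gam2 \/
       hypothesis_R1 T lambda f fmu L U CL11 CL10 CU11 CU10 Gam1 Gam2)
    (HC2 : gradient_bound T lambda sigma f L U CL11 CL10 CU11 CU10 C2)
    (HVc : is_lift T lambda sigma f L U Vc)
    (x : forall n : nat, 'rV[R]_n.+1) (mu : P2 R)
    (Hx : W2 (emp (x n)) mu @[n --> \oo] --> (0 : R))
    (t : R) (Ht : 0 <= t <= T) :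
  let C71 := C2 * (CL11 + CU11 + CL10 + CU10) in
  let C72 := C2 * (CL11 + CU11) / 2 in
  V T lambda sigma f L U 0 t (x n) @[n --> \oo] --> Vc t mu /\
  forall n : nat,
    `|V T lambda sigma f L U 0 t (x n) - Vc t mu| <=
      C71 * W2 (emp (x n)) mu
      + C72 * (W2 (emp (x n)) mu ^+ 2
               + (second_moment (emp (x n)) + second_moment mu)
                 * W2 (emp (x n)) mu).
Proof.
move=> C71 C72.
have [lift cont] := HVc t Ht.
split.
  apply/cvgrPdist_lt => e e0; have [d d0 near_mu] := cont mu e e0.
  have /cvgrPdist_lt /(_ d d0) := Hx; apply: filterS => n.
  rewrite sub0r normrN ger0_norm ?sqrtr_ge0 // => /near_mu.
  by rewrite lift distrC.
move=> n; have [a0 b0] := gradient_cst_ge0 T_gt0 Hstanding HC2.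
have Fe m (p q : 'rV[R]_m.+1) : `|Vc t (emp q) - Vc t (emp p)| <=
    (C2 * (CL11 + CU11) * (1 + (mean (fun i => p 0 i ^+ 2) + mean (fun i => q 0 i ^+ 2)) / 2)
      + C2 * (CL10 + CU10)) * Num.sqrt (mean (fun i => (q 0 i - p 0 i) ^+ 2)).
  by rewrite !lift; exact: (value_lipschitz T_gt0 lambda_gt0 Hstanding HC2 p q Ht).
have := lift_lipschitz a0 b0 cont Fe (emp (x n)) mu; rewrite lift => /le_trans; apply.
(* With [a = C2 (CL11 + CU11)] and [b = C2 (CL10 + CU10)], expanding the bound of [lift_lipschitz]
   gives [(a + b) W] plus [a / 2] times the sum of second moments times [W]. The stated rate has the
   further nonnegative term [a / 2 * W^2]. *)
set W := W2 _ _; have W2_ge0 : 0 <= C2 * (CL11 + CU11) / 2 * W ^+ 2.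
  by rewrite mulr_ge0 ?sqr_ge0 // divr_ge0.
by move: W2_ge0; rewrite /C71 /C72 !expr2; lra.
Qed.
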